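(* Let $K$ be a field with $\mathrm{char}\,K\neq 2$. Every even-trigonalizable algebraic supergroup over $K$ is solvable.
   Context: ''Super'' means $\mathbb{Z}_2$-graded. $\mathsf{SAlg}_K$ is the category of super-commutative superalgebras over $K$. An affine supergroup $\mathbb{G}$ is a representable group-valued functor on $\mathsf{SAlg}_K$, represented by a super-commutative Hopf superalgebra $K[\mathbb{G}]$; it is an algebraic supergroup if $K[\mathbb{G}]$ is finitely generated. $\mathbb{G}_{ev}$ is the affine group (scheme) represented by $K[\mathbb{G}]/(K[\mathbb{G}]_1)$, where $(K[\mathbb{G}]_1)$ is the ideal generated by the odd component. Closed super-subgroups correspond to quotient Hopf superalgebras of $K[\mathbb{G}]$. For a normal closed super-subgroup $\mathbb{N}$, the quotient $\mathbb{G}/\mathbb{N}$ is represented by the unique Hopf super-subalgebra $B\subset K[\mathbb{G}]$ with $K[\mathbb{G}]/B^+K[\mathbb{G}]=K[\mathbb{N}]$, $B^+=\mathrm{Ker}\,\varepsilon_B$. An algebraic group (scheme) $G$ is trigonalizable if every simple $G$-module is one-dimensional. An algebraic supergroup $\mathbb{G}$ is even-trigonalizable if $\mathbb{G}_{ev}$ is trigonalizable. The derived super-subgroup $\mathcal{D}\mathbb{G}$ of an algebraic supergroup $\mathbb{G}$ is the smallest closed normal super-subgroup $\mathbb{N}$ such that $\mathbb{G}/\mathbb{N}$ is abelian. Put $\mathcal{D}^0\mathbb{G}=\mathbb{G}$ and $\mathcal{D}^r\mathbb{G}=\mathcal{D}(\mathcal{D}^{r-1}\mathbb{G})$ for $r>0$.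 $\mathbb{G}$ is solvable if $\mathcal{D}^r\mathbb{G}=1$ for some $r$. *)

(* Defs.v *)
From HB Require Import structures.
From mathcomp Require Import all_boot all_order all_algebra.
From mathcomp Require Import boolp.

Set Implicit Arguments.
Unset Strict Implicit.
Unset Printing Implicit Defensive.

Import GRing.Theory.
Local Open Scope ring_scope.
Local Open Scope quotient_scope.

Section Tensor.
Variables (K : comNzRingType) (V W : lmodType K).

Definition bilinear_map (U : lmodType K) (b : V -> W -> U) : Prop :=
  (forall w, linear (b^~ w)) /\ (forall v, linear (b v)).

(* The list [:: (v1, w1); ...; (vn, wn)] stands for the sum of the vi (x) wi;
   two such sums are equal iff every bilinear map identifies them. *)
Definition formal_sum := seq (V * W).

Definition formal_eval (U : lmodType K) (b : V -> W -> U) (s : formal_sum) : U :=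
  \sum_(p <- s) b p.1 p.2.

Definition tensor_rel (s t : formal_sum) : bool :=
  `[< forall (U : lmodType K) (b : V -> W -> U),
        bilinear_map b -> formal_eval b s = formal_eval b t >].

Fact tensor_rel_refl : reflexive tensor_rel.
Proof. by move=> s; apply/asboolP. Qed.

Fact tensor_rel_sym : symmetric tensor_rel.
Proof. by move=> s t; apply/asboolP/asboolP => h U b /h. Qed.

Fact tensor_rel_trans : transitive tensor_rel.
Proof.
by move=> t s u /asboolP h /asboolP h'; apply/asboolP => U b bb; rewrite h// h'.
Qed.

Canonical tensor_equiv :=
  EquivRel tensor_rel tensor_rel_refl tensor_rel_sym tensor_rel_trans.

Definition tensor := {eq_quot tensor_equiv}.

HB.instance Definition _ := Choice.on tensor.
HB.instance Definition _ := EqQuotient.on tensor.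

Lemma tensor_eqP (s t : formal_sum) :
  reflect (forall (U : lmodType K) (b : V -> W -> U),
             bilinear_map b -> formal_eval b s = formal_eval b t)
          (\pi_tensor s == \pi_tensor t).
Proof. by rewrite eqmodE; apply: asboolP. Qed.

Definition tens (v : V) (w : W) : tensor := \pi_tensor [:: (v, w)].

Definition tensor_zero : tensor := \pi_tensor [::].
Definition tensor_add (x y : tensor) : tensor := \pi_tensor (repr x ++ repr y).
Definition tensor_scale (c : K) (x : tensor) : tensor :=
  \pi_tensor [seq (c *: p.1, p.2) | p <- repr x].

(* The linear map induced by [b]; only meaningful when [b] is bilinear. *)
Definition tensor_lift (U : lmodType K) (b : V -> W -> U) (x : tensor) : U :=
  formal_eval b (repr x).

Lemma tensor_lift_pi (U : lmodType K) (b : V -> W -> U) (s : formal_sum) :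
  bilinear_map b -> tensor_lift b (\pi_tensor s) = formal_eval b s.
Proof.
move=> bb; have /eqP/tensor_eqP h : \pi_tensor (repr (\pi_tensor s)) = \pi_tensor s.
  exact: reprK.
exact: h.
Qed.

Lemma tensor_lift_inj (x y : tensor) :
  (forall (U : lmodType K) (b : V -> W -> U),
     bilinear_map b -> tensor_lift b x = tensor_lift b y) -> x = y.
Proof.
by move=> h; rewrite -[x]reprK -[y]reprK; apply/eqP/tensor_eqP => U b bb; apply: h.
Qed.

Lemma formal_eval_cat (U : lmodType K) (b : V -> W -> U) s t :
  formal_eval b (s ++ t) = formal_eval b s + formal_eval b t.
Proof. exact: big_cat. Qed.

Lemma tensor_lift0 (U : lmodType K) (b : V -> W -> U) :
  bilinear_map b -> tensor_lift b tensor_zero = 0.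
Proof. by move=> bb; rewrite tensor_lift_pi// /formal_eval big_nil. Qed.

Lemma tensor_liftD (U : lmodType K) (b : V -> W -> U) x y :
  bilinear_map b ->
  tensor_lift b (tensor_add x y) = tensor_lift b x + tensor_lift b y.
Proof. by move=> bb; rewrite tensor_lift_pi// formal_eval_cat. Qed.

Lemma bilinear_scalel (U : lmodType K) (b : V -> W -> U) c v w :
  bilinear_map b -> b (c *: v) w = c *: b v w.
Proof.
move=> [bl _]; have h := bl w.
have b0 : b 0 w = 0.
  by have := h (-1) 0 0; rewrite scaler0 addr0 scaleN1r addNr.
by have := h c v 0; rewrite addr0 b0 addr0.
Qed.

Lemma tensor_liftZ (U : lmodType K) (b : V -> W -> U) c x :
  bilinear_map b -> tensor_lift b (tensor_scale c x) = c *: tensor_lift b x.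
Proof.
move=> bb; rewrite tensor_lift_pi// /tensor_lift /formal_eval big_map scaler_sumr.
by apply: eq_bigr => p _ /=; rewrite bilinear_scalel.
Qed.

Definition tensor_opp := tensor_scale (-1).

Fact tensor_addA : associative tensor_add.
Proof.
by move=> x y z; apply: tensor_lift_inj => U b bb; rewrite !tensor_liftD// addrA.
Qed.
Fact tensor_addC : commutative tensor_add.
Proof.
by move=> x y; apply: tensor_lift_inj => U b bb; rewrite !tensor_liftD// addrC.
Qed.
Fact tensor_add0 : left_id tensor_zero tensor_add.
Proof.
by move=> x; apply: tensor_lift_inj => U b bb; rewrite tensor_liftD// tensor_lift0// add0r.
Qed.
Fact tensor_addN : left_inverse tensor_zero tensor_opp tensor_add.
Proof.
move=> x; apply: tensor_lift_inj => U b bb.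
by rewrite tensor_liftD// tensor_liftZ// tensor_lift0// scaleN1r addNr.
Qed.

HB.instance Definition _ :=
  GRing.isZmodule.Build tensor tensor_addA tensor_addC tensor_add0 tensor_addN.

Fact tensor_scaleA c d x :
  tensor_scale c (tensor_scale d x) = tensor_scale (c * d) x.
Proof.
by apply: tensor_lift_inj => U b bb; rewrite !tensor_liftZ// scalerA.
Qed.
Fact tensor_scale1 : left_id 1 tensor_scale.
Proof.
by move=> x; apply: tensor_lift_inj => U b bb; rewrite tensor_liftZ// scale1r.
Qed.
Fact tensor_scaleDr : right_distributive tensor_scale +%R.
Proof.
move=> c x y; apply: tensor_lift_inj => U b bb.
by rewrite tensor_liftZ// !tensor_liftD// !tensor_liftZ// scalerDr.
Qed.
Fact tensor_scaleDl x : {morph tensor_scale^~ x : c d / c + d >-> c + d}.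
Proof.
move=> c d; apply: tensor_lift_inj => U b bb.
by rewrite tensor_liftD// !tensor_liftZ// scalerDl.
Qed.

HB.instance Definition _ :=
  GRing.Zmodule_isLmodule.Build K tensor
    tensor_scaleA tensor_scale1 tensor_scaleDr tensor_scaleDl.

Lemma tens_bilinear : bilinear_map tens.
Proof.
split=> [w c v v'|v c w w']; apply: tensor_lift_inj => U b bb;
  rewrite tensor_liftD// tensor_liftZ// !tensor_lift_pi// /formal_eval !big_seq1 /=.
- by case: (bb) => bl _; rewrite (bl w).
- by case: (bb) => _ br; rewrite (br v).
Qed.

Lemma tensor_lift_linear (U : lmodType K) (b : V -> W -> U) :
  bilinear_map b -> linear (tensor_lift b).
Proof. by move=> bb c x y; rewrite tensor_liftD// tensor_liftZ. Qed.

Lemma tensor_lift_tens (U : lmodType K) (b : V -> W -> U) v w :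
  bilinear_map b -> tensor_lift b (tens v w) = b v w.
Proof. by move=> bb; rewrite tensor_lift_pi// /formal_eval big_seq1. Qed.

Lemma tensor_sum (x : tensor) :
  exists s : seq (V * W), x = \sum_(p <- s) tens p.1 p.2.
Proof.
exists (repr x); apply: tensor_lift_inj => U b bb.
rewrite {1}/tensor_lift /formal_eval; elim: (repr x) => [|p s ih].
  by rewrite !big_nil tensor_lift0.
by rewrite !big_cons ih tensor_liftD// tensor_lift_tens.
Qed.

End Tensor.

(* id (x) f; only meaningful when [f] is linear. *)
Definition tensor_mapr (K : comNzRingType) (V W W' : lmodType K) (f : W -> W') :
    tensor V W -> tensor V W' :=
  tensor_lift (fun v w => tens v (f w)).

(* The grading is given by the projections onto the homogeneous components, of
   degree 0 for [false] and 1 for [true]. In characteristic 2 one usually also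
   demands that odd elements square to zero; elsewhere this follows from
   [salg_comm]. An [algType] is nonzero, so the zero superalgebra is left out:
   every representable functor takes a one-point value there, hence a group
   functor and its subfunctors are determined by the other values. *)
Record SAlg (K : fieldType) := MkSAlg {
  salg_alg :> algType K;
  hpart : bool -> {linear salg_alg -> salg_alg};
  salg_compK : forall i j a, hpart i (hpart j a) = if i == j then hpart j a else 0;
  salg_compD : forall a, hpart false a + hpart true a = a;
  salg_comp1 : hpart false 1 = 1;
  salg_compM : forall i j a b, hpart i a = a -> hpart j b = b ->
    hpart (i (+) j) (a * b) = a * b;
  salg_comm : forall i j a b, hpart i a = a -> hpart j b = b ->
    a * b = (-1) ^+ (i && j) * (b * a)
}.

Arguments hpart {K s} i.

Definition homogeneous (K : fieldType) (A : SAlg K) (i : bool) (a : A) : Prop :=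
  hpart i a = a.

Record SHom (K : fieldType) (A B : SAlg K) := MkSHom {
  shom_map :> {lrmorphism A -> B};
  shom_comp : forall i a, shom_map (hpart i a) = hpart i (shom_map a)
}.

Lemma shom_ext (K : fieldType) (A B : SAlg K) (f g : SHom A B) :
  f =1 g -> f = g.
Proof.
case: f g => [f hf] [g hg] /= fg.
have e : f = g.
  case: f g {hf hg} fg => [f [[cf] [df] [lf]]] [g [[cg] [dg] [lg]]] /= /funext fg.
  subst g; congr (GRing.LRMorphism.Pack (GRing.LRMorphism.Class _ _ _));
  congr (_ _); exact: Prop_irrelevance.
by subst g; congr MkSHom; apply: Prop_irrelevance.
Qed.

Definition shom_id (K : fieldType) (A : SAlg K) : SHom A A :=
  @MkSHom K A A idfun (fun i a => erefl).

Fact shom_compose_comp (K : fieldType) (A B C : SAlg K) (g : SHom B C)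
    (f : SHom A B) i a : (g \o f) (hpart i a) = hpart i ((g \o f) a).
Proof. by rewrite /= !shom_comp. Qed.

Definition shom_compose (K : fieldType) (A B C : SAlg K)
    (g : SHom B C) (f : SHom A B) : SHom A C :=
  @MkSHom K A C (g \o f) (shom_compose_comp g f).

Section EvenSAlg.
Variables (K : fieldType) (R : comAlgType K).

Definition even_comp (i : bool) : {linear R -> R} :=
  if i then (\0 : {linear R -> R}) else (idfun : {linear R -> R}).

Fact even_compK i j a :
  even_comp i (even_comp j a) = if i == j then even_comp j a else 0.
Proof. by case: i; case: j. Qed.
Fact even_compD a : even_comp false a + even_comp true a = a.
Proof. exact: addr0. Qed.
Fact even_compM i j a b : even_comp i a = a -> even_comp j b = b ->
  even_comp (i (+) j) (a * b) = a * b.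
Proof.
case: i; case: j => //= ha hb.
- by rewrite -ha mul0r.
- by rewrite -hb mulr0.
Qed.
Fact even_comm i j a b : even_comp i a = a -> even_comp j b = b ->
  a * b = (-1) ^+ (i && j) * (b * a).
Proof.
case: i; case: j => //= ha hb; last 3 first.
- by rewrite expr0 mul1r mulrC.
- by rewrite expr0 mul1r mulrC.
- by rewrite expr0 mul1r mulrC.
- by rewrite -ha mul0r mulr0 mulr0.
Qed.

Definition even_salg : SAlg K :=
  @MkSAlg K R even_comp even_compK even_compD erefl even_compM even_comm.

End EvenSAlg.

Fact even_shom_comp (K : fieldType) (R R' : comAlgType K)
    (f : {lrmorphism R -> R'}) i a : f (even_comp R i a) = even_comp R' i (f a).
Proof. by case: i; rewrite //= raddf0. Qed.

Definition even_shom (K : fieldType) (R R' : comAlgType K)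
    (f : {lrmorphism R -> R'}) : SHom (even_salg R) (even_salg R') :=
  @MkSHom K (even_salg R) (even_salg R') f (even_shom_comp f).

Definition base_salg (K : fieldType) : SAlg K := even_salg (K^o : comAlgType K).

(* A group structure on the functor R |-> Hom(coord_alg, R). By Yoneda's lemma this
   is the same as a Hopf superalgebra structure on [coord_alg]. *)
Record supergroup (K : fieldType) := MkSupergroup {
  coord_alg : SAlg K;
  pmul : forall R : SAlg K, SHom coord_alg R -> SHom coord_alg R -> SHom coord_alg R;
  pone : forall R : SAlg K, SHom coord_alg R;
  pinv : forall R : SAlg K, SHom coord_alg R -> SHom coord_alg R;
  pmulA : forall R, associative (@pmul R);
  pmul1 : forall R, left_id (@pone R) (@pmul R);
  pmulV : forall R, left_inverse (@pone R) (@pinv R) (@pmul R);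
  pmul_natural : forall (R S : SAlg K) (f : SHom R S) (g h : SHom coord_alg R),
    shom_compose f (pmul g h) = pmul (shom_compose f g) (shom_compose f h)
}.

Definition point (K : fieldType) (G : supergroup K) (R : SAlg K) :=
  SHom (coord_alg G) R.

Definition counit (K : fieldType) (G : supergroup K) :
    SHom (coord_alg G) (base_salg K) :=
  pone G (base_salg K).

Record supergroup_hom (K : fieldType) (H G : supergroup K) := MkSupergroupHom {
  comorphism : SHom (coord_alg G) (coord_alg H);
  comorphismM : forall (R : SAlg K) (g h : point H R),
    shom_compose (pmul g h) comorphism =
    pmul (shom_compose g comorphism) (shom_compose h comorphism)
}.

Definition point_map (K : fieldType) (H G : supergroup K)
    (f : supergroup_hom H G) (R : SAlg K) (h : point H R) : point G R :=
  shom_compose h (comorphism f).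

Definition trivial_supergroup (K : fieldType) (G : supergroup K) : Prop :=
  forall (R : SAlg K) (g : point G R), g = pone G R.

Definition abelian_supergroup (K : fieldType) (G : supergroup K) : Prop :=
  forall (R : SAlg K) (g h : point G R), pmul g h = pmul h g.

Definition algebraic_supergroup (K : fieldType) (G : supergroup K) : Prop :=
  exists s : seq (coord_alg G), forall P : coord_alg G -> Prop,
    (forall x, x \in s -> P x) -> P 1 ->
    (forall (c : K) x y, P x -> P y -> P (c *: x + y)) ->
    (forall x y, P x -> P y -> P (x * y)) ->
    forall x, P x.

(* Closed super-subgroups of G are the quotient Hopf superalgebras of K[G]. *)
Definition closed_embedding (K : fieldType) (H G : supergroup K)
    (i : supergroup_hom H G) : Prop :=
  forall a : coord_alg H, exists b : coord_alg G, comorphism i b = a.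

Definition in_ideal_generated (K : fieldType) (A : SAlg K) (S : A -> Prop)
    (a : A) : Prop :=
  exists s : seq (A * A),
    (forall p, p \in s -> S p.1) /\ a = \sum_(p <- s) p.1 * p.2.

(* [i] identifies [E] with G_ev: K[E] is the quotient of K[G] by the ideal
   generated by the odd component. *)
Definition is_even_part (K : fieldType) (G E : supergroup K)
    (i : supergroup_hom E G) : Prop :=
  closed_embedding i /\
  forall a : coord_alg G,
    comorphism i a = 0 <-> in_ideal_generated (homogeneous true) a.

Definition normal_subgroup (K : fieldType) (G N : supergroup K)
    (i : supergroup_hom N G) : Prop :=
  forall (R : SAlg K) (g : point G R) (n : point N R),
    exists n' : point N R,
      point_map i n' = pmul (pmul g (point_map i n)) (pinv g).

(* [p] identifies Q with G/N: its comorphism identifies K[Q] with a Hopf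
   super-subalgebra B of K[G] such that B^+K[G] is the kernel of K[G] -> K[N]. *)
Definition is_quotient (K : fieldType) (G N Q : supergroup K)
    (i : supergroup_hom N G) (p : supergroup_hom G Q) : Prop :=
  injective (comorphism p) /\
  forall a : coord_alg G,
    comorphism i a = 0 <->
    in_ideal_generated
      (fun b => exists c : coord_alg Q, counit Q c = 0 /\ b = comorphism p c) a.

Definition normal_with_abelian_quotient (K : fieldType) (G N : supergroup K)
    (i : supergroup_hom N G) : Prop :=
  [/\ closed_embedding i, normal_subgroup i &
      exists (Q : supergroup K) (p : supergroup_hom G Q),
        is_quotient i p /\ abelian_supergroup Q].

Definition subgroup_le (K : fieldType) (G M N : supergroup K)
    (i : supergroup_hom M G) (j : supergroup_hom N G) : Prop :=
  forall (R : SAlg K) (m : point M R),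
    exists n : point N R, point_map j n = point_map i m.

Definition is_derived (K : fieldType) (G D : supergroup K)
    (i : supergroup_hom D G) : Prop :=
  normal_with_abelian_quotient i /\
  forall (N : supergroup K) (j : supergroup_hom N G),
    normal_with_abelian_quotient j -> subgroup_le i j.

(* [iterated_derived G r D]: D is (isomorphic to) the r-th derived
   super-subgroup of G. *)
Inductive iterated_derived (K : fieldType) (G : supergroup K) :
    nat -> supergroup K -> Prop :=
| IterDerived0 : iterated_derived G 0 G
| IterDerivedS r D D' (i : supergroup_hom D' D) :
    iterated_derived G r D -> is_derived i -> iterated_derived G r.+1 D'.

Definition solvable_supergroup (K : fieldType) (G : supergroup K) : Prop :=
  exists (r : nat) (D : supergroup K),
    iterated_derived G r D /\ trivial_supergroup D.

Definition tensor_act (K : fieldType) (V : lmodType K) (R : comAlgType K) (r : R) :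
    tensor V R -> tensor V R :=
  tensor_mapr (fun x : R => r * x).

(* Meant for a purely even E, that is, an affine group scheme: a natural
   R-linear action of E(R) on V (x) R for all commutative K-algebras R. *)
Record gmodule (K : fieldType) (E : supergroup K) := MkGModule {
  gmod :> lmodType K;
  gact : forall R : comAlgType K,
    point E (even_salg R) -> tensor gmod R -> tensor gmod R;
  gactD : forall R (g : point E (even_salg R)) x y,
    gact g (x + y) = gact g x + gact g y;
  gactZ : forall (R : comAlgType K) (g : point E (even_salg R)) (r : R) x,
    gact g (tensor_act r x) = tensor_act r (gact g x);
  gact1 : forall R x, gact (pone E (even_salg R)) x = x;
  gactM : forall R (g h : point E (even_salg R)) x,
    gact (pmul g h) x = gact g (gact h x);
  gact_natural : forall (R R' : comAlgType K) (f : {lrmorphism R -> R'})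
      (g : point E (even_salg R)) x,
    gact (shom_compose (even_shom f) g : point E (even_salg R'))
      (tensor_mapr f x) = tensor_mapr f (gact g x)
}.

(* [W] is a subspace such that every W (x) R, identified with its image in
   V (x) R, is stable under E(R). *)
Definition submodule (K : fieldType) (E : supergroup K) (V : gmodule E)
    (W : V -> Prop) : Prop :=
  [/\ W 0,
      forall (c : K) v w, W v -> W w -> W (c *: v + w) &
      forall (R : comAlgType K) (g : point E (even_salg R)) (w : V) (r : R),
        W w -> exists s : seq (V * R),
          (forall p, p \in s -> W p.1) /\
          gact g (tens w r) = \sum_(p <- s) tens p.1 p.2].

Definition simple_module (K : fieldType) (E : supergroup K) (V : gmodule E) :
    Prop :=
  (exists v : V, v != 0) /\
  forall W : V -> Prop, submodule W ->
    (forall w, W w -> w = 0) \/ (forall w, W w).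

Definition one_dimensional (K : fieldType) (V : lmodType K) : Prop :=
  exists2 v : V, v != 0 & forall w : V, exists c : K, w = c *: v.

Definition trigonalizable (K : fieldType) (E : supergroup K) : Prop :=
  forall V : gmodule E, simple_module V -> one_dimensional V.

Definition even_trigonalizable (K : fieldType) (G : supergroup K) : Prop :=
  exists (E : supergroup K) (i : supergroup_hom E G),
    is_even_part i /\ trigonalizable E.

(* Main.v *)
From HB Require Import structures.
From mathcomp Require Import all_boot all_order all_algebra.
From mathcomp Require Import boolp classical_sets.
Require Import Defs.

Set Implicit Arguments.
Unset Strict Implicit.
Unset Printing Implicit Defensive.

Import GRing.Theory.
Local Open Scope ring_scope.
Local Open Scope quotient_scope.

(* Let E = G_ev and let v_0, ..., v_(d-1) be a basis of the odd part of Lie(G) adapted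
   to a flag which is stable under the trigonalizable group E. For an odd parameter a
   the map x_k(a) = eps + v_k a is a point of G, and every point of G is uniquely a
   product e x_0(a_0) ... x_(d-1)(a_(d-1)) with e in E. Reordering such products only
   creates even points, because a commutator of two odd one-parameter points is
   trivial modulo each of its two parameters; hence the products that stop before
   x_n form subgroups P_n. The last coordinate z on P_(n+1) is invariant under left
   multiplication by P_n, so that z(g'g) = z(g) + z(g') beta(g). Then beta is a
   character of P_(n+1), and z is a homomorphism to the odd additive group on the
   kernel of beta, whose kernel lies in P_n. Finally P_0 = E is a group of triangular
   matrices.
   The abelian quotients of a supergroup D correspond to the cocommutative Hopf
   super-subalgebras of K[D]. There is a largest one, so derived super-subgroups
   exist; all grouplike elements are 1 and all primitive elements are 0 on them, so
   they descend along the chain above. *)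

(** * Superalgebras and points *)

(** Solvability is asserted for all closed super-subgroups whose points lie in a prescribed family,
    so the P_n and the kernels of their characters are never represented; closure under products and
    the behaviour of single coordinate functions suffice. The main obstacle is the unique product
    decomposition, that is, bijectivity of K[G] -> K[E][s_0, ..., s_(d-1)]. Let J be the ideal
    generated by the odd elements. Translation by E provides generators of J modulo J^2; a form of
    Nakayama's lemma turns them into generators of J, and it rests on odd elements having square
    zero, where the characteristic enters. The comparison with the odd variables s_k is exact only
    up to higher order, and the nilpotent filtration by these variables removes the error. The
    character beta is unavoidable: E acts on each line of the flag by a character, so that z is a
    homomorphism only where this character is 1. Hence every odd coordinate costs two derived
    super-subgroups. Trigonalizability is used for the flag in the odd tangent space and again for
    the triangular matrices describing E. *)

Section MkShom.
Variables (K : fieldType) (A B : SAlg K) (f : A -> B).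
Hypotheses (fL : linear f) (fM : {morph f : x y / x * y}) (f1 : f 1 = 1)
  (fH : forall i a, f (hpart i a) = hpart i (f a)).

Let f_ (_ : unit) := f.
HB.instance Definition _ u := GRing.isLinear.Build K A B _ (f_ u) fL.
HB.instance Definition _ u :=
  GRing.isMonoidMorphism.Build A B (f_ u) (conj f1 fM).
Definition mk_shom : SHom A B := @MkSHom K A B (f_ tt) fH.
End MkShom.

Notation is_even := (homogeneous false).
Notation is_odd := (homogeneous true).

Section Homogeneous.
Variables (K : fieldType) (A : SAlg K).
Implicit Types (a b : A) (c : K).

Lemma hpartK i a : hpart i (hpart i a) = hpart i a.
Proof. by rewrite salg_compK eqxx. Qed.

Lemma hpartN i a : hpart (~~ i) (hpart i a) = 0.
Proof. by rewrite salg_compK; case: i. Qed.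

Lemma hpart_homog i a : homogeneous i (hpart i a).
Proof. exact: hpartK. Qed.

Lemma hpart_other i a : homogeneous i a -> hpart (~~ i) a = 0.
Proof. by move=> <-; rewrite hpartN. Qed.

Lemma homog_hpart i j a : homogeneous i a -> hpart j a = if j == i then a else 0.
Proof. by move=> ha; rewrite -[in LHS]ha salg_compK; case: eqP. Qed.

Lemma homog0 i : homogeneous i (0 : A). Proof. exact: raddf0. Qed.
Lemma homog1 : is_even (1 : A). Proof. exact: salg_comp1. Qed.
Lemma homogD i a b : homogeneous i a -> homogeneous i b -> homogeneous i (a + b).
Proof. by rewrite /homogeneous raddfD /= => -> ->. Qed.
Lemma homogN i a : homogeneous i a -> homogeneous i (- a).
Proof. by rewrite /homogeneous raddfN /= => ->. Qed.
Lemma homogB i a b : homogeneous i a -> homogeneous i b -> homogeneous i (a - b).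
Proof. by move=> ha hb; apply: homogD => //; apply: homogN. Qed.
Lemma homogZ i c a : homogeneous i a -> homogeneous i (c *: a).
Proof. by rewrite /homogeneous linearZ /= => ->. Qed.
Lemma homogM i j a b : homogeneous i a -> homogeneous j b -> homogeneous (i (+) j) (a * b).
Proof. exact: salg_compM. Qed.
Lemma homog_sum i (I : Type) (r : seq I) (P : pred I) (F : I -> A) :
  (forall k, P k -> homogeneous i (F k)) -> homogeneous i (\sum_(k <- r | P k) F k).
Proof.
by move=> h; elim/big_ind: _ => [|x y|//]; [exact: homog0|exact: homogD].
Qed.
Lemma homogZ1 c : is_even (c%:A : A).
Proof. exact: homogZ homog1. Qed.

Lemma hpartM0 a b : hpart false (a * b) =
  hpart false a * hpart false b + hpart true a * hpart true b.
Proof.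
have h i j : homogeneous (i (+) j) (hpart i a * hpart j b).
  by apply: homogM; apply: hpart_homog.
rewrite -[in LHS](salg_compD a) -[in LHS](salg_compD b) !(mulrDl, mulrDr) !raddfD /=.
rewrite !(homog_hpart _ (h _ _)) /=.
by rewrite addr0 add0r.
Qed.

Lemma hpartM1 a b : hpart true (a * b) =
  hpart false a * hpart true b + hpart true a * hpart false b.
Proof.
have h i j : homogeneous (i (+) j) (hpart i a * hpart j b).
  by apply: homogM; apply: hpart_homog.
rewrite -[in LHS](salg_compD a) -[in LHS](salg_compD b) !(mulrDl, mulrDr) !raddfD /=.
rewrite !(homog_hpart _ (h _ _)) /=.
by rewrite addr0 add0r addrC.
Qed.

Lemma even_comm_l a b : is_even a -> a * b = b * a.
Proof.
move=> ha; rewrite -(salg_compD b) mulrDl mulrDr.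
by rewrite (salg_comm ha (hpart_homog false b)) (salg_comm ha (hpart_homog true b))
   /= expr0 !mul1r.
Qed.

Lemma odd_anticomm a b : is_odd a -> is_odd b -> a * b = - (b * a).
Proof. by move=> ha hb; rewrite (salg_comm ha hb) /= expr1 mulN1r. Qed.

(** The parity involution. An odd element moves past [a] at the price of replacing [a] by [ginv a]
    ([odd_ginv]), which carries the Koszul signs without a case split on homogeneous parts. *)
Definition ginv a : A := locked (hpart false a - hpart true a).
Lemma ginvE a : ginv a = hpart false a - hpart true a.
Proof. by rewrite /ginv -lock. Qed.

Lemma ginv_linear : linear ginv.
Proof.
by move=> c a b; rewrite !ginvE !linearP /= addrACA scalerBr scalerN.
Qed.
HB.instance Definition _ := GRing.isLinear.Build K A A _ ginv ginv_linear.

Lemma odd_ginv t a : is_odd t -> t * a = ginv a * t.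
Proof.
move=> ht; rewrite !ginvE -{1}(salg_compD a) mulrDr mulrBl.
rewrite (odd_anticomm ht (hpart_homog true a)).
by rewrite (even_comm_l t (hpart_homog false a)).
Qed.

Lemma ginv_even a : is_even a -> ginv a = a.
Proof. by move=> ha; rewrite !ginvE ha (hpart_other ha) subr0. Qed.
Lemma ginv_odd a : is_odd a -> ginv a = - a.
Proof. by move=> ha; rewrite !ginvE ha (hpart_other ha) sub0r. Qed.

Lemma ginvK : involutive ginv.
Proof.
move=> a; rewrite -{2}(salg_compD a) !ginvE !raddfB /= !salg_compK /=.
by rewrite subr0 oppr0 sub0r opprK.
Qed.

Lemma ginv_hpart i a : ginv (hpart i a) = hpart i (ginv a).
Proof.
by case: i; rewrite !ginvE !raddfB /= !salg_compK /= ?subr0 ?oppr0 ?sub0r.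
Qed.

Lemma ginvM a b : ginv (a * b) = ginv a * ginv b.
Proof.
have gD x y : ginv (x + y) = ginv x + ginv y by exact: raddfD.
rewrite -(salg_compD a) -(salg_compD b).
move: (hpart_homog false a) (hpart_homog true a) (hpart_homog false b) (hpart_homog true b).
move: (hpart false a) (hpart true a) (hpart false b) (hpart true b) => a0 a1 b0 b1 ea0 ea1 eb0 eb1.
rewrite !gD (ginv_even ea0) (ginv_even eb0) (ginv_odd ea1) (ginv_odd eb1).
rewrite !mulrDl !mulrDr !gD.
rewrite (ginv_even (homogM ea0 eb0)) (ginv_odd (homogM ea0 eb1)).
by rewrite (ginv_odd (homogM ea1 eb0)) (ginv_even (homogM ea1 eb1)) mulrN mulNr mulrNN.
Qed.

Lemma ginv1 : ginv 1 = 1.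
Proof. exact: ginv_even homog1. Qed.

Hypothesis char2 : 2%N \notin [pchar K].

Lemma odd_sqr a : is_odd a -> a * a = 0.
Proof.
move=> ha; have h := odd_anticomm ha ha.
have n2 : (2%:R : K) != 0 by move: char2; rewrite inE /=.
have : (2%:R : K) *: (a * a) = 0.
  by rewrite scaler_nat mulr2n {1}h addNr.
by move/(congr1 (fun x => 2%:R^-1 *: x)); rewrite scalerA mulVf // scale1r scaler0.
Qed.

End Homogeneous.

Arguments homog0 {K A}.
Arguments homog1 {K A}.

Section ShomTheory.
Variables (K : fieldType) (A B : SAlg K) (f : SHom A B).
Lemma shomP c x y : f (c *: x + y) = c *: f x + f y. Proof. exact: linearP. Qed.
Lemma shomD x y : f (x + y) = f x + f y. Proof. exact: raddfD. Qed.
Lemma shomB x y : f (x - y) = f x - f y. Proof. exact: raddfB. Qed.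
Lemma shomN x : f (- x) = - f x. Proof. exact: raddfN. Qed.
Lemma shomZ c x : f (c *: x) = c *: f x. Proof. exact: linearZ. Qed.
Lemma shomM x y : f (x * y) = f x * f y. Proof. exact: rmorphM. Qed.
Lemma shom0 : f 0 = 0. Proof. exact: raddf0. Qed.
Lemma shom1 : f 1 = 1. Proof. exact: rmorph1. Qed.
Lemma shom_sum (I : Type) (r : seq I) (P : pred I) (F : I -> A) :
  f (\sum_(i <- r | P i) F i) = \sum_(i <- r | P i) f (F i).
Proof. exact: raddf_sum. Qed.
Lemma shom_scal1 c : f c%:A = c%:A. Proof. by rewrite shomZ shom1. Qed.
Lemma shom_homog i a : homogeneous i a -> homogeneous i (f a).
Proof. by move=> h; rewrite /homogeneous -shom_comp h. Qed.
End ShomTheory.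

Section BaseShom.
Variables (K : fieldType) (R : SAlg K).
Let in_scal (c : base_salg K) : R := (c : K)%:A.
Fact in_scal_linear : linear in_scal.
Proof. by move=> c x y; rewrite /in_scal scalerDl scalerA. Qed.
Fact in_scalM : {morph in_scal : x y / x * y}.
Proof. by move=> x y; rewrite /in_scal -scalerAl mul1r scalerA. Qed.
Fact in_scal1 : in_scal 1 = 1.
Proof. by rewrite /in_scal scale1r. Qed.
Fact in_scal_hpart i a : in_scal (hpart i a) = hpart i (in_scal a).
Proof.
case: i; rewrite /in_scal /=; last by rewrite (homogZ1 R a).
by rewrite scale0r (@hpart_other _ _ false) //; apply: homogZ1.
Qed.
Definition base_shom : SHom (base_salg K) R :=
  mk_shom in_scal_linear in_scalM in_scal1 in_scal_hpart.
End BaseShom.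

Section Points.
Variable (K : fieldType).
Implicit Types (R S A B C : SAlg K).

Lemma shom_composeA A B C D' (f : SHom A B) (g : SHom B C) (h : SHom C D') :
  shom_compose h (shom_compose g f) = shom_compose (shom_compose h g) f.
Proof. exact: shom_ext. Qed.

Lemma shom_compose1 A B (f : SHom A B) : shom_compose f (shom_id A) = f.
Proof. exact: shom_ext. Qed.
Lemma shom_1compose A B (f : SHom A B) : shom_compose (shom_id B) f = f.
Proof. exact: shom_ext. Qed.

Lemma shom_lift_inj A B C (f : SHom B C) (g : SHom A C) : injective f ->
  (forall a, exists b, f b = g a) -> exists h : SHom A B, shom_compose f h = g.
Proof.
move=> fi fg.
have [h hP] := boolp.choice fg.
have hL : linear h by move=> c x y; apply: fi; rewrite shomP !hP shomP.
have hM : {morph h : x y / x * y}.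
  by move=> x y; apply: fi; rewrite shomM !hP shomM.
have h1 : h 1 = 1 by apply: fi; rewrite hP !shom1.
have hH i a : h (hpart i a) = hpart i (h a).
  by apply: fi; rewrite shom_comp !hP shom_comp.
by exists (mk_shom hL hM h1 hH); apply: shom_ext => a /=; rewrite /= hP.
Qed.

Lemma shom_factor A B C (f : SHom A B) (g : SHom A C) :
  (forall b, exists a, f a = b) -> (forall a, f a = 0 -> g a = 0) ->
  exists h : SHom B C, shom_compose h f = g.
Proof.
move=> fs fg.
have [s sP] := boolp.choice fs.
have E a a' : f a = f a' -> g a = g a'.
  move=> h; apply/eqP; rewrite -subr_eq0 -shomB fg //.
  by rewrite shomB h subrr.
pose h b := g (s b).
have hE a : h (f a) = g a by apply: E; rewrite sP.
have hL : linear h.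
  by move=> c x y; rewrite -(sP x) -(sP y) -shomP !hE shomP.
have hM : {morph h : x y / x * y}.
  by move=> x y; rewrite -(sP x) -(sP y) -shomM !hE shomM.
have h1 : h 1 = 1 by rewrite -(shom1 f) hE rmorph1.
have hH i a : h (hpart i a) = hpart i (h a).
  by rewrite -(sP a) -shom_comp !hE shom_comp.
by exists (mk_shom hL hM h1 hH); apply: shom_ext => a; apply: hE.
Qed.

Lemma shom_surj_inj A B C (f : SHom A B) (g h : SHom B C) :
  (forall b, exists a, f a = b) -> shom_compose g f = shom_compose h f -> g = h.
Proof.
by move=> fs e; apply: shom_ext => b; have [a <-] := fs b; apply: (congr1 (fun k : SHom A C => k a) e).
Qed.

Variable G : supergroup K.

Lemma pmulgV R (g : point G R) : pmul g (pinv g) = pone G R.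
Proof.
rewrite -[LHS]pmul1 -{1}(pmulV (pinv g)) -pmulA [pmul (pinv g) _]pmulA pmulV pmul1.
by rewrite pmulV.
Qed.

Lemma pmulg1 R : right_id (pone G R) (@pmul K G R).
Proof. by move=> g; rewrite -[in LHS](pmulV g) pmulA pmulgV pmul1. Qed.

Lemma pmulgI R (g h k : point G R) : pmul g h = pmul g k -> h = k.
Proof. by move/(congr1 (pmul (pinv g))); rewrite !pmulA pmulV !pmul1. Qed.

Lemma pmulIg R (g h k : point G R) : pmul h g = pmul k g -> h = k.
Proof. by move/(congr1 (fun x => pmul x (pinv g))); rewrite -!pmulA pmulgV !pmulg1. Qed.

Lemma pone_natural R S (f : SHom R S) : shom_compose f (pone G R) = pone G S.
Proof.
apply: (@pmulgI _ (shom_compose f (pone G R))).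
by rewrite -pmul_natural pmul1 pmulg1.
Qed.

Lemma pinv_natural R S (f : SHom R S) (g : point G R) :
  shom_compose f (pinv g) = pinv (shom_compose f g).
Proof.
by apply: (@pmulIg _ (shom_compose f g)); rewrite -pmul_natural !pmulV pone_natural.
Qed.

Definition antipode : SHom (coord_alg G) (coord_alg G) := pinv (shom_id (coord_alg G)).

Lemma pinvE R (g : point G R) : pinv g = shom_compose g antipode.
Proof. by rewrite /antipode pinv_natural shom_compose1. Qed.

Definition eps (a : coord_alg G) : K := counit G a.

Lemma epsE R (a : coord_alg G) : pone G R a = (eps a)%:A.
Proof. by rewrite -(pone_natural (base_shom R)). Qed.

Lemma epsP (c : K) a b : eps (c *: a + b) = c * eps a + eps b.
Proof. exact: (shomP (counit G)). Qed.
Lemma epsD a b : eps (a + b) = eps a + eps b. Proof. exact: (shomD (counit G)). Qed.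
Lemma epsB a b : eps (a - b) = eps a - eps b. Proof. exact: (shomB (counit G)). Qed.
Lemma epsZ (c : K) a : eps (c *: a) = c * eps a. Proof. exact: (shomZ (counit G)). Qed.
Lemma epsM a b : eps (a * b) = eps a * eps b.
Proof. by rewrite /eps rmorphM. Qed.
Lemma eps1 : eps 1 = 1.
Proof. by rewrite /eps rmorph1. Qed.
Lemma eps_odd a : is_odd a -> eps a = 0.
Proof. by move=> h; rewrite /eps -h shom_comp. Qed.

End Points.

Section Homs.
Variables (K : fieldType) (H G : supergroup K) (i : supergroup_hom H G).

Lemma point_mapM R (g h : point H R) :
  point_map i (pmul g h) = pmul (point_map i g) (point_map i h).
Proof. exact: comorphismM. Qed.
Lemma point_map1 R : point_map i (pone H R) = pone G R.
Proof.
apply: (@pmulgI _ _ _ (point_map i (pone H R))).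
by rewrite -point_mapM pmul1 pmulg1.
Qed.
Lemma point_mapV R (g : point H R) : point_map i (pinv g) = pinv (point_map i g).
Proof.
by apply: (@pmulIg _ _ _ (point_map i g)); rewrite -point_mapM !pmulV point_map1.
Qed.
Lemma point_map_natural R S (f : SHom R S) (g : point H R) :
  point_map i (shom_compose f g) = shom_compose f (point_map i g).
Proof. by rewrite /point_map shom_composeA. Qed.
Lemma eps_comorphism a : eps (comorphism i a) = eps a.
Proof.
by rewrite /eps /counit -(point_map1 (base_salg K)).
Qed.
Lemma antipode_comorphism a : antipode H (comorphism i a) = comorphism i (antipode G a).
Proof.
have := point_mapV (shom_id (coord_alg H)).
rewrite [in RHS]pinvE => /(congr1 (fun f : SHom _ _ => f a)) /=.
by [].
Qed.
Lemma point_map_inj R : closed_embedding i -> injective (@point_map _ _ _ i R).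
Proof. by move=> ci g h; apply: shom_surj_inj. Qed.
End Homs.

(** * Super tensor products *)

Section Retraction.
Variables (K : fieldType) (V W : lmodType K).

(** Zorn's lemma gives a subspace maximal among those meeting the image of [f] only in 0; it is a
    complement, and the retraction is the projection along it. Dimensions are arbitrary. It makes
    tensor products of injections injective and supplies dual families. *)
Lemma linear_retraction (f : V -> W) : linear f -> injective f ->
  exists r : W -> V, linear r /\ forall v, r (f v) = v.
Proof.
move=> fL fi.
have f0 : f 0 = 0.
  by have := fL (-1) 0 0; rewrite scaler0 addr0 scaleN1r addNr.
have fZ c x : f (c *: x) = c *: f x by have := fL c x 0; rewrite f0 !addr0.
have fD x y : f (x + y) = f x + f y by have := fL 1 x y; rewrite !scale1r.
have fN x : f (- x) = - f x by rewrite -scaleN1r fZ scaleN1r.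
(* Membership of 0 is left out of [P]: [Zorn_bigcup] includes the empty chain, whose union is empty.
   It is recovered from maximality in [C0]. *)
pose P (C : set W) := (forall (c : K) x y, C x -> C y -> C (c *: x + y)) /\
   (forall v, C (f v) -> v = 0).
have [C [[CL Cf] Cmax]] : exists A, P A /\ forall B, (A `<` B)%classic -> ~ P B.
  apply: Zorn_bigcup => F FP Ftot; split.
    move=> c x y [X FX Xx] [Y FY Yy].
    have [XY|YX] := Ftot X Y FX FY.
      by exists Y => //; apply: (FP _ FY).1 => //; apply: XY.
    by exists X => //; apply: (FP _ FX).1 => //; apply: YX.
  by move=> v [X FX]; apply: (FP _ FX).2.
have C0 : C 0.
  apply: contrapT => nC0; have nC x : ~ C x.
    by move=> Cx; apply: nC0; have := CL (-1) x x Cx Cx; rewrite scaleN1r addNr.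
  apply: (Cmax [set 0]%classic).
    split; last by move=> /(_ 0 erefl) /nC.
    by move=> x /nC.
  split; first by move=> c x y -> ->; rewrite scaler0 addr0.
  by move=> v /= fv; apply: fi; rewrite fv f0.
have CB x y : C x -> C y -> C (x - y).
  by move=> Cx Cy; rewrite addrC -scaleN1r; apply: CL.
have CZ c x : C x -> C (c *: x) by move=> Cx; rewrite -[_ *: _]addr0; apply: CL.
have tot w : exists v, C (w - f v).
  apply: contrapT => nw.
  (* Without such a [v], the line through [w] could be added to [C]: an element of the image with a
     nonzero coefficient at [w] would yield a [v] after all. *)
  apply: (Cmax [set x | exists c, exists2 y, C y & x = c *: w + y]%classic).
    split; last first.
      move/(_ w) => h; apply: nw; exists 0; rewrite f0 subr0; apply: h.
      by exists 1, 0 => //; rewrite scale1r addr0.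
    by move=> x Cx; exists 0, x => //; rewrite scale0r add0r.
  split.
    move=> c x y [c1 [x1 Cx1 ->]] [c2 [x2 Cx2 ->]].
    exists (c * c1 + c2), (c *: x1 + x2); first exact: CL.
    by rewrite scalerDr scalerA addrACA -scalerDl.
  move=> v [c [y Cy fv]].
  have [c0|c0] := eqVneq c 0; first by apply: Cf; rewrite fv c0 scale0r add0r.
  case: nw; exists (c^-1 *: v); rewrite fZ fv scalerDr scalerA mulVf // scale1r.
  by rewrite opprD addNKr -scalerN; apply: CZ; rewrite -sub0r; apply: CB.
have [r rP] := boolp.choice tot.
have rU w v : C (w - f v) -> r w = v.
  move=> h; apply/eqP; rewrite -subr_eq0; apply/eqP/Cf.
  rewrite fD fN; have := CB _ _ h (rP w).
  by rewrite opprB addrC addrA subrK.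
exists r; split=> [c x y|v]; apply: rU; last by rewrite subrr.
rewrite fD fZ opprD addrACA -scalerBr.
exact: CL.
Qed.
End Retraction.

Section TensorFacts.
Variables (K : fieldType).

Lemma tens_ind (V W : lmodType K) (P : tensor V W -> Prop) :
  (forall x y, P x -> P y -> P (x + y)) -> P 0 -> (forall v w, P (tens v w)) ->
  forall x, P x.
Proof.
move=> PD P0 Pt x; have [s ->] := tensor_sum x.
by elim/big_ind: _ => // p _; apply: Pt.
Qed.

Section TensLin.
Variables V W : lmodType K.
Implicit Types (v : V) (w : W).
Lemma tensDl v v' w : tens (v + v') w = tens v w + tens v' w.
Proof. by have := (tens_bilinear V W).1 w 1 v v'; rewrite !scale1r. Qed.
Lemma tensDr v w w' : tens v (w + w') = tens v w + tens v w'.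
Proof. by have := (tens_bilinear V W).2 v 1 w w'; rewrite !scale1r. Qed.
Lemma tens0l w : tens (0 : V) w = 0.
Proof. by apply: (addrI (tens 0 w)); rewrite -tensDl !addr0. Qed.
Lemma tens0r v : tens v (0 : W) = 0.
Proof. by apply: (addrI (tens v 0)); rewrite -tensDr !addr0. Qed.
Lemma tensZl c v w : tens (c *: v) w = c *: tens v w.
Proof. by have := (tens_bilinear V W).1 w c v 0; rewrite tens0l !addr0. Qed.
Lemma tensZr c v w : tens v (c *: w) = c *: tens v w.
Proof. by have := (tens_bilinear V W).2 v c w 0; rewrite tens0r !addr0. Qed.
Lemma tensNl v w : tens (- v) w = - tens v w.
Proof. by rewrite -scaleN1r tensZl scaleN1r. Qed.
Lemma tensNr v w : tens v (- w) = - tens v w.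
Proof. by rewrite -scaleN1r tensZr scaleN1r. Qed.
Lemma tens_suml (I : Type) (r : seq I) (P : pred I) (F : I -> V) w :
  tens (\sum_(i <- r | P i) F i) w = \sum_(i <- r | P i) tens (F i) w.
Proof. by apply: (big_morph (fun v => tens v w)) => [x y|]; rewrite ?tensDl ?tens0l. Qed.

Lemma lin_tens_ext (U : lmodType K) (f g : tensor V W -> U) : linear f -> linear g ->
  (forall v w, f (tens v w) = g (tens v w)) -> f =1 g.
Proof.
move=> fL gL fg.
have f0 (h : tensor V W -> U) : linear h -> h 0 = 0.
  by move=> hL; have := hL (-1) 0 0; rewrite scaler0 addr0 scaleN1r addNr.
have hD (h : tensor V W -> U) : linear h -> forall x y, h (x + y) = h x + h y.
  by move=> hL x y; have := hL 1 x y; rewrite !scale1r.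
elim/tens_ind => [x y ex ey||//]; first by rewrite !hD // ex ey.
by rewrite !f0.
Qed.
End TensLin.

Definition tmap (V W V' W' : lmodType K) (f : V -> V') (g : W -> W') :
  tensor V W -> tensor V' W' := tensor_lift (fun v w => tens (f v) (g w)).

Lemma tmap_bilin (V W V' W' : lmodType K) (f : V -> V') (g : W -> W') :
  linear f -> linear g -> bilinear_map (fun v w => tens (f v) (g w)).
Proof.
by move=> fL gL; split=> [w c x y|v c x y];
  rewrite ?fL ?gL ?(tensDl, tensDr) ?(tensZl, tensZr).
Qed.
Lemma tmapE (V W V' W' : lmodType K) (f : V -> V') (g : W -> W') v w :
  linear f -> linear g -> tmap f g (tens v w) = tens (f v) (g w).
Proof. by move=> fL gL; rewrite /tmap tensor_lift_tens //; apply: tmap_bilin. Qed.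
Lemma tmap_linear (V W V' W' : lmodType K) (f : V -> V') (g : W -> W') :
  linear f -> linear g -> linear (tmap f g).
Proof. by move=> fL gL; apply: tensor_lift_linear; apply: tmap_bilin. Qed.

Lemma tmap_inj (V W V' W' : lmodType K) (f : V -> V') (g : W -> W') :
  linear f -> linear g -> injective f -> injective g -> injective (tmap f g).
Proof.
move=> fL gL fi gi.
have [r [rL rf]] := linear_retraction fL fi; have [s [sL sg]] := linear_retraction gL gi.
apply: (can_inj (g := tmap r s)).
apply: lin_tens_ext => [|//|v w]; last by rewrite !tmapE // rf sg.
by move=> c x y; rewrite !(tmap_linear fL gL) (tmap_linear rL sL).
Qed.

End TensorFacts.

(** * The super tensor product *)

Section STensor.
Variables (K : fieldType) (A B : SAlg K).

Definition stensor : Type := tensor A B.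
HB.instance Definition _ := GRing.Lmodule.on stensor.

Implicit Types (a c : A) (b d : B) (x y z : stensor).

Definition stens a b : stensor := tens a b.

Lemma stensDl a a' b : stens (a + a') b = stens a b + stens a' b.
Proof. exact: tensDl. Qed.
Lemma stensDr a b b' : stens a (b + b') = stens a b + stens a b'.
Proof. exact: tensDr. Qed.
Lemma stensZl (k : K) a b : stens (k *: a) b = k *: stens a b.
Proof. exact: tensZl. Qed.
Lemma stensZr (k : K) a b : stens a (k *: b) = k *: stens a b.
Proof. exact: tensZr. Qed.
Lemma stens0l b : stens 0 b = 0. Proof. exact: tens0l. Qed.
Lemma stens0r a : stens a 0 = 0. Proof. exact: tens0r. Qed.
Lemma stensNl a b : stens (- a) b = - stens a b. Proof. exact: tensNl. Qed.
Lemma stensNr a b : stens a (- b) = - stens a b. Proof. exact: tensNr. Qed.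
Lemma stens_ind (P : stensor -> Prop) :
  (forall x y, P x -> P y -> P (x + y)) -> P 0 -> (forall a b, P (stens a b)) ->
  forall x, P x.
Proof. exact: tens_ind. Qed.

Definition gpow (i : bool) a : A := if i then ginv a else a.
Lemma gpowM i a c : gpow i (a * c) = gpow i a * gpow i c.
Proof. by case: i; rewrite // /gpow ginvM. Qed.
Lemma gpow_gpow i j a : gpow i (gpow j a) = gpow (i (+) j) a.
Proof. by case: i; case: j; rewrite //= ginvK. Qed.
Lemma gpowD i a c : gpow i (a + c) = gpow i a + gpow i c.
Proof. by case: i => //; exact: raddfD. Qed.
Lemma gpowZ i (k : K) a : gpow i (k *: a) = k *: gpow i a.
Proof. by case: i => //; exact: linearZ. Qed.
Lemma gpow1 i : gpow i 1 = 1.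
Proof. by case: i => //; exact: ginv1. Qed.
Lemma gpow_homog i j a : homogeneous j a -> gpow i a = (-1) ^+ (i && j) * a.
Proof.
case: i => [|_]; last by rewrite expr0 mul1r.
by case: j => h /=; rewrite ?expr1 ?expr0 ?mulN1r ?mul1r ?(ginv_odd h) ?(ginv_even h).
Qed.
Lemma gpow_homogP i j a : homogeneous j a -> homogeneous j (gpow i a).
Proof. by case: i => // h; rewrite /homogeneous -ginv_hpart h. Qed.

(** The Koszul rule: the product of a (x) b and c (x) d is (-1)^(|b||c|) ac (x) bd. Splitting [b] by
    parity makes the formula bilinear, and [gpow] negates the odd part of [c] exactly when the part
    of [b] is odd. *)
Let m a b c d : stensor :=
  stens (a * gpow false c) (hpart false b * d) + stens (a * gpow true c) (hpart true b * d).

Let mulin a b y : stensor := tensor_lift (m a b) y.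

Fact m_bilin a b : bilinear_map (m a b).
Proof.
split=> [d k c c'|c k d d']; rewrite /m ?(gpowD, gpowZ) !(mulrDr, stensDl, stensDr) -?(scalerAr, scalerAl);
  rewrite ?(stensZl, stensZr) addrACA scalerDr //.
Qed.

Fact mulinE a b c d : mulin a b (stens c d) = m a b c d.
Proof. by rewrite /mulin tensor_lift_tens //; apply: m_bilin. Qed.

Fact mulin_linear a b : linear (mulin a b).
Proof. exact: tensor_lift_linear (m_bilin a b). Qed.

Fact mulin_bilin y : bilinear_map (fun a b => mulin a b y).
Proof.
split=> [b k a a'|a k b b']; rewrite /mulin /tensor_lift /formal_eval scaler_sumr -big_split;
  apply: eq_bigr => -[c d] _ /=; rewrite /m ?linearP.
  by rewrite /= !mulrDl -!scalerAl !(stensDl, stensZl) addrACA scalerDr.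
by rewrite /= !mulrDl -!scalerAl !(stensDr, stensZr) addrACA scalerDr.
Qed.

Definition tmul x y : stensor := tensor_lift (fun a b => mulin a b y) x.

Fact tmulE a b c d j : homogeneous j b ->
  tmul (stens a b) (stens c d) = stens (a * gpow j c) (b * d).
Proof.
move=> hb; rewrite /tmul tensor_lift_tens ?mulinE; last exact: mulin_bilin.
rewrite /m; case: j hb => hb; rewrite hb (hpart_other hb) mul0r stens0r ?add0r ?addr0 //.
Qed.

Fact tmulDl : left_distributive tmul +%R.
Proof.
move=> x y z; have := tensor_lift_linear (mulin_bilin z) 1 x y.
by rewrite !scale1r.
Qed.
Fact tmulDr : right_distributive tmul +%R.
Proof.
move=> x y z; rewrite /tmul /tensor_lift /formal_eval -big_split /=.
by apply: eq_bigr => p _; have := mulin_linear p.1 p.2 1 y z; rewrite !scale1r.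
Qed.

Lemma stens_homog_ind (P : stensor -> Prop) :
  (forall x y, P x -> P y -> P (x + y)) -> P 0 ->
  (forall a b i j, homogeneous i a -> homogeneous j b -> P (stens a b)) ->
  forall x, P x.
Proof.
move=> PD P0 Pt; apply: stens_ind => // a b.
rewrite -(salg_compD a) -(salg_compD b) !(stensDl, stensDr).
by apply: (PD); apply: (PD); apply: (Pt _ _ _ _ (hpart_homog _ _) (hpart_homog _ _)).
Qed.

Fact tmul0l x : tmul 0 x = 0.
Proof. by apply: (addrI (tmul 0 x)); rewrite -tmulDl !addr0. Qed.
Fact tmul0r x : tmul x 0 = 0.
Proof. by apply: (addrI (tmul x 0)); rewrite -tmulDr !addr0. Qed.

Fact tmulA : associative tmul.
Proof.
move=> x y z; elim/stens_homog_ind: x => [x x' hx hx'||a b i j ha hb].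
- by rewrite !tmulDl hx hx'.
- by rewrite !tmul0l.
elim/stens_homog_ind: y => [y y' hy hy'||c d k l hc hd].
- by rewrite !(tmulDr, tmulDl) hy hy'.
- by rewrite !(tmul0r, tmul0l).
elim/stens_homog_ind: z => [z z' hz hz'||e f p q he hf].
- by rewrite !tmulDr hz hz'.
- by rewrite !tmul0r.
rewrite (tmulE _ _ _ hd) (tmulE _ _ _ hb) (tmulE _ _ _ hb) (tmulE _ _ _ (homogM hb hd)).
by rewrite gpowM gpow_gpow !mulrA.
Qed.

Fact tmul1l : left_id (stens 1 1) tmul.
Proof.
elim/stens_ind => [x y hx hy||a b]; first by rewrite tmulDr hx hy.
  by rewrite tmul0r.
by rewrite (tmulE _ _ _ homog1) !mul1r.
Qed.
Fact tmul1r : right_id (stens 1 1) tmul.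
Proof.
elim/stens_homog_ind => [x y hx hy||a b i j ha hb]; first by rewrite tmulDl hx hy.
  by rewrite tmul0l.
by rewrite (tmulE _ _ _ hb) gpow1 !mulr1.
Qed.

Fact tens11_neq0 : stens 1 1 != 0.
Proof.
have inj (C : SAlg K) : injective (fun c : K^o => c%:A : C).
  move=> c c' /eqP; rewrite -subr_eq0 -scalerBl scaler_eq0 oner_eq0 orbF subr_eq0.
  by move/eqP.
(* Functionals with value 1 at the unit, obtained from retractions of K -> A and K -> B, separate 1
   (x) 1 from 0. *)
have [f [fL f1]] := linear_retraction (@in_scal_linear _ A) (inj A).
have [g [gL g1]] := linear_retraction (@in_scal_linear _ B) (inj B).
have bb : bilinear_map (fun (a : A) (b : B) => f a * g b : K^o).
  split=> [b k a a'|a k b b']; rewrite ?fL ?gL ?mulrDl ?mulrDr.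
    by rewrite -scalerAl.
  by congr (_ + _); rewrite [RHS](mulrCA k) .
apply/eqP => /(congr1 (tensor_lift (fun (a : A) (b : B) => f a * g b : K^o))).
rewrite tensor_lift_tens // -[1 : A]scale1r -[1 : B]scale1r f1 g1 mul1r.
rewrite (_ : 0 = tensor_zero A B) // tensor_lift0 // => /eqP.
by rewrite oner_eq0.
Qed.

HB.instance Definition _ := GRing.Zmodule_isNzRing.Build stensor
  tmulA tmul1l tmul1r tmulDl tmulDr tens11_neq0.

Lemma stensM a b c d j : homogeneous j b ->
  stens a b * stens c d = stens (a * gpow j c) (b * d).
Proof. exact: tmulE. Qed.
Lemma stens1 : stens 1 1 = 1. Proof. by []. Qed.

Fact stens_scaleAl (k : K) x y : k *: (x * y) = (k *: x) * y.
Proof.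
elim/stens_homog_ind: x => [x x' hx hx'||a b i j ha hb].
- by rewrite mulrDl !scalerDr hx hx' mulrDl.
- by rewrite !(mul0r, scaler0, mul0r).
elim/stens_ind: y => [y y' hy hy'||c d].
- by rewrite mulrDr scalerDr hy hy' -mulrDr.
- by rewrite !mulr0 scaler0.
by rewrite -stensZl !(stensM _ _ _ hb) -stensZl scalerAl.
Qed.
HB.instance Definition _ := GRing.Lmodule_isLalgebra.Build K stensor stens_scaleAl.

Fact stens_scaleAr (k : K) x y : k *: (x * y) = x * (k *: y).
Proof.
elim/stens_homog_ind: x => [x x' hx hx'||a b i j ha hb].
- by rewrite !mulrDl !scalerDr hx hx'.
- by rewrite !(mul0r, scaler0, mul0r).
elim/stens_ind: y => [y y' hy hy'||c d].
- by rewrite scalerDr !mulrDr scalerDr hy hy'.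
- by rewrite !scaler0 !mulr0 scaler0.
by rewrite -stensZl !(stensM _ _ _ hb) gpowZ -stensZl scalerAr.
Qed.
HB.instance Definition _ := GRing.Lalgebra_isAlgebra.Build K stensor stens_scaleAr.

Definition sth i x : stensor :=
  locked ((tmap (hpart false) (hpart i) x : stensor) + tmap (hpart true) (hpart (~~ i)) x).

Fact sth_linear i : linear (sth i).
Proof.
move=> k x y; rewrite /sth -!lock.
rewrite !(@tmap_linear _ A B A B _ _ (@linearP _ _ _ _ _) (@linearP _ _ _ _ _)).
by rewrite addrACA scalerDr.
Qed.
HB.instance Definition _ i := GRing.isLinear.Build K stensor stensor _ (sth i) (sth_linear i).

Lemma sthE i a b : sth i (stens a b) =
  stens (hpart false a) (hpart i b) + stens (hpart true a) (hpart (~~ i) b).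
Proof. by rewrite /sth -lock !tmapE //; exact: linearP. Qed.

Lemma sth_homog i j k a b : homogeneous j a -> homogeneous k b ->
  sth i (stens a b) = if i == j (+) k then stens a b else 0.
Proof.
move=> ha hb; rewrite sthE !(homog_hpart _ ha) !(homog_hpart _ hb).
by case: i; case: j {ha}; case: k {hb} => /=; rewrite ?stens0l ?stens0r ?addr0 ?add0r.
Qed.

Fact sthD i x y : sth i (x + y) = sth i x + sth i y. Proof. exact: raddfD. Qed.
Fact sth0 i : sth i 0 = 0. Proof. exact: raddf0. Qed.

Fact sth_K i j x : sth i (sth j x) = if i == j then sth j x else 0.
Proof.
elim/stens_homog_ind: x => [x y hx hy||a b p q ha hb].
- by rewrite !sthD hx hy; case: eqP; rewrite ?addr0.
- by rewrite !sth0; case: eqP.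
rewrite !(sth_homog _ ha hb); case: (j =P _) => [->|_]; last by rewrite sth0; case: eqP.
exact: (sth_homog _ ha hb).
Qed.
Fact sth_D x : sth false x + sth true x = x.
Proof.
elim/stens_homog_ind: x => [x y hx hy||a b p q ha hb].
- by rewrite !sthD addrACA hx hy.
- by rewrite !sth0 addr0.
by rewrite !(sth_homog _ ha hb); case: (p (+) q); rewrite ?addr0 ?add0r.
Qed.
Fact sth_1 : sth false 1 = 1.
Proof. by rewrite (sth_homog _ homog1 homog1). Qed.

Lemma sth_ind i (P : stensor -> Prop) :
  (forall x y, P x -> P y -> P (x + y)) -> P 0 ->
  (forall a b j k, i = j (+) k -> homogeneous j a -> homogeneous k b -> P (stens a b)) ->
  forall x, sth i x = x -> P x.
Proof.
move=> PD P0 Pt x <-; elim/stens_homog_ind: x => [x y hx hy||a b p q ha hb].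
- by rewrite sthD; apply: PD.
- by rewrite sth0.
by rewrite (sth_homog _ ha hb); case: eqP => // e; apply: Pt e ha hb.
Qed.

Fact sth_M i j x y : sth i x = x -> sth j y = y -> sth (i (+) j) (x * y) = x * y.
Proof.
move=> hx hy; elim/sth_ind: x / hx => [x x' hx hx'||a b p q -> ha hb].
- by rewrite mulrDl sthD hx hx'.
- by rewrite mul0r sth0.
elim/sth_ind: y / hy => [y y' hy hy'||c d r s -> hc hd].
- by rewrite mulrDr sthD hy hy'.
- by rewrite mulr0 sth0.
rewrite (stensM _ _ _ hb) (sth_homog _ (homogM ha (gpow_homogP q hc)) (homogM hb hd)).
by case: eqP => // -[]; case: p {ha}; case: q {hb}; case: r {hc}; case: s {hd}.
Qed.
Fact sth_comm i j x y : sth i x = x -> sth j y = y ->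
  x * y = (-1) ^+ (i && j) * (y * x).
Proof.
move=> hx hy; elim/sth_ind: x / hx => [x x' hx hx'||a b p q -> ha hb].
- by rewrite !(mulrDr, mulrDl) hx hx'.
- by rewrite !(mul0r, mulr0).
elim/sth_ind: y / hy => [y y' hy hy'||c d r s -> hc hd].
- by rewrite !(mulrDr, mulrDl) hy hy'.
- by rewrite !(mul0r, mulr0).
rewrite (stensM _ _ _ hb) (stensM _ _ _ hd) (gpow_homog _ hc) (gpow_homog _ ha).
have -> : a * ((-1) ^+ (q && r) * c) = (-1) ^+ (q && r) * ((-1) ^+ (p && r) * (c * a)).
  by rewrite -(salg_comm ha hc); case: (q && r); rewrite ?expr0 ?expr1 ?mul1r // !mulN1r mulrN.
rewrite (salg_comm hb hd).
by case: p {ha}; case: q {hb}; case: r {hc}; case: s {hd};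
  rewrite /= ?expr0 ?expr1 ?mulN1r ?mul1r ?mulrN ?stensNl ?stensNr ?opprK.
Qed.

Definition stensor_salg : SAlg K :=
  @MkSAlg K stensor sth sth_K sth_D sth_1 sth_M sth_comm.

Fact inl_linear : linear (fun a : A => stens a 1 : stensor_salg).
Proof. by move=> k a b; rewrite stensDl stensZl. Qed.
Fact inlM : {morph (fun a : A => stens a 1 : stensor_salg) : a c / a * c}.
Proof. by move=> a c; rewrite (stensM _ _ _ homog1) mulr1. Qed.
Fact inlH i a : stens (hpart i a) 1 = hpart i (stens a 1 : stensor_salg).
Proof.
rewrite /= sthE -[1](@homog1 K B) !salg_compK.
by case: i; rewrite /= ?stens0r ?addr0 ?add0r salg_comp1.
Qed.
Definition sinl : SHom A stensor_salg := mk_shom inl_linear inlM stens1 inlH.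

Fact inr_linear : linear (fun b : B => stens 1 b : stensor_salg).
Proof. by move=> k a b; rewrite stensDr stensZr. Qed.
Fact inrM : {morph (fun b : B => stens 1 b : stensor_salg) : a c / a * c}.
Proof.
move=> b d; rewrite -(salg_compD b) mulrDl !stensDr mulrDl.
by rewrite !(stensM _ _ _ (hpart_homog _ _)) !gpow1 mulr1.
Qed.
Fact inrH i b : stens 1 (hpart i b) = hpart i (stens 1 b : stensor_salg).
Proof. by rewrite /= sthE homog1 (hpart_other homog1) stens0l addr0. Qed.
Definition sinr : SHom B stensor_salg := mk_shom inr_linear inrM stens1 inrH.

Lemma stens_sinlr a b : stens a b = sinl a * sinr b :> stensor_salg.
Proof. by rewrite /= [RHS](stensM _ _ _ homog1) gpow1 mul1r mulr1. Qed.

Section Pair.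
Variables (R : SAlg K) (f : SHom A R) (g : SHom B R).

Let pr (x : stensor_salg) : R := tensor_lift (fun a b => f a * g b) x.
Fact pr_bilin : bilinear_map (fun (a : A) (b : B) => f a * g b : R).
Proof.
split=> [b k a a'|a k b b']; rewrite shomP; first by rewrite mulrDl scalerAl.
by rewrite mulrDr scalerAr.
Qed.
Fact pr_linear : linear pr. Proof. exact: tensor_lift_linear pr_bilin. Qed.
Fact prE a b : pr (stens a b) = f a * g b.
Proof. by rewrite /pr tensor_lift_tens //; exact: pr_bilin. Qed.
Fact prD x y : pr (x + y) = pr x + pr y.
Proof. by have := pr_linear 1 x y; rewrite !scale1r. Qed.
Fact pr0 : pr 0 = 0. Proof. exact: tensor_lift0 pr_bilin. Qed.
Fact pr1 : pr 1 = 1. Proof. by rewrite -stens1 prE !shom1 mulr1. Qed.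
Fact prM : {morph pr : x y / x * y}.
Proof.
move=> x y; elim/stens_homog_ind: x => [x x' hx hx'||a b i j ha hb].
- by rewrite mulrDl !prD hx hx' mulrDl.
- by rewrite mul0r pr0 mul0r.
elim/stens_homog_ind: y => [y y' hy hy'||c d k l hc hd].
- by rewrite mulrDr !prD hy hy' mulrDr.
- by rewrite mulr0 pr0 mulr0.
rewrite [_ * _](stensM _ _ _ hb) !prE !shomM (gpow_homog _ hc) shomM.
rewrite -!mulrA; congr (_ * _); rewrite [in RHS]mulrA.
rewrite (salg_comm (shom_homog g hb) (shom_homog f hc)) !mulrA; congr (_ * _ * _ * _).
by case: (j && k); rewrite ?expr0 ?expr1 ?shomN ?shom1.
Qed.
Fact prH i (x : stensor_salg) : pr (hpart i x) = hpart i (pr x).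
Proof.
elim/stens_homog_ind: x => [x x' hx hx'||a b j k ha hb].
- by rewrite linearD !prD hx hx' linearD.
- by rewrite linear0 pr0 linear0.
rewrite /= (sth_homog _ ha hb) prE.
rewrite (homog_hpart _ (homogM (shom_homog f ha) (shom_homog g hb))).
by case: eqP; rewrite ?prE ?pr0.
Qed.
(** The super tensor product is the coproduct of superalgebras: the images of [f] and [g]
    supercommute in [R]. A pair of points over [R] is thus a single morphism. *)
Definition spair : SHom stensor_salg R := mk_shom pr_linear prM pr1 prH.
Lemma spairE a b : spair (stens a b) = f a * g b. Proof. exact: prE. Qed.
Lemma spair_inl : shom_compose spair sinl = f.
Proof. by apply: shom_ext => a /=; rewrite prE shom1 mulr1. Qed.
Lemma spair_inr : shom_compose spair sinr = g.
Proof. by apply: shom_ext => a /=; rewrite prE shom1 mul1r. Qed.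
End Pair.

End STensor.

Arguments sinl {K A B}.
Arguments sinr {K A B}.

Section STensorMap.
Variables (K : fieldType) (A B A' B' : SAlg K) (f : SHom A A') (g : SHom B B').
Definition smap : SHom (stensor_salg A B) (stensor_salg A' B') :=
  spair (shom_compose sinl f) (shom_compose sinr g).
Lemma smapE a b : smap (stens a b) = stens (f a) (g b).
Proof. by rewrite spairE [RHS]stens_sinlr. Qed.
Lemma smap_inj : injective f -> injective g -> injective smap.
Proof.
move=> fi gi.
have E : smap =1 tmap f g.
  apply: lin_tens_ext.
  - by move=> c x y; exact: (shomP smap).
  - by apply: tmap_linear; exact: shomP.
  - by move=> a b; rewrite [LHS]smapE tmapE //; exact: shomP.
move=> x y; rewrite !E.
by apply: tmap_inj => //; exact: shomP.
Qed.
End STensorMap.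

(** * Comultiplication, quotients and subalgebras *)

Section Comult.
Variables (K : fieldType) (G : supergroup K).
Let A := coord_alg G.

(** The product of the two universal points; by naturality it determines every product of points
    ([pmul_spair]). *)
Definition comult : SHom A (stensor_salg A A) := pmul (sinl : point G _) (sinr : point G _).

Lemma pmul_spair R (g h : point G R) : pmul g h = shom_compose (spair g h) comult.
Proof. by rewrite pmul_natural spair_inl spair_inr. Qed.

Lemma stens_list (B C : SAlg K) (x : stensor_salg B C) :
  exists s : seq (B * C), x = \sum_(p <- s) (stens p.1 p.2 : stensor_salg B C).
Proof. exact: tensor_sum. Qed.

Lemma pmul_listE R (g h : point G R) (x : A) s :
  comult x = \sum_(p <- s) (stens p.1 p.2 : stensor_salg A A) -> pmul g h x = \sum_(p <- s) g p.1 * h p.2.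
Proof.
move=> e; rewrite pmul_spair.
rewrite [LHS](_ : _ = spair g h (comult x)) // e shom_sum.
by apply: eq_bigr => p _; rewrite spairE.
Qed.

(** The list writes the comultiplication of [x] as a sum of pure tensors, so the same list serves
    all R, g and h. Most later computations with the comultiplication go through such lists. *)
Lemma comult_list (x : A) : exists s : seq (A * A),
  forall R (g h : point G R), pmul g h x = \sum_(p <- s) g p.1 * h p.2.
Proof.
have [s e] := stens_list (comult x); exists s => R g h; exact: pmul_listE.
Qed.

End Comult.

(** * Quotient superalgebras and super-subalgebras *)

Section Quotient.
Variables (K : fieldType) (A : SAlg K) (I : A -> Prop).

(** Ideals are taken proper because an [SAlg] is nonzero. *)
Record is_sideal : Prop := IsSideal {
  sideal_lin : forall (c : K) a b, I a -> I b -> I (c *: a + b);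
  sidealMl : forall a b, I b -> I (a * b);
  sidealMr : forall a b, I a -> I (a * b);
  sideal_hpart : forall i a, I a -> I (hpart i a);
  sideal0 : I 0;
  sideal1 : ~ I 1
}.

Hypothesis hI : is_sideal.

Lemma sidealD a b : I a -> I b -> I (a + b).
Proof. by rewrite -{2}[a]scale1r; apply: sideal_lin. Qed.
Lemma sidealZ (c : K) a : I a -> I (c *: a).
Proof. by move=> h; rewrite -[_ *: _]addr0; apply: sideal_lin => //; apply: sideal0. Qed.
Lemma sidealN a : I a -> I (- a).
Proof. by rewrite -scaleN1r; apply: sidealZ. Qed.

Definition qrel (a b : A) : bool := `[< I (a - b) >].
Fact qrel_refl : reflexive qrel.
Proof. by move=> a; apply/asboolP; rewrite subrr; apply: sideal0. Qed.
Fact qrel_sym : symmetric qrel.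
Proof. by move=> a b; apply/asboolP/asboolP => /sidealN; rewrite opprB. Qed.
Fact qrel_trans : transitive qrel.
Proof.
move=> a b c /asboolP h1 /asboolP h2; apply/asboolP.
by have := sidealD h1 h2; rewrite addrA subrK.
Qed.
Canonical qequiv := EquivRel qrel qrel_refl qrel_sym qrel_trans.
Definition qalg : Type := {eq_quot qequiv}.
HB.instance Definition _ := Choice.on qalg.
HB.instance Definition _ := EqQuotient.on qalg.

Definition qpi (a : A) : qalg := \pi_qalg a.
Lemma qpiP a b : qpi a = qpi b <-> I (a - b).
Proof.
split=> [/eqP|h]; last by apply/eqP; rewrite eqmodE; apply/asboolP.
by rewrite eqmodE => /asboolP.
Qed.
Lemma qpi_repr x : qpi (repr x) = x. Proof. exact: reprK. Qed.
Lemma qrepr_pi a : I (repr (qpi a) - a).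
Proof. by apply/qpiP; rewrite qpi_repr. Qed.

Definition qadd (x y : qalg) : qalg := qpi (repr x + repr y).
Definition qopp (x : qalg) : qalg := qpi (- repr x).
Definition qscale (c : K) (x : qalg) : qalg := qpi (c *: repr x).
Definition qmul (x y : qalg) : qalg := qpi (repr x * repr y).

Fact qaddE a b : qadd (qpi a) (qpi b) = qpi (a + b).
Proof. by apply/qpiP; rewrite opprD addrACA; apply: sidealD; apply: qrepr_pi. Qed.
Fact qoppE a : qopp (qpi a) = qpi (- a).
Proof. by apply/qpiP; rewrite -opprD; apply: sidealN; apply: qrepr_pi. Qed.
Fact qscaleE c a : qscale c (qpi a) = qpi (c *: a).
Proof. by apply/qpiP; rewrite -scalerBr; apply: sidealZ; apply: qrepr_pi. Qed.
Fact qmulE a b : qmul (qpi a) (qpi b) = qpi (a * b).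
Proof.
apply/qpiP; rewrite -[_ - _](subrKA (repr (qpi a) * b)) -mulrBr -mulrBl.
by apply: sidealD; [apply: (sidealMl hI)|apply: (sidealMr hI)]; apply: qrepr_pi.
Qed.

Lemma qpi_ind (P : qalg -> Prop) : (forall a, P (qpi a)) -> forall x, P x.
Proof. by move=> h x; rewrite -(qpi_repr x). Qed.

Fact qaddA : associative qadd.
Proof. by elim/qpi_ind=> a; elim/qpi_ind=> b; elim/qpi_ind=> c; rewrite !qaddE addrA. Qed.
Fact qaddC : commutative qadd.
Proof. by elim/qpi_ind=> a; elim/qpi_ind=> b; rewrite !qaddE addrC. Qed.
Fact qadd0 : left_id (qpi 0) qadd.
Proof. by elim/qpi_ind=> a; rewrite qaddE add0r. Qed.
Fact qaddN : left_inverse (qpi 0) qopp qadd.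
Proof. by elim/qpi_ind=> a; rewrite qoppE qaddE addNr. Qed.
HB.instance Definition _ := GRing.isZmodule.Build qalg qaddA qaddC qadd0 qaddN.
Lemma qpiD a b : qpi (a + b) = qpi a + qpi b. Proof. by rewrite -qaddE. Qed.

Fact qmulA : associative qmul.
Proof. by elim/qpi_ind=> a; elim/qpi_ind=> b; elim/qpi_ind=> c; rewrite !qmulE mulrA. Qed.
Fact qmul1l : left_id (qpi 1) qmul.
Proof. by elim/qpi_ind=> a; rewrite qmulE mul1r. Qed.
Fact qmul1r : right_id (qpi 1) qmul.
Proof. by elim/qpi_ind=> a; rewrite qmulE mulr1. Qed.
Fact qmulDl : left_distributive qmul +%R.
Proof.
by elim/qpi_ind=> a; elim/qpi_ind=> b; elim/qpi_ind=> c; rewrite -qpiD !qmulE -qpiD mulrDl.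
Qed.
Fact qmulDr : right_distributive qmul +%R.
Proof.
by elim/qpi_ind=> a; elim/qpi_ind=> b; elim/qpi_ind=> c; rewrite -qpiD !qmulE -qpiD mulrDr.
Qed.
Fact q1_neq0 : qpi 1 != 0 :> qalg.
Proof. by apply/eqP => /qpiP; rewrite subr0; apply: sideal1. Qed.
HB.instance Definition _ := GRing.Zmodule_isNzRing.Build qalg
  qmulA qmul1l qmul1r qmulDl qmulDr q1_neq0.

Fact qscaleA c d x : qscale c (qscale d x) = qscale (c * d) x.
Proof. by elim/qpi_ind: x => a; rewrite !qscaleE scalerA. Qed.
Fact qscale1 : left_id 1 qscale.
Proof. by elim/qpi_ind=> a; rewrite qscaleE scale1r. Qed.
Fact qscaleDr : right_distributive qscale +%R.
Proof. by move=> c; elim/qpi_ind=> a; elim/qpi_ind=> b; rewrite -qpiD !qscaleE -qpiD scalerDr. Qed.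
Fact qscaleDl x : {morph qscale^~ x : c d / c + d >-> c + d}.
Proof. by elim/qpi_ind: x => a c d; rewrite !qscaleE -qpiD scalerDl. Qed.
HB.instance Definition _ :=
  GRing.Zmodule_isLmodule.Build K qalg qscaleA qscale1 qscaleDr qscaleDl.
Fact qscaleAl (c : K) (x y : qalg) : c *: (x * y) = (c *: x) * y.
Proof.
elim/qpi_ind: x => a; elim/qpi_ind: y => b.
by rewrite /GRing.mul /GRing.scale /= qmulE !qscaleE qmulE scalerAl.
Qed.
HB.instance Definition _ := GRing.Lmodule_isLalgebra.Build K qalg qscaleAl.
Fact qscaleAr (c : K) (x y : qalg) : c *: (x * y) = x * (c *: y).
Proof.
elim/qpi_ind: x => a; elim/qpi_ind: y => b.
by rewrite /GRing.mul /GRing.scale /= qmulE !qscaleE qmulE scalerAr.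
Qed.
HB.instance Definition _ := GRing.Lalgebra_isAlgebra.Build K qalg qscaleAr.

Lemma qpiM a b : qpi (a * b) = qpi a * qpi b. Proof. by rewrite -qmulE. Qed.
Lemma qpiZ (c : K) a : qpi (c *: a) = c *: qpi a. Proof. by rewrite -qscaleE. Qed.

Definition qhp i (x : qalg) : qalg := qpi (hpart i (repr x)).
Lemma qhpE i a : qhp i (qpi a) = qpi (hpart i a).
Proof. by apply/qpiP; rewrite -linearB; apply: (sideal_hpart hI); apply: qrepr_pi. Qed.
Fact qhp_linear i : linear (qhp i).
Proof.
by move=> c; elim/qpi_ind=> a; elim/qpi_ind=> b; rewrite -qpiZ -qpiD !qhpE -qpiZ -qpiD linearP.
Qed.
HB.instance Definition _ i := GRing.isLinear.Build K qalg qalg _ (qhp i) (qhp_linear i).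
Fact qhpK i j x : qhp i (qhp j x) = if i == j then qhp j x else 0.
Proof. by elim/qpi_ind: x => a; rewrite !qhpE salg_compK; case: eqP. Qed.
Fact qhpD x : qhp false x + qhp true x = x.
Proof. by elim/qpi_ind: x => a; rewrite !qhpE -qpiD salg_compD. Qed.
Fact qhp1 : qhp false 1 = 1.
Proof. by rewrite qhpE salg_comp1. Qed.
Fact qhp_ind i (P : qalg -> Prop) :
  (forall a, homogeneous i a -> P (qpi a)) -> forall x, qhp i x = x -> P x.
Proof. by move=> h x <-; elim/qpi_ind: x => a; rewrite qhpE; apply: h; apply: hpart_homog. Qed.
Fact qhpM i j x y : qhp i x = x -> qhp j y = y -> qhp (i (+) j) (x * y) = x * y.
Proof.
move=> hx hy; elim/qhp_ind: x / hx => a ha; elim/qhp_ind: y / hy => b hb.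
by rewrite -qpiM qhpE (homogM ha hb).
Qed.
Fact qhp_comm i j x y : qhp i x = x -> qhp j y = y -> x * y = (-1) ^+ (i && j) * (y * x).
Proof.
move=> hx hy; elim/qhp_ind: x / hx => a ha; elim/qhp_ind: y / hy => b hb.
rewrite -!qpiM (salg_comm ha hb); case: (i && j); rewrite ?expr0 ?expr1 ?mul1r //.
by rewrite !mulN1r -qoppE.
Qed.
Definition qsalg : SAlg K := @MkSAlg K qalg qhp qhpK qhpD qhp1 qhpM qhp_comm.

Fact qpi_linear : linear (qpi : A -> qsalg).
Proof. by move=> c a b; rewrite qpiD qpiZ. Qed.
Definition qproj : SHom A qsalg :=
  mk_shom qpi_linear (qpiM : {morph (qpi : A -> qsalg) : x y / x * y}) (erefl : qpi 1 = (1 : qsalg))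
    (fun i a => esym (qhpE i a)).
Lemma qproj_eq0 a : qproj a = 0 <-> I a.
Proof. by rewrite -[a in I a]subr0; exact: (@qpiP a 0). Qed.
Lemma qproj_surj (x : qsalg) : exists a, qproj a = x.
Proof. by exists (repr (x : qalg)); apply: qpi_repr. Qed.
End Quotient.

Section Sub.
Variables (K : fieldType) (A : SAlg K) (B : A -> Prop).
Record is_subsalg : Prop := IsSubsalg {
  subsalg_lin : forall (c : K) a b, B a -> B b -> B (c *: a + b);
  subsalgM : forall a b, B a -> B b -> B (a * b);
  subsalg1 : B 1;
  subsalg_hpart : forall i a, B a -> B (hpart i a)
}.
Hypothesis hB : is_subsalg.

Definition sub_pred of is_subsalg : A -> bool := fun a => `[< B a >].
Fact sub_closed : subalg_closed (sub_pred hB).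
Proof.
split=> [|c a b /asboolP ha /asboolP hb|a b /asboolP ha /asboolP hb]; apply/asboolP.
- exact: subsalg1.
- exact: subsalg_lin.
- exact: subsalgM.
Qed.
HB.instance Definition _ := GRing.isSubalgClosed.Build K A (sub_pred hB) sub_closed.
Definition subalg : Type := {x : A | sub_pred hB x}.
HB.instance Definition _ := SubChoice.on subalg.
HB.instance Definition _ := [SubChoice_isSubAlgebra of subalg by <:].

Fact subhp_proof i (x : subalg) : sub_pred hB (hpart i (val x)).
Proof. by apply/asboolP; apply: (subsalg_hpart hB); apply/asboolP/(valP x). Qed.
Definition subhp i (x : subalg) : subalg := exist (sub_pred hB) _ (subhp_proof i x).
Fact subhp_linear i : linear (subhp i).
Proof. by move=> c x y; apply: val_inj; rewrite /= linearP. Qed.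
HB.instance Definition _ i := GRing.isLinear.Build K subalg subalg _ (subhp i) (subhp_linear i).
Fact subhpK i j x : subhp i (subhp j x) = if i == j then subhp j x else 0.
Proof. by apply: val_inj; rewrite /= salg_compK; case: eqP. Qed.
Fact subhpD x : subhp false x + subhp true x = x.
Proof. by apply: val_inj; rewrite /= salg_compD. Qed.
Fact subhp1 : subhp false 1 = 1.
Proof. by apply: val_inj; rewrite /= salg_comp1. Qed.
Fact subhpM i j x y : subhp i x = x -> subhp j y = y -> subhp (i (+) j) (x * y) = x * y.
Proof.
move=> /(congr1 val) hx /(congr1 val) hy; apply: val_inj.
exact: (salg_compM hx hy).
Qed.
Fact subhp_comm i j x y : subhp i x = x -> subhp j y = y -> x * y = (-1) ^+ (i && j) * (y * x).
Proof.
move=> /(congr1 val) hx /(congr1 val) hy; apply: val_inj.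
have := salg_comm hx hy; case: (i && j); rewrite ?expr0 ?expr1 ?mul1r ?mulN1r => e; exact: e.
Qed.
Definition sub_salg : SAlg K := @MkSAlg K subalg subhp subhpK subhpD subhp1 subhpM subhp_comm.
Let vl (x : sub_salg) : A := val (x : subalg).
Fact vl_linear : linear vl. Proof. by []. Qed.
Fact vlM : {morph vl : x y / x * y}. Proof. by []. Qed.
Definition sub_incl : SHom sub_salg A := mk_shom vl_linear vlM erefl (fun i a => erefl).
Lemma sub_incl_inj : injective sub_incl. Proof. exact: val_inj. Qed.
Lemma sub_inclP x : B (sub_incl x). Proof. by apply/asboolP; apply: (valP (x : subalg)). Qed.
Lemma sub_incl_onto a : B a -> exists x, sub_incl x = a.
Proof. by move=> /asboolP h; exists (exist (sub_pred hB) a h). Qed.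
End Sub.

Lemma stensor_hom_ext (K : fieldType) (A B R : SAlg K) (u v : SHom (stensor_salg A B) R) :
  (forall a b, u (stens a b) = v (stens a b)) -> u = v.
Proof.
move=> h; apply: shom_ext; apply: lin_tens_ext => //; [exact: (shomP u)|exact: (shomP v)].
Qed.

Section SpairTheory.
Variables (K : fieldType) (A B R : SAlg K).
Lemma spair_natural (S : SAlg K) (f : SHom R S) (x : SHom A R) (y : SHom B R) :
  shom_compose f (spair x y) = spair (shom_compose f x) (shom_compose f y).
Proof. by apply: stensor_hom_ext => a b; rewrite spairE /= -shomM -spairE. Qed.
Lemma spair_smap (A' B' : SAlg K) (f : SHom A' A) (g : SHom B' B) (x : SHom A R) (y : SHom B R) :
  shom_compose (spair x y) (smap f g) = spair (shom_compose x f) (shom_compose y g).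
Proof.
apply: stensor_hom_ext => a b; rewrite spairE.
by rewrite [LHS](_ : _ = spair x y (smap f g (stens a b))) // smapE spairE.
Qed.
End SpairTheory.

(** * Derived subgroups *)

Section ClosedSub.
Variables (K : fieldType) (G : supergroup K) (B : SAlg K) (f : SHom (coord_alg G) B).
Definition factors R (g : point G R) : Prop := exists h : SHom B R, shom_compose h f = g.
Hypotheses (fs : forall b, exists a, f a = b)
  (facM : forall R (g h : point G R), factors g -> factors h -> factors (pmul g h))
  (fac1 : forall R, factors (pone G R))
  (facV : forall R (g : point G R), factors g -> factors (pinv g)).

(** Surjectivity of [f] makes factorizations through [f] unique. The operations of [G] on the
    factoring points therefore define operations on morphisms out of [B], which inherit the group
    axioms and naturality. *)
Lemma closed_subgroup : exists (H : supergroup K) (i : supergroup_hom H G),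
  [/\ closed_embedding i,
      forall a, comorphism i a = 0 <-> f a = 0 &
      forall R (g : point G R), (exists h, point_map i h = g) <-> factors g].
Proof.
have self R (h : SHom B R) : factors (shom_compose h f : point G R) by exists h.
pose mul R (g h : SHom B R) := sval (cid (facM (self R g) (self R h))).
have mulE R g h : shom_compose (mul R g h) f =
    pmul (shom_compose g f : point G R) (shom_compose h f).
  exact: (svalP (cid (facM (self R g) (self R h)))).
pose one R := sval (cid (fac1 R)).
have oneE R : shom_compose (one R) f = pone G R by exact: (svalP (cid (fac1 R))).
pose inv R (g : SHom B R) := sval (cid (facV (self R g))).
have invE R g : shom_compose (inv R g) f = pinv (shom_compose g f : point G R).
  exact: (svalP (cid (facV (self R g)))).
have inj R (g h : SHom B R) : shom_compose g f = shom_compose h f -> g = h.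
  exact: shom_surj_inj.
have mulA R : associative (mul R).
  by move=> x y z; apply: inj; rewrite !mulE pmulA.
have mul1 R : left_id (one R) (mul R).
  by move=> x; apply: inj; rewrite !mulE oneE pmul1.
have mulV R : left_inverse (one R) (inv R) (mul R).
  by move=> x; apply: inj; rewrite mulE invE oneE pmulV.
have mul_nat (R S : SAlg K) (u : SHom R S) g h :
    shom_compose u (mul R g h) = mul S (shom_compose u g) (shom_compose u h).
  by apply: inj; rewrite -shom_composeA !mulE pmul_natural !shom_composeA.
pose H := MkSupergroup mulA mul1 mulV mul_nat.
pose i := @MkSupergroupHom K H G f mulE.
by exists H, i; split => // R g.
Qed.
End ClosedSub.

Section AbelianSets.
Variables (K : fieldType) (G : supergroup K).
Let A := coord_alg G.

(* Such a set generates a cocommutative Hopf super-subalgebra, that is, an abelian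
   quotient of G; the largest one, [ab_gen], cuts out the derived subgroup. *)
Record abelian_set (X : A -> Prop) : Prop := IsAbelianSet {
  ab_hpart : forall i a, X a -> X (hpart i a);
  ab_comult : forall a, X a -> exists s : seq (A * A),
    (forall p, p \in s -> X p.1 /\ X p.2) /\
    forall R (g h : point G R), pmul g h a = \sum_(p <- s) g p.1 * h p.2;
  ab_antipode : forall a, X a -> X (antipode G a);
  ab_comm : forall a, X a -> forall R (g h : point G R), pmul g h a = pmul h g a
}.

(** Over a field the inclusion of [B] remains injective after tensoring, so comultiplication and
    antipode restrict to [B]. A morphism out of [B] need not extend to a point of [G]; the group
    laws are therefore checked at universal morphisms, where injectivity reduces them to those of
    [G]. *)
Lemma quotient_supergroup (B : A -> Prop) : is_subsalg B -> abelian_set B ->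
  exists (Q : supergroup K) (p : supergroup_hom G Q),
  [/\ abelian_supergroup Q, injective (comorphism p) &
      forall a, B a <-> exists c, comorphism p c = a].
Proof.
move=> hB abB; pose C := sub_salg hB; pose io : SHom C A := sub_incl hB.
have ioi : injective io by exact: sub_incl_inj.
have ioB c : B (io c) by exact: sub_inclP.
have io_onto a : B a -> exists c, io c = a by exact: sub_incl_onto.
have [m mE] : exists m : SHom C (stensor_salg C C),
    shom_compose (smap io io) m = shom_compose (comult G) io.
  apply: shom_lift_inj; first exact: smap_inj.
  move=> c; have [s [sB sE]] := ab_comult abB (ioB c).
  have [q hq] : exists q, smap io io q = \sum_(j <- s) (sinl j.1 * sinr j.2).
    elim: s sB {sE} => [|p s ih] sB.
      by exists (0 : stensor_salg C C); rewrite big_nil shom0.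
    have [q hq] : exists q, smap io io q = \sum_(j <- s) (sinl j.1 * sinr j.2).
      by apply: ih => q qs; apply: sB; rewrite inE qs orbT.
    have [/io_onto[x hx] /io_onto[y hy]] := sB p (mem_head _ _).
    exists ((stens x y : stensor_salg C C) + q).
    by rewrite shomD hq big_cons smapE hx hy stens_sinlr.
  by exists q; rewrite hq; symmetry; apply: sE.
pose mul R (x y : SHom C R) : SHom C R := shom_compose (spair x y) m.
have mul_io R (x y : point G R) :
    mul R (shom_compose x io) (shom_compose y io) = shom_compose (pmul x y) io.
  rewrite /mul -spair_smap -shom_composeA mE.
  by rewrite pmul_spair shom_composeA.
have mul_nat (R S : SAlg K) (u : SHom R S) g h :
    shom_compose u (mul R g h) = mul S (shom_compose u g) (shom_compose u h).
  by rewrite /mul shom_composeA spair_natural.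
have inj (R S T : SAlg K) (u : SHom R S) (x y : SHom T R) : injective u ->
    shom_compose u x = shom_compose u y -> x = y.
  by move=> ui e; apply: shom_ext => t; apply: ui; apply: (congr1 (fun k : SHom T S => k t) e).
pose one R : SHom C R := shom_compose (pone G R) io.
have [sC sE] : exists sC : SHom C C, shom_compose io sC = shom_compose (antipode G) io.
  apply: shom_lift_inj => // c; apply: io_onto; exact: (ab_antipode abB).
pose inv R (x : SHom C R) : SHom C R := shom_compose x sC.
have mulA R : associative (mul R).
  move=> x y z.
  (* Three arbitrary morphisms are images under [u] of the three universal ones into C (x) C (x) C,
     where associativity can be tested after embedding into A (x) A (x) A. *)
  pose T := stensor_salg C (stensor_salg C C).
  pose u : SHom T R := spair x (spair y z).
  pose b1 : SHom C T := sinl.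
  pose b2 : SHom C T := shom_compose sinr sinl.
  pose b3 : SHom C T := shom_compose sinr sinr.
  have e1 : x = shom_compose u b1 by rewrite spair_inl.
  have e2 : y = shom_compose u b2 by rewrite shom_composeA spair_inr spair_inl.
  have e3 : z = shom_compose u b3 by rewrite shom_composeA spair_inr spair_inr.
  rewrite e1 e2 e3 -!mul_nat; congr (shom_compose u _).
  pose j : SHom T _ := smap io (smap io io).
  have ji : injective j by do 2!apply: smap_inj => //.
  apply: (inj _ _ _ j) => //; rewrite !mul_nat.
  have -> : shom_compose j b1 = shom_compose sinl io by rewrite spair_inl.
  have -> : shom_compose j b2 = shom_compose (shom_compose sinr sinl) io.
    by rewrite shom_composeA spair_inr -shom_composeA spair_inl shom_composeA.
  have -> : shom_compose j b3 = shom_compose (shom_compose sinr sinr) io.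
    by rewrite shom_composeA spair_inr -shom_composeA spair_inr shom_composeA.
  by rewrite !mul_io pmulA.
have mul1 R : left_id (one R) (mul R).
  move=> x; rewrite -[x in RHS]shom_compose1 -[in LHS](shom_compose1 x).
  have -> : one R = shom_compose x (one C).
    by rewrite /one shom_composeA pone_natural.
  rewrite -mul_nat; congr (shom_compose x _).
  apply: (inj _ _ _ io) => //; rewrite mul_nat /one shom_composeA pone_natural.
  rewrite shom_compose1 -[X in mul _ _ X](shom_1compose io) (mul_io _ (pone G A) (shom_id A)).
  by rewrite pmul1 shom_1compose.
have mulV R : left_inverse (one R) (inv R) (mul R).
  move=> x; rewrite -[X in mul _ _ X]shom_compose1 /inv.
  have -> : one R = shom_compose x (one C).
    by rewrite /one shom_composeA pone_natural.
  rewrite -mul_nat; congr (shom_compose x _).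
  apply: (inj _ _ _ io) => //; rewrite mul_nat /one shom_composeA pone_natural sE.
  rewrite shom_compose1 -[X in mul _ _ X](shom_1compose io) (mul_io _ (antipode G) (shom_id A)).
  by rewrite pmulV.
pose Q := MkSupergroup mulA mul1 mulV mul_nat.
have pM R (g h : point G R) : shom_compose (pmul g h) io =
    @pmul K Q R (shom_compose g io) (shom_compose h io).
  by rewrite [RHS]mul_io.
exists Q, (@MkSupergroupHom K G Q io pM); split => //.
- move=> R x y.
  change (mul R x y = mul R y x).
  pose u : SHom (stensor_salg C C) R := spair x y.
  have e1 : x = shom_compose u sinl by rewrite spair_inl.
  have e2 : y = shom_compose u sinr by rewrite spair_inr.
  rewrite e1 e2 -!mul_nat; congr (shom_compose u _).
  apply: (inj _ _ _ (smap io io)); first exact: smap_inj.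
  rewrite !mul_nat spair_inl spair_inr !mul_io; apply: shom_ext => c.
  exact: (ab_comm abB (ioB c) (sinl : point G _) sinr).
- by move=> a; split=> [/io_onto//|[c <-]].
Qed.

Inductive ab_gen : A -> Prop :=
| AbGen X a : abelian_set X -> X a -> ab_gen a
| AbGen1 : ab_gen 1
| AbGenL (c : K) a b : ab_gen a -> ab_gen b -> ab_gen (c *: a + b)
| AbGenM a b : ab_gen a -> ab_gen b -> ab_gen (a * b).

Lemma ab_gen0 : ab_gen 0.
Proof. by have := AbGenL (-1) AbGen1 AbGen1; rewrite scaleN1r addNr. Qed.
Lemma ab_genD a b : ab_gen a -> ab_gen b -> ab_gen (a + b).
Proof. by rewrite -{2}[a]scale1r; apply: AbGenL. Qed.
Lemma ab_genN a : ab_gen a -> ab_gen (- a).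
Proof. by move=> h; rewrite -[- a]addr0 -scaleN1r; apply: AbGenL => //; apply: ab_gen0. Qed.
Lemma ab_genZ (c : K) a : ab_gen a -> ab_gen (c *: a).
Proof. by move=> h; rewrite -[_ *: a]addr0; apply: AbGenL => //; apply: ab_gen0. Qed.

Lemma ab_gen_hpart a : ab_gen a -> forall i, ab_gen (hpart i a).
Proof.
elim=> {a} [X a abX Xa i||c a b _ ha _ hb i|a b _ ha _ hb i].
- by apply: (AbGen abX); apply: (ab_hpart abX).
- by case; rewrite ?salg_comp1 ?(@hpart_other _ _ false _ homog1); [exact: ab_gen0|exact: AbGen1].
- by rewrite linearP; apply: AbGenL.
- by case: i; rewrite ?hpartM0 ?hpartM1; apply: ab_genD; apply: AbGenM.
Qed.

Lemma ab_gen_subsalg : is_subsalg ab_gen.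
Proof.
split; [exact: AbGenL|exact: AbGenM|exact: AbGen1|by move=> i a h; apply: ab_gen_hpart].
Qed.

Lemma ab_gen_comult a : ab_gen a -> exists s : seq (A * A),
    (forall p, p \in s -> ab_gen p.1 /\ ab_gen p.2) /\
    forall R (g h : point G R), pmul g h a = \sum_(p <- s) g p.1 * h p.2.
Proof.
elim=> {a} [X a abX Xa||c a b _ [s [sB sE]] _ [t [tB tE]]|a b _ [s [sB sE]] _ [t [tB tE]]].
- have [s [sX sE]] := ab_comult abX Xa; exists s; split => // p /sX[h1 h2].
  by split; apply: (AbGen abX).
- exists [:: (1, 1)]; split; first by move=> p; rewrite inE => /eqP ->; split; exact: AbGen1.
  by move=> R g h; rewrite big_seq1 !shom1 mulr1.
- exists ([seq (c *: p.1, p.2) | p <- s] ++ t); split.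
    move=> p; rewrite mem_cat => /orP[/mapP[q /sB[h1 h2] ->]|/tB//].
    by split => //; apply: ab_genZ.
  move=> R g h; rewrite shomP big_cat sE tE big_map scaler_sumr; congr (_ + _).
  by apply: eq_bigr => p _; rewrite shomZ scalerAl.
(* Multiplying two decompositions exchanges [p.2] with [q.1]; the odd half of [p.2] turns [q.1] into
   [ginv q.1]. *)
pose F (p q : A * A) := [:: (p.1 * q.1, hpart false p.2 * q.2); (p.1 * ginv q.1, hpart true p.2 * q.2)].
exists (flatten [seq flatten [seq F p q | q <- t] | p <- s]); split.
  move=> r /flatten_mapP[p /sB[p1 p2] /flatten_mapP[q /tB[q1 q2]]].
  rewrite !inE => /orP[] /eqP -> /=; split; apply: AbGenM => //; try exact: ab_gen_hpart.
  by rewrite ginvE; apply: ab_genD; [|apply: ab_genN]; apply: ab_gen_hpart.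
move=> R g h; rewrite shomM sE tE big_flatten big_map mulr_suml; apply: eq_bigr => p _.
rewrite big_flatten big_map mulr_sumr; apply: eq_bigr => q _.
rewrite /F big_cons big_seq1 /= !shomM.
rewrite -[X in _ * h X * _](salg_compD p.2) shomD mulrDr mulrDl.
congr (_ + _); rewrite -!mulrA; congr (_ * _); rewrite !mulrA; congr (_ * _).
  by rewrite even_comm_l //; apply: shom_homog; apply: hpart_homog.
rewrite odd_ginv; last by apply: shom_homog; apply: hpart_homog.
by rewrite !ginvE -!shom_comp shomB.
Qed.

Lemma ab_gen_abelian : abelian_set ab_gen.
Proof.
split; [by move=> i a h; apply: ab_gen_hpart|exact: ab_gen_comult| |].
  move=> a; elim=> {a} [X a abX Xa||c a b _ ha _ hb|a b _ ha _ hb].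
  - by apply: (AbGen abX); apply: (ab_antipode abX).
  - by rewrite shom1; exact: AbGen1.
  - by rewrite shomP; apply: AbGenL.
  - by rewrite shomM; apply: AbGenM.
move=> a; elim=> {a} [X a abX Xa R g h|R g h|c a b _ ha _ hb R g h|a b _ ha _ hb R g h].
- exact: (ab_comm abX).
- by rewrite !shom1.
- by rewrite !shomP ha hb.
- by rewrite !shomM ha hb.
Qed.

(** These are the points of the derived super-subgroup. Quantifying over all abelian sets allows a
    small explicit set around one given function to be inserted later. *)
Definition kills_abelian R (g : point G R) : Prop :=
  forall X, abelian_set X -> forall a, X a -> g a = pone G R a.

Lemma ab_gen_kill R (g : point G R) : kills_abelian g ->
  forall a, ab_gen a -> g a = pone G R a.
Proof. by move=> h a; apply: h; exact: ab_gen_abelian. Qed.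

End AbelianSets.

Section IdealGenerated.
Variables (K : fieldType) (A : SAlg K) (S : A -> Prop).

Lemma ideal_gen_incl a b : S a -> in_ideal_generated S (a * b).
Proof.
move=> Sa; exists [:: (a, b)]; rewrite big_seq1; split=> // p.
by rewrite inE => /eqP ->.
Qed.
Lemma ideal_gen0 : in_ideal_generated S 0.
Proof. by exists [::]; rewrite big_nil. Qed.
Lemma ideal_genD a b :
  in_ideal_generated S a -> in_ideal_generated S b -> in_ideal_generated S (a + b).
Proof.
move=> [s [sS ->]] [t [tS ->]]; exists (s ++ t); rewrite big_cat; split=> // p.
by rewrite mem_cat => /orP[/sS|/tS].
Qed.
Lemma ideal_gen_sum (I : eqType) (r : seq I) (F : I -> A) :
  (forall k, k \in r -> in_ideal_generated S (F k)) ->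
  in_ideal_generated S (\sum_(k <- r) F k).
Proof.
elim: r => [|k r ih] h; first by rewrite big_nil; exact: ideal_gen0.
rewrite big_cons; apply: ideal_genD; first by apply: h; rewrite mem_head.
by apply: ih => l lr; apply: h; rewrite inE lr orbT.
Qed.
Lemma ideal_genMr a b : in_ideal_generated S a -> in_ideal_generated S (a * b).
Proof.
move=> [s [sS ->]]; rewrite mulr_suml; apply: ideal_gen_sum => p ps.
by rewrite -mulrA; apply: ideal_gen_incl; apply: sS.
Qed.

Hypothesis S_hpart : forall i a, S a -> S (hpart i a).

Lemma ideal_genMl a b : in_ideal_generated S b -> in_ideal_generated S (a * b).
Proof.
move=> [s [sS ->]]; rewrite mulr_sumr; apply: ideal_gen_sum => p ps.
have -> : a * (p.1 * p.2) = hpart false p.1 * (a * p.2) + hpart true p.1 * (ginv a * p.2).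
  rewrite !mulrA -mulrDl -{1}(salg_compD p.1) mulrDr.
  rewrite -(even_comm_l _ (hpart_homog false _)).
  by rewrite (odd_ginv _ (hpart_homog true _)) ginvK.
by apply: ideal_genD; apply: ideal_gen_incl; apply: S_hpart; apply: sS.
Qed.

Lemma ideal_gen_hpart i a : in_ideal_generated S a -> in_ideal_generated S (hpart i a).
Proof.
move=> [s [sS ->]]; rewrite linear_sum; apply: ideal_gen_sum => p ps.
have h j b : in_ideal_generated S (hpart j p.1 * b).
  by apply: ideal_gen_incl; apply: S_hpart; apply: sS.
by case: i; rewrite /= ?hpartM0 ?hpartM1; apply: ideal_genD; apply: h.
Qed.

Lemma ideal_gen_zero (C : SAlg K) (f : SHom A C) :
  (forall a, S a -> f a = 0) -> forall a, in_ideal_generated S a -> f a = 0.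
Proof.
move=> fS a [s [sS ->]]; rewrite shom_sum big_seq big1 // => p ps.
by rewrite shomM fS ?mul0r //; apply: sS.
Qed.

Lemma ideal_gen_sideal (C : SAlg K) (f : SHom A C) :
  (forall a, S a -> f a = 0) -> is_sideal (in_ideal_generated S).
Proof.
move=> fS; split.
- move=> c a b ha hb; apply: ideal_genD => //.
  by rewrite -[a]mul1r scalerAl; apply: ideal_genMl.
- exact: ideal_genMl.
- exact: ideal_genMr.
- exact: ideal_gen_hpart.
- exact: ideal_gen0.
- by move/(ideal_gen_zero fS)/eqP; rewrite shom1 oner_eq0.
Qed.
End IdealGenerated.

Lemma ideal_gen_ext (K : fieldType) (A : SAlg K) (S T : A -> Prop) :
  (forall a, S a -> T a) -> forall a, in_ideal_generated S a -> in_ideal_generated T a.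
Proof. by move=> ST a [s [sS ->]]; exists s; split => // p /sS /ST. Qed.

Section Derived.
Variables (K : fieldType).

Lemma image_abelian_set (G Q : supergroup K) (p : supergroup_hom G Q) :
  abelian_supergroup Q -> abelian_set (fun a => exists c, comorphism p c = a).
Proof.
move=> abQ; split.
- by move=> i _ [c <-]; exists (hpart i c); rewrite shom_comp.
- move=> _ [c <-]; have [s sE] := comult_list c.
  exists [seq (comorphism p q.1, comorphism p q.2) | q <- s]; split.
    by move=> _ /mapP[q _ ->]; split; [exists q.1|exists q.2].
  move=> R g h; rewrite big_map -[LHS]/(shom_compose (pmul g h) (comorphism p) c).
  by rewrite comorphismM sE.
- by move=> _ [c <-]; exists (antipode Q c); rewrite antipode_comorphism.
- move=> _ [c <-] R g h.
  rewrite -[LHS]/(shom_compose (pmul g h) (comorphism p) c).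
  by rewrite -[RHS]/(shom_compose (pmul h g) (comorphism p) c) !comorphismM abQ.
Qed.

(** The ideal is generated by the elements of [ab_gen] with counit 0. Normality: a function in an
    abelian set takes equal values at gh and hg, hence at a point and at its conjugates. Minimality:
    the functions coming from any abelian quotient form an abelian set, and so are neutral on
    [D]. *)
Theorem derived_exists (G : supergroup K) :
  exists (D : supergroup K) (i : supergroup_hom D G),
    is_derived i /\ forall R (d : point D R), kills_abelian (point_map i d).
Proof.
pose A := coord_alg G.
pose S (a : A) := ab_gen a /\ eps a = 0.
have abB := ab_gen_abelian G.
have S_hpart i a : S a -> S (hpart i a).
  move=> [ha ea]; split; first exact: ab_gen_hpart.
  case: i; first by apply: eps_odd; apply: hpart_homog.
  have := ea; rewrite -{1}(salg_compD a) epsD [X in _ + X]eps_odd ?addr0 //.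
  exact: hpart_homog.
have S0 a : S a -> counit G a = 0 by case.
have hI : is_sideal (in_ideal_generated S) by exact: ideal_gen_sideal S_hpart _ (counit G) S0.
pose f := qproj hI.
have facP R (g : point G R) : factors f g <-> kills_abelian g.
  split=> [[h <-] X abX a Xa|hk].
    have : f (a - (eps a)%:A) = 0.
      apply/qproj_eq0; rewrite -[a - _]mulr1; apply: ideal_gen_incl; split.
        by apply: ab_genD; [exact: (AbGen abX)|apply/ab_genN/ab_genZ/AbGen1].
      by rewrite epsB epsZ eps1 mulr1 subrr.
    move/eqP; rewrite shomB subr_eq0 => /eqP e; rewrite -[LHS]/(h (f a)) e !shom_scal1.
    by rewrite epsE.
  apply: shom_factor; first exact: qproj_surj.
  move=> a /qproj_eq0; apply: ideal_gen_zero => b [hb eb].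
  by rewrite (ab_gen_kill hk hb) epsE eb scale0r.
have killM R (g h : point G R) : kills_abelian g -> kills_abelian h -> kills_abelian (pmul g h).
  move=> hg hh X abX a Xa; have [s [sX sE]] := ab_comult abX Xa.
  rewrite -[in RHS](pmul1 (pone G R)) !sE big_seq [RHS]big_seq; apply: eq_bigr => p ps.
  by have [p1 p2] := sX p ps; rewrite (hg X abX _ p1) (hh X abX _ p2).
have killV R (g : point G R) : kills_abelian g -> kills_abelian (pinv g).
  move=> hg X abX a Xa; rewrite pinvE -[LHS]/(g (antipode G a)) (hg X abX); last exact: (ab_antipode abX).
  rewrite -[LHS]/(shom_compose (pone G R) (antipode G) a) -pinvE.
  by rewrite -[pinv _]pmulg1 pmulV.
have [||||D [i [ci ki fi]]] := closed_subgroup (f := f) (G := G).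
- exact: qproj_surj.
- by move=> R g h /facP hg /facP hh; apply/facP; apply: killM.
- by move=> R; apply/facP.
- by move=> R g /facP hg; apply/facP; apply: killV.
have iP R (d : point D R) : kills_abelian (point_map i d).
  by apply/facP/fi; exists d.
exists D, i; split=> //.
have [Q [p [abQ pinj pP]]] := quotient_supergroup (ab_gen_subsalg G) abB.
split; last first.
  move=> N j [cj _ [Q' [p' [[p'inj p'ker] abQ']]]] R m.
  have [n hn] : exists n : point N R, shom_compose n (comorphism j) = point_map i m.
    apply: shom_factor => // a /p'ker; apply: ideal_gen_zero => b [c [c0 ->]].
    rewrite (iP _ m _ (image_abelian_set p' abQ')); last by exists c.
    by rewrite epsE eps_comorphism /eps c0 scale0r.
  by exists n.
split => //.
  move=> R g n.
  have [n' hn'] : exists n', point_map i n' = pmul (pmul g (point_map i n)) (pinv g).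
    apply/fi/facP => X abX a Xa.
    by rewrite (ab_comm abX Xa) pmulA pmulV pmul1; apply: (iP _ n _ abX).
  by exists n'.
exists Q, p; split => //; split => // a.
rewrite ki; split=> [/qproj_eq0|h]; last apply/qproj_eq0; last move: h;
  apply: ideal_gen_ext => b.
  move=> [/pP[c <-] eb]; exists c; split => //.
  by rewrite -[LHS]/(eps c) -(eps_comorphism p).
move=> [c [c0 ->]]; split; first by apply/pP; exists c.
by rewrite eps_comorphism.
Qed.

Lemma iterated_derived_shift (G D1 : supergroup K) (i : supergroup_hom D1 G) r D :
  is_derived i -> iterated_derived D1 r D -> iterated_derived G r.+1 D.
Proof.
move=> di; elim=> {r D} [|r D D' j _ ih dj]; last exact: IterDerivedS ih dj.
exact: IterDerivedS (IterDerived0 G) di.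
Qed.

Lemma solvable_of_derived (G D : supergroup K) (i : supergroup_hom D G) :
  is_derived i -> solvable_supergroup D -> solvable_supergroup G.
Proof.
move=> di [r [D' [h t]]]; exists r.+1, D'; split => //.
exact: (iterated_derived_shift di h).
Qed.

Fact hom_compM (H G L : supergroup K) (f : supergroup_hom H G) (g : supergroup_hom G L)
  R (x y : point H R) :
  shom_compose (pmul x y) (shom_compose (comorphism f) (comorphism g)) =
  pmul (shom_compose x (shom_compose (comorphism f) (comorphism g)))
       (shom_compose y (shom_compose (comorphism f) (comorphism g))).
Proof. by rewrite !shom_composeA !comorphismM. Qed.
Definition hom_comp (H G L : supergroup K) (f : supergroup_hom H G) (g : supergroup_hom G L) :
  supergroup_hom H L := MkSupergroupHom (hom_compM f g).

(** [F] is an arbitrary family of sets of points, in general neither closed under products nor known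
    to be representable; only closed super-subgroups inside it are considered. In this form the
    property can be propagated along derived super-subgroups. *)
Definition solvable_within (G : supergroup K) (F : forall R, point G R -> Prop) : Prop :=
  forall (D : supergroup K) (i : supergroup_hom D G), closed_embedding i ->
    (forall R (d : point D R), F R (point_map i d)) -> solvable_supergroup D.

(** Points of the derived super-subgroup of [D] kill the abelian sets of [D]. If this forces them
    into [F'], that super-subgroup is solvable, and then so is [D]. *)
Lemma solvable_within_step (G : supergroup K) (F F' : forall R, point G R -> Prop) :
  solvable_within F' ->
  (forall (D : supergroup K) (i : supergroup_hom D G), closed_embedding i ->
     (forall R (d : point D R), F R (point_map i d)) ->
     forall R (d : point D R), kills_abelian d -> F' R (point_map i d)) ->
  solvable_within F.
Proof.
move=> sF' step D i ci iF.
have [D1 [j [dj jk]]] := derived_exists D.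
apply: (solvable_of_derived dj); apply: (sF' D1 (hom_comp j i)).
  have [[cj _ _] _] := dj; move=> a; have [b <-] := cj a; have [c <-] := ci b.
  by exists c.
move=> R d.
have -> : point_map (hom_comp j i) d = point_map i (point_map j d).
  by rewrite /point_map shom_composeA.
by apply: step.
Qed.

Lemma solvable_within_trivial (G : supergroup K) (F : forall R, point G R -> Prop) :
  (forall R g, F R g -> g = pone G R) -> solvable_within F.
Proof.
move=> F1 D i ci iF; exists 0%N, D; split; first exact: IterDerived0.
move=> R d; apply: (point_map_inj ci); rewrite point_map1; exact: F1.
Qed.

Lemma solvable_within_sub (G : supergroup K) (F F' : forall R, point G R -> Prop) :
  (forall R g, F R g -> F' R g) -> solvable_within F' -> solvable_within F.
Proof. by move=> FF' sF' D i ci iF; apply: (sF' D i) => // R d; apply: FF'. Qed.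

Lemma solvable_within_all (G : supergroup K) :
  solvable_within (fun R (g : point G R) => True) -> solvable_supergroup G.
Proof.
move=> h; have idM R (x y : point G R) : shom_compose (pmul x y) (shom_id (coord_alg G)) =
    pmul (shom_compose x (shom_id _)) (shom_compose y (shom_id _)).
  by rewrite !shom_compose1.
by apply: (h G (MkSupergroupHom idM)) => // a; exists a.
Qed.

End Derived.

(** * Odd one-parameter points *)

Lemma shom_ginv (K : fieldType) (A B : SAlg K) (f : SHom A B) a : f (ginv a) = ginv (f a).
Proof. by rewrite !ginvE shomB !shom_comp. Qed.

Section SuperDual.
Variables (K : fieldType) (R : SAlg K).

(* R[s] with s odd: [SDual a b] stands for a + b s. *)
Record sdual : Type := SDual { dre : R; dim : R }.
Definition sdual_pair (x : sdual) : R * R := (dre x, dim x).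
Definition pair_sdual (p : R * R) : sdual := SDual p.1 p.2.
Fact sdual_pairK : cancel sdual_pair pair_sdual. Proof. by case. Qed.
HB.instance Definition _ := Choice.copy sdual (can_type sdual_pairK).
Implicit Types (x y z : sdual).
Definition dadd x y := SDual (dre x + dre y) (dim x + dim y).
Definition dopp x := SDual (- dre x) (- dim x).
Fact daddA : associative dadd. Proof. by move=> x y z; congr SDual; apply: addrA. Qed.
Fact daddC : commutative dadd. Proof. by move=> x y; congr SDual; apply: addrC. Qed.
Fact dadd0 : left_id (SDual 0 0) dadd.
Proof. by case=> a b; congr SDual; apply: add0r. Qed.
Fact daddN : left_inverse (SDual 0 0) dopp dadd.
Proof. by case=> a b; congr SDual; apply: addNr. Qed.
HB.instance Definition _ := GRing.isZmodule.Build sdual daddA daddC dadd0 daddN.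
Definition dscale (c : K) x := SDual (c *: dre x) (c *: dim x).
Fact dscaleA c d x : dscale c (dscale d x) = dscale (c * d) x.
Proof. by congr SDual; apply: scalerA. Qed.
Fact dscale1 : left_id 1 dscale.
Proof. by case=> a b; congr SDual; apply: scale1r. Qed.
Fact dscaleDr : right_distributive dscale +%R.
Proof. by move=> c x y; congr SDual; apply: scalerDr. Qed.
Fact dscaleDl x : {morph dscale^~ x : c d / c + d >-> c + d}.
Proof. by move=> c d; congr SDual; apply: scalerDl. Qed.
HB.instance Definition _ :=
  GRing.Zmodule_isLmodule.Build K sdual dscaleA dscale1 dscaleDr dscaleDl.

(** Forced by s c = ginv(c) s and s^2 = 0. *)
Definition dmul x y : sdual := SDual (dre x * dre y) (dre x * dim y + dim x * ginv (dre y)).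

Fact ginvD (a b : R) : ginv (a + b) = ginv a + ginv b.
Proof. exact: raddfD. Qed.
Fact dmulA : associative dmul.
Proof.
move=> [a b] [c d] [e f]; rewrite /dmul /=; congr SDual; first exact: mulrA.
by rewrite !mulrDr !mulrDl ginvM !mulrA addrA.
Qed.
Fact dmul1l : left_id (SDual 1 0) dmul.
Proof. by move=> [a b]; rewrite /dmul /= !mul1r mul0r addr0. Qed.
Fact dmul1r : right_id (SDual 1 0) dmul.
Proof. by move=> [a b]; rewrite /dmul /= ginv1 !mulr1 mulr0 add0r. Qed.
Fact dmulDl : left_distributive dmul +%R.
Proof.
move=> [a b] [c d] [e f]; rewrite /dmul /=; congr SDual; first exact: mulrDl.
by rewrite /= !mulrDl addrACA.
Qed.
Fact dmulDr : right_distributive dmul +%R.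
Proof.
move=> [a b] [c d] [e f]; rewrite /dmul /=; congr SDual; first exact: mulrDr.
by rewrite /= ginvD !mulrDr addrACA.
Qed.
Fact d1_neq0 : (SDual 1 0) != 0.
Proof. by apply/eqP => -[/eqP]; rewrite oner_eq0. Qed.
HB.instance Definition _ := GRing.Zmodule_isNzRing.Build sdual
  dmulA dmul1l dmul1r dmulDl dmulDr d1_neq0.
Lemma dmulE x y : x * y = SDual (dre x * dre y) (dre x * dim y + dim x * ginv (dre y)) :> sdual.
Proof. by []. Qed.
Fact dscaleAl (c : K) x y : c *: (x * y) = (c *: x) * y.
Proof. by rewrite !dmulE; congr SDual; rewrite /= ?scalerDr !scalerAl. Qed.
HB.instance Definition _ := GRing.Lmodule_isLalgebra.Build K sdual dscaleAl.
Fact dscaleAr (c : K) x y : c *: (x * y) = x * (c *: y).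
Proof.
by rewrite !dmulE; congr SDual; rewrite /= ?scalerDr ?[ginv (_ *: _)]linearZ !scalerAr.
Qed.
HB.instance Definition _ := GRing.Lalgebra_isAlgebra.Build K sdual dscaleAr.

Definition dhp i x : sdual := SDual (hpart i (dre x)) (hpart (~~ i) (dim x)).
Fact dhp_linear i : linear (dhp i).
Proof. by move=> c x y; rewrite /dhp /= !linearP. Qed.
HB.instance Definition _ i := GRing.isLinear.Build K sdual sdual _ (dhp i) (dhp_linear i).
Fact dhpK i j x : dhp i (dhp j x) = if i == j then dhp j x else 0.
Proof. by rewrite /dhp /= !salg_compK; case: i; case: j. Qed.
Fact dhpD x : dhp false x + dhp true x = x.
Proof. by case: x => a b; congr SDual; rewrite /= ?salg_compD // addrC salg_compD. Qed.
Fact dhp1 : dhp false 1 = 1.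
Proof. by congr SDual; rewrite /= ?salg_comp1 ?linear0. Qed.
Fact dhpM i j x y : dhp i x = x -> dhp j y = y -> dhp (i (+) j) (x * y) = x * y.
Proof.
case: x y => [a b] [c d] [ha hb] [hc hd]; rewrite dmulE; congr SDual => /=.
  exact: homogM.
have -> : ~~ (i (+) j) = i (+) ~~ j by case: i {ha hb}; case: j {hc hd}.
apply: homogD; first exact: homogM.
have -> : i (+) ~~ j = ~~ i (+) j by case: i {ha hb}; case: j {hc hd}.
by apply: homogM => //; rewrite /homogeneous -ginv_hpart hc.
Qed.
Fact dhp_comm i j x y : dhp i x = x -> dhp j y = y -> x * y = (-1) ^+ (i && j) * (y * x).
Proof.
case: x y => [a b] [c d] [ha hb] [hc hd].
have e : b * ginv c = (-1) ^+ (j && i) * (c * b) /\ d * ginv a = (-1) ^+ (i && j) * (a * d).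
  have hh u v p q : homogeneous p u -> homogeneous (~~ q) v -> v * ginv u = (-1) ^+ (p && q) * (u * v).
    move=> hu hv; have := salg_comm hv hu.
    case: p hu => hu; rewrite ?(ginv_odd hu) ?(ginv_even hu).
      by case: q hv => hv /=; rewrite ?expr0 ?expr1 ?mul1r ?mulN1r mulrN => ->; rewrite ?opprK.
    by move=> ->; rewrite andbF expr0.
  by split; apply: hh.
have := salg_comm ha hc; move: e; rewrite [j && i]andbC.
case: (i && j); rewrite ?expr0 ?expr1 ?mul1r ?mulN1r => -[e1 e2] e3;
  rewrite !dmulE /= e1 e2 e3; congr SDual; rewrite /= ?expr0 ?expr1 ?mul1r ?mulN1r.
  by rewrite opprD opprK addrC.
by rewrite addrC.
Qed.
Definition sdual_salg : SAlg K := @MkSAlg K sdual dhp dhpK dhpD dhp1 dhpM dhp_comm.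

Fact dinj_linear : linear (fun a : R => SDual a 0 : sdual_salg).
Proof. by move=> c a b; congr SDual; rewrite /= scaler0 addr0. Qed.
Fact dinjM : {morph (fun a : R => SDual a 0 : sdual_salg) : x y / x * y}.
Proof. by move=> a b; congr SDual; rewrite /= mulr0 mul0r addr0. Qed.
Fact dinjH i a : SDual (hpart i a) 0 = hpart i (SDual a 0 : sdual_salg).
Proof. by rewrite /= /dhp /= linear0. Qed.
Definition dinj : SHom R sdual_salg := mk_shom dinj_linear dinjM erefl dinjH.
Definition dvar : sdual_salg := SDual 0 1.
Lemma dvar_odd : is_odd dvar.
Proof. by rewrite /homogeneous /= /dhp /= linear0 salg_comp1. Qed.
Lemma ddecomp (x : sdual_salg) : x = dinj (dre x) + dinj (dim x) * dvar.
Proof.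
case: x => a b; rewrite /= [_ * _]dmulE /=; congr SDual; rewrite /=.
  by rewrite mulr0 addr0.
by rewrite mulr1 mul0r addr0 add0r.
Qed.

Hypothesis char2 : 2%N \notin [pchar K].

Section Univ.
Variables (S : SAlg K) (f : SHom R S) (t : S).
Hypothesis ht : is_odd t.
Let dh (x : sdual_salg) : S := f (dre x) + f (dim x) * t.
Fact dh_linear : linear dh.
Proof.
by move=> c x y; rewrite /dh /= !shomP mulrDl addrACA -scalerAl scalerDr.
Qed.
Fact dhM : {morph dh : x y / x * y}.
Proof.
move=> x y; rewrite /dh [x * y]dmulE /= !(shomD, shomM) !mulrDl !mulrDr -!addrA.
rewrite -[f (dim x) * t * f (dre y)]mulrA -[f (dim x) * t * (_ * t)]mulrA.
rewrite [t * (_ * t)]mulrA !(odd_ginv _ ht) -(mulrA _ t t) (odd_sqr char2 ht) !mulr0 addr0.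
by rewrite shom_ginv !mulrA.
Qed.
Fact dh1 : dh 1 = 1. Proof. by rewrite /dh /= shom1 shom0 mul0r addr0. Qed.
Fact dhH i (x : sdual_salg) : dh (hpart i x) = hpart i (dh x).
Proof.
rewrite /dh /= linearD /= shom_comp; congr (_ + _).
have h0 := homogM (shom_homog f (hpart_homog false (dim x))) ht.
have h1 := homogM (shom_homog f (hpart_homog true (dim x))) ht.
rewrite -[in RHS](salg_compD (dim x)) shomD mulrDl linearD /=.
by rewrite (homog_hpart _ h1) (homog_hpart _ h0); case: i; rewrite ?addr0 ?add0r.
Qed.
(** Universal property of R[s]: a morphism out of it amounts to a morphism out of R and an odd
    element [t]. Outside characteristic 2 the relation t^2 = 0 holds automatically. *)
Definition dhom : SHom sdual_salg S := mk_shom dh_linear dhM dh1 dhH.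
Lemma dhomE x : dhom x = f (dre x) + f (dim x) * t. Proof. by []. Qed.
Lemma dhom_inj : shom_compose dhom dinj = f.
Proof. by apply: shom_ext => a; rewrite /= /dh /= shom0 mul0r addr0. Qed.
Lemma dhom_var : dhom dvar = t.
Proof. by rewrite /= /dh /= shom0 shom1 mul1r add0r. Qed.
End Univ.

Lemma dhom_uniq (S : SAlg K) (u v : SHom sdual_salg S) :
  shom_compose u dinj = shom_compose v dinj -> u dvar = v dvar -> u = v.
Proof.
move=> e1 e2; apply: shom_ext => x; rewrite [x]ddecomp !shomD !shomM e2.
have e a : u (dinj a) = v (dinj a) by apply: (congr1 (fun k : SHom R S => k a) e1).
by rewrite !e.
Qed.

Lemma sdual_odd (x : sdual_salg) : is_odd x ->
  is_odd (dre x) /\ is_even (dim x).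
Proof. by case: x => a b [ha hb]. Qed.
Lemma sdual_even (x : sdual_salg) : is_even x ->
  is_even (dre x) /\ is_odd (dim x).
Proof. by case: x => a b [ha hb]. Qed.

Definition ddrop : SHom sdual_salg R := dhom (shom_id R) (homog0 true).
Lemma ddropE x : ddrop x = dre x.
Proof. by rewrite /ddrop dhomE mulr0 addr0. Qed.
Lemma ddrop_inj : shom_compose ddrop dinj = shom_id R.
Proof. exact: dhom_inj. Qed.
End SuperDual.

(** * Points attached to odd tangent vectors *)

Section Tangent.
Variables (K : fieldType) (char2 : 2%N \notin [pchar K]) (G : supergroup K).
Let A := coord_alg G.
Implicit Types R S T : SAlg K.

Record tangent (v : A -> K) : Prop := IsTangent {
  tan_lin : forall c a b, v (c *: a + b) = c * v a + v b;
  tan_even : forall a, is_even a -> v a = 0;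
  tan_der : forall a b, v (a * b) = eps a * v b + v a * eps b
}.

Lemma tan0 v : tangent v -> v 0 = 0.
Proof. by move=> hv; apply: (tan_even hv); apply: homog0. Qed.
Lemma tan1 v : tangent v -> v 1 = 0.
Proof. by move=> hv; apply: (tan_even hv); apply: homog1. Qed.

Section XPoint.
Variables (v : A -> K) (hv : tangent v) (R : SAlg K) (a : R) (ha : is_odd a).
Let f (y : A) : R := (eps y)%:A + v y *: a.
Fact xp_linear : linear f.
Proof.
move=> c x y; rewrite /f epsP (tan_lin hv) !scalerDl -!scalerA addrACA.
by rewrite scalerDr.
Qed.
Fact xpM : {morph f : x y / x * y}.
Proof.
move=> x y; rewrite /f epsM (tan_der hv) mulrDl !mulrDr.
rewrite -!scalerAl -!scalerAr !mul1r mulr1 (odd_sqr char2 ha) !scaler0 addr0 !scalerA.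
by rewrite scalerDl -addrA [v x * eps y]mulrC.
Qed.
Fact xp1 : f 1 = 1.
Proof. by rewrite /f eps1 scale1r (tan1 hv) scale0r addr0. Qed.
Fact xpH i y : f (hpart i y) = hpart i (f y).
Proof.
rewrite /f linearD /= !linearZ /= (homog_hpart i homog1) (homog_hpart i ha).
have e0 : eps (hpart true y) = 0 by apply: eps_odd; apply: hpart_homog.
have v0 : v (hpart false y) = 0 by apply: (tan_even hv); apply: hpart_homog.
have e1 : eps (hpart false y) = eps y.
  by rewrite -[in RHS](salg_compD y) epsD e0 addr0.
have v1 : v (hpart true y) = v y.
  by rewrite -[in RHS](salg_compD y) -[hpart false y]scale1r (tan_lin hv) v0 mulr0 add0r.
by case: i; rewrite /= ?e0 ?e1 ?v0 ?v1 ?scale0r ?scaler0.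
Qed.
Definition xpoint : point G R := mk_shom xp_linear xpM xp1 xpH.
End XPoint.

(* The point with values [eps + v a], totalized to be the neutral point when
   [v] is not a tangent vector or [a] is not odd. *)
Definition xp (v : A -> K) R (a : R) : point G R :=
  match pselect (tangent v), pselect (is_odd a) with
  | left hv, left ha => xpoint hv ha
  | _, _ => pone G R
  end.

Lemma xpE v R (a : R) y : tangent v -> is_odd a ->
  xp v a y = (eps y)%:A + v y *: a.
Proof. by move=> hv ha; rewrite /xp; case: pselect => // hv'; case: pselect. Qed.

Lemma xp_natural v R S (f : SHom R S) a : tangent v -> is_odd a ->
  shom_compose f (xp v a) = xp v (f a).
Proof.
move=> hv ha; apply: shom_ext => y; rewrite xpE //; last exact: shom_homog.
by rewrite -[LHS]/(f (xp v a y)) xpE // shomD !shomZ shom1.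
Qed.

Lemma xp0 v R : tangent v -> xp v (0 : R) = pone G R.
Proof.
by move=> hv; apply: shom_ext => y; rewrite xpE ?scaler0 ?addr0 ?epsE //; apply: homog0.
Qed.

(** In the expansion of (eps + Dg)(eps + Dh) the cross terms vanish, and the counit laws collapse
    what remains. Points that differ from the identity to first order thus multiply by adding their
    deviations. *)
Lemma first_order_mul R (g h : point G R) (Dg Dh : A -> R) :
  (forall y, g y = (eps y)%:A + Dg y) -> (forall y, h y = (eps y)%:A + Dh y) ->
  (forall y z, Dg y * Dh z = 0) ->
  forall y, pmul g h y = (eps y)%:A + Dg y + Dh y.
Proof.
move=> gE hE DD y; have [s sE] := comult_list y.
have e1 : \sum_(p <- s) (eps p.1)%:A * (eps p.2)%:A = (eps y)%:A :> R.
  rewrite -[in RHS]epsE -[in RHS](pmul1 (pone G R)) sE.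
  by apply: eq_bigr => p _; rewrite !epsE.
have eg : \sum_(p <- s) Dg p.1 * (eps p.2)%:A = Dg y.
  apply: (addrI (eps y)%:A); rewrite -gE -[in RHS](pmulg1 g) sE -{1}e1 -big_split.
  by apply: eq_bigr => p _; rewrite gE epsE mulrDl.
have eh : \sum_(p <- s) (eps p.1)%:A * Dh p.2 = Dh y.
  apply: (addrI (eps y)%:A); rewrite -hE -[in RHS](pmul1 h) sE -{1}e1 -big_split.
  by apply: eq_bigr => p _; rewrite hE epsE mulrDr.
rewrite sE -e1 -eg -eh -!big_split; apply: eq_bigr => p _.
by rewrite gE hE mulrDl !mulrDr DD addr0 addrAC.
Qed.

Definition evenpt R (g : point G R) : Prop := forall y, is_odd y -> g y = 0.

Lemma evenpt_natural R S (f : SHom R S) (g : point G R) : evenpt g -> evenpt (shom_compose f g).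
Proof. by move=> hg y hy; rewrite -[LHS]/(f (g y)) hg // shom0. Qed.

Lemma evenpt1 R : evenpt (pone G R).
Proof. by move=> y hy; rewrite epsE eps_odd // scale0r. Qed.

Let K1 := sdual_salg (base_salg K).
Let K2 := sdual_salg K1.

Lemma base_odd (c : base_salg K) : is_odd c -> c = 0.
Proof. by rewrite /homogeneous /= => <-. Qed.

Let s1 : K2 := dinj _ (dvar _).
Let s2 : K2 := dvar _.
Fact s1_odd : is_odd s1. Proof. exact: shom_homog (dvar_odd _). Qed.
Fact s2_odd : is_odd s2. Proof. exact: dvar_odd. Qed.

Let drop2 : SHom K2 K1 := ddrop K1 char2.
Let drop1 : SHom K2 K1 :=
  dhom char2 (shom_compose (dinj _) (ddrop _ char2)) (dvar_odd (base_salg K)).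

(** Here K2 = K[s1, s2]. Its odd part is spanned by s1 and s2, and each coefficient survives when
    the other variable is set to 0. *)
Fact odd_K2_eq0 (x : K2) : is_odd x -> drop2 x = 0 -> drop1 x = 0 -> x = 0.
Proof.
move=> /sdual_odd[_ hq]; rewrite ddropE => p0.
rewrite dhomE p0 shom0 add0r -[shom_compose _ _ _]/(dinj _ (ddrop _ char2 (dim x))) ddropE.
have [_ /base_odd q2] := sdual_even hq.
case: x p0 hq q2 => p [q1 q2'] /= -> _ ->.
case=> _; rewrite mulr1 mul0r addr0 => ->.
by [].
Qed.

(* A word in odd one-parameter points that becomes trivial when either parameter
   vanishes is divisible by the product of the parameters, hence even. *)
Lemma evenpt_word (W : forall R : SAlg K, R -> R -> point G R) :
  (forall R S (f : SHom R S) a b, is_odd a -> is_odd b ->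
     shom_compose f (W R a b) = W S (f a) (f b)) ->
  (forall R (a : R), is_odd a -> W R a 0 = pone G R) ->
  (forall R (a : R), is_odd a -> W R 0 a = pone G R) ->
  forall R (a b : R), is_odd a -> is_odd b -> evenpt (W R a b).
Proof.
move=> Wn W0r W0l R a b ha hb.
(* By naturality the given parameters may be replaced by the universal ones s1 and s2, which [f]
   specializes to [a] and [b]. *)
pose f1 : SHom K1 R := dhom char2 (base_shom R) ha.
pose f : SHom K2 R := dhom char2 f1 hb.
have fs1 : f s1 = a.
  rewrite -[LHS]/(shom_compose f (dinj _) (dvar _)) dhom_inj; exact: dhom_var.
have fs2 : f s2 = b by exact: dhom_var.
rewrite -fs1 -fs2 -(Wn _ _ f s1 s2 s1_odd s2_odd); apply: evenpt_natural.
move=> y hy; apply: odd_K2_eq0.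
- exact: shom_homog.
- rewrite -[LHS]/(shom_compose drop2 (W K2 s1 s2) y) (Wn _ _ _ _ _ s1_odd s2_odd).
  have -> : drop2 s2 = 0 by rewrite ddropE.
  by rewrite W0r ?(evenpt1 _ hy) //; exact: (shom_homog drop2 s1_odd).
- rewrite -[LHS]/(shom_compose drop1 (W K2 s1 s2) y) (Wn _ _ _ _ _ s1_odd s2_odd).
  have -> : drop1 s1 = 0.
    rewrite -[LHS]/(shom_compose drop1 (dinj _) (dvar _)) dhom_inj.
    by rewrite -[LHS]/(dinj _ (ddrop _ char2 (dvar _))) ddropE.
  by rewrite W0l ?(evenpt1 _ hy) //; exact: (shom_homog drop1 s2_odd).
Qed.

Lemma xp_comm v w R (a b : R) : tangent v -> tangent w ->
  is_odd a -> is_odd b ->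
  exists2 e, evenpt e & pmul (xp v a) (xp w b) = pmul (pmul (xp w b) (xp v a)) e.
Proof.
move=> hv hw ha hb.
pose W (S : SAlg K) (x y : S) : point G S :=
  pmul (pinv (pmul (xp w y) (xp v x))) (pmul (xp v x) (xp w y)).
exists (W R a b); last by rewrite /W pmulA pmulgV pmul1.
apply: evenpt_word => //.
- move=> S T f x y hx hy.
  by rewrite /W !pmul_natural pinv_natural !pmul_natural !xp_natural.
- by move=> S x hx; rewrite /W xp0 // pmul1 pmulg1 pmulV.
- by move=> S x hx; rewrite /W xp0 // pmul1 pmulg1 pmulV.
Qed.

(** The bracket [v, v] of an odd vector need not vanish, so x(a)x(b) may differ from x(a + b). The
    discrepancy is trivial when either parameter is 0, hence even by [evenpt_word]. *)
Lemma xp_add v R (a b : R) : tangent v -> is_odd a -> is_odd b ->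
  exists2 e, evenpt e & pmul (xp v a) (xp v b) = pmul (xp v (a + b)) e.
Proof.
move=> hv ha hb.
pose W (S : SAlg K) (x y : S) : point G S :=
  pmul (pinv (xp v (x + y))) (pmul (xp v x) (xp v y)).
exists (W R a b); last by rewrite /W pmulA pmulgV pmul1.
apply: evenpt_word => //.
- move=> S T f x y hx hy.
  rewrite /W !pmul_natural pinv_natural !xp_natural ?shomD //; exact: homogD.
- by move=> S x hx; rewrite /W xp0 // addr0 pmulg1 pmulV.
- by move=> S x hx; rewrite /W xp0 // add0r pmul1 pmulV.
Qed.

End Tangent.

(** * The cells *)

Section KilledElements.
Variables (K : fieldType) (G : supergroup K).
Let A := coord_alg G.
Implicit Types R : SAlg K.

Lemma antipode_invol (x : A) : antipode G (antipode G x) = x.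
Proof.
rewrite -[LHS]/(shom_compose (antipode G) (antipode G) x) -pinvE.
suff -> : pinv (antipode G : point G A) = shom_id A by [].
by apply: (@pmulIg _ _ _ (antipode G)); rewrite pmulV pmulgV.
Qed.

Lemma kills_grouplike (x : A) : is_even x -> eps x = 1 ->
  (forall R (g h : point G R), pmul g h x = g x * h x) ->
  forall R (g : point G R), kills_abelian g -> g x = 1.
Proof.
move=> hx ex xM R g; pose y := antipode G x.
have hy : is_even y by apply: shom_homog.
have ev (S : SAlg K) (h : point G S) a : is_even a -> is_even (h a).
  exact: shom_homog.
have yx : y * x = 1.
  rewrite -[x in _ * x]/(shom_id A x) -xM.
  by rewrite pmulV epsE ex scale1r.
have yM (S : SAlg K) (h k : point G S) : pmul h k y = h y * k y.
  have e1 : pmul h k y * (h x * k x) = 1 by rewrite -xM -shomM yx shom1.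
  have e2 : (h x * k x) * (h y * k y) = 1.
    rewrite (even_comm_l _ (ev _ h _ hx)) -!mulrA (mulrA (h x)).
    rewrite -[h x * h y]shomM -[x * y]even_comm_l // yx shom1 mul1r -shomM.
    by rewrite -[x * y]even_comm_l // yx shom1.
  by rewrite -[LHS]mulr1 -e2 mulrA e1 mul1r.
(* The abelian set consists of [x], its inverse [y], and 0 as their odd part. Since [x] and [y] are
   even, their values commute. *)
move=> /(_ (fun a => [\/ a = 0, a = x | a = y])) kg.
rewrite kg; last by constructor 2.
  by rewrite epsE ex scale1r.
split.
- move=> i a [->|->|->]; first by rewrite linear0; constructor 1.
    by rewrite (homog_hpart _ hx); case: eqP; [constructor 2|constructor 1].
  by rewrite (homog_hpart _ hy); case: eqP; [constructor 3|constructor 1].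
- move=> a [->|->|->].
  + by exists [::]; split=> // S h k; rewrite big_nil shom0.
  + exists [:: (x, x)]; split=> [p|S h k]; last by rewrite big_seq1 xM.
    by rewrite inE => /eqP ->; split; constructor 2.
  + exists [:: (y, y)]; split=> [p|S h k]; last by rewrite big_seq1 yM.
    by rewrite inE => /eqP ->; split; constructor 3.
- move=> a [->|->|->]; first by rewrite shom0; constructor 1.
    by constructor 3.
  by rewrite antipode_invol; constructor 2.
- move=> a [->|->|->] S h k; first by rewrite !shom0.
    by rewrite !xM; apply: even_comm_l; apply: ev.
  by rewrite !yM; apply: even_comm_l; apply: ev.
Qed.

Lemma kills_primitive (x : A) i : homogeneous i x ->
  (forall R (g h : point G R), pmul g h x = g x + h x) ->
  forall R (g : point G R), kills_abelian g -> g x = 0.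
Proof.
move=> hx xM R g.
have p0 (S : SAlg K) : pone G S x = 0.
  by apply: (addrI (pone G S x)); rewrite addr0 -xM pmul1.
have ax : antipode G x = - x.
  apply/eqP; rewrite -addr_eq0 -[x in _ + x]/(shom_id A x) -xM pmulV p0.
  by [].
(* The comultiplication brings in 1, the antipode brings in -x, and 0 is the part of the wrong
   parity. The required symmetry is commutativity of addition, so [x] may also be odd. *)
move=> /(_ (fun a => [\/ a = 0, a = 1, a = x | a = - x])) kg.
rewrite kg; [exact: p0| |by constructor 3].
have comult_pm (y : A) : (y = x \/ y = - x) -> exists s : seq (A * A),
    (forall p, p \in s -> [\/ p.1 = 0, p.1 = 1, p.1 = x | p.1 = - x] /\
                           [\/ p.2 = 0, p.2 = 1, p.2 = x | p.2 = - x]) /\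
    forall S (h k : point G S), pmul h k y = \sum_(p <- s) h p.1 * k p.2.
  move=> hy; have yM S (h k : point G S) : pmul h k y = h y + k y.
    by case: hy => ->; rewrite ?shomN xM // opprD.
  exists [:: (y, 1); (1, y)]; split=> [p|S h k].
    rewrite !inE => /orP[] /eqP -> /=; case: hy => ->; split;
    by [constructor 2|constructor 3|constructor 4].
  by rewrite big_cons big_seq1 /= !shom1 mulr1 mul1r yM.
split.
- move=> j a [->|->|->|->].
  + by rewrite linear0; constructor 1.
  + by rewrite (homog_hpart _ homog1); case: eqP; [constructor 2|constructor 1].
  + by rewrite (homog_hpart _ hx); case: eqP; [constructor 3|constructor 1].
  + by rewrite (homog_hpart _ (homogN hx)); case: eqP; [constructor 4|constructor 1].
- move=> a [->|->|->|->].
  + by exists [::]; split=> // S h k; rewrite big_nil shom0.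
  + exists [:: (1, 1)]; split=> [p|S h k]; last by rewrite big_seq1 !shom1 mulr1.
    by rewrite inE => /eqP ->; split; constructor 2.
  + by apply: comult_pm; left.
  + by apply: comult_pm; right.
- move=> a [->|->|->|->].
  + by rewrite shom0; constructor 1.
  + by rewrite shom1; constructor 2.
  + by rewrite ax; constructor 4.
  + by rewrite shomN ax opprK; constructor 3.
- by move=> a [->|->|->|->] S h k; rewrite ?shomN ?shom0 ?shom1 // !xM addrC.
Qed.
End KilledElements.

Section EvenPart.
Variables (K : fieldType) (G E : supergroup K) (i : supergroup_hom E G).
Hypothesis hE : is_even_part i.
Implicit Types R S T : SAlg K.

Lemma evenptP R (g : point G R) : evenpt g <-> exists e : point E R, point_map i e = g.
Proof.
have [ci ki] := hE; split=> [hg|[e <-] y hy].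
  apply: shom_factor => // a /ki; exact: ideal_gen_zero.
have /ki h : in_ideal_generated (is_odd) y.
  by rewrite -[y]mulr1; apply: ideal_gen_incl.
by rewrite -[LHS]/(e (comorphism i y)) h shom0.
Qed.

Lemma evenptM R (g h : point G R) : evenpt g -> evenpt h -> evenpt (pmul g h).
Proof.
move=> /evenptP[e <-] /evenptP[f <-]; apply/evenptP; exists (pmul e f).
exact: point_mapM.
Qed.
Lemma evenptV R (g : point G R) : evenpt g -> evenpt (pinv g).
Proof.
by move=> /evenptP[e <-]; apply/evenptP; exists (pinv e); apply: point_mapV.
Qed.

Variables (char2 : 2%N \notin [pchar K]) (v : nat -> coord_alg G -> K).
Hypothesis hv : forall n, tangent (v n).

Fixpoint cell n R (g : point G R) : Prop :=
  if n is m.+1 then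
    exists h (a : R), [/\ is_odd a, cell m h & g = pmul h (xp char2 (v m) a)]
  else evenpt g.

Lemma cell_mono n R (g : point G R) : cell n g -> cell n.+1 g.
Proof.
move=> hg; exists g, 0; split => //; first exact: homog0.
by rewrite xp0 // pmulg1.
Qed.
Lemma cell_le n m R (g : point G R) : (n <= m)%N -> cell n g -> cell m g.
Proof.
move=> le hg; rewrite -(subnKC le); elim: (m - n)%N => [|k ih]; first by rewrite addn0.
by rewrite addnS; apply: cell_mono.
Qed.
Lemma cell1 n R : cell n (pone G R).
Proof. by apply: (@cell_le 0) => //; apply: evenpt1. Qed.
Lemma cell_xp n R (a : R) : is_odd a -> cell n.+1 (xp char2 (v n) a).
Proof. by move=> ha; exists (pone G R), a; split => //; [exact: cell1|rewrite pmul1]. Qed.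

Variable d : nat.
(** Stability of the flag, in the form used for reordering: conjugation by an even point turns
    x_n(a) into a product of x_0, ..., x_n. *)
Hypothesis cell_conj : forall n R (a : R) (e : point G R), (n < d)%N ->
  is_odd a -> evenpt e -> cell n.+1 (pmul (xp char2 (v n) a) e).

(** In (h1 x_n(a))(h2 x_n(b)) the factor x_n(a) is carried through h2 one parameter at a time and
    then merged with x_n(b). Each exchange, and the merge, leaves an even point to the right of a
    factor x_n, where [cell_conj] absorbs it. *)
Lemma cellM n R (g h : point G R) : (n <= d)%N -> cell n g -> cell n h -> cell n (pmul g h).
Proof.
elim: n R g h => [|n IH] R g h; first by move=> _; apply: evenptM.
move=> nd; have {}IH S (g' h' : point G S) : cell n g' -> cell n h' -> cell n (pmul g' h').
  exact: IH (ltnW nd).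
pose x S (a : S) := xp char2 (v n) a.
have cellMl (S : SAlg K) (k g' : point G S) : cell n k -> cell n.+1 g' -> cell n.+1 (pmul k g').
  move=> hk [h' [a [ha hh' ->]]]; exists (pmul k h'), a; split => //; first exact: IH.
  by rewrite pmulA.
have cellX (S : SAlg K) (g' : point G S) (b : S) : is_odd b -> cell n.+1 g' ->
    cell n.+1 (pmul g' (x S b)).
  move=> hb [h' [a [ha hh' ->]]]; rewrite -pmulA.
  have [e he ->] := xp_add char2 (hv n) ha hb.
  by apply: (cellMl) => //; apply: cell_conj => //; apply: homogD.
have cellXl (S : SAlg K) m (a : S) (k : point G S) : (m <= n)%N -> is_odd a ->
    cell m k -> cell n.+1 (pmul (x S a) k).
  move=> + ha; elim: m k => [|m ihm] k mn; first exact: cell_conj.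
  move=> [k' [b [hb hk' ->]]]; rewrite pmulA.
  have [l [c [hc hl ->]]] := ihm k' (ltnW mn) hk'.
  rewrite -pmulA; apply: (cellMl) => //.
  have [e he ->] := xp_comm char2 (hv n) (hv m) hc hb.
  rewrite -pmulA; apply: cellMl; last exact: cell_conj.
  exact: (cell_le mn (cell_xp m hb)).
move=> [h1 [a [ha hh1 ->]]] [h2 [b [hb hh2 ->]]].
rewrite -pmulA; apply: (cellMl) => //; rewrite pmulA.
by apply: (cellX) => //; apply: (cellXl _ n).
Qed.

(** The superalgebra K[E][s_0, ..., s_(n-1)] with odd s_k. Every point of [cell n] specializes the
    universal product [cell_pt n]; the specialization is unique once [cell_pt n] is surjective as a
    morphism out of K[G]. *)
Fixpoint cell_alg n : SAlg K :=
  if n is m.+1 then sdual_salg (cell_alg m) else coord_alg E.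

Fixpoint cell_pt n : point G (cell_alg n) :=
  if n is m.+1 return point G (cell_alg n) then
    pmul (shom_compose (dinj (cell_alg m)) (cell_pt m)) (xp char2 (v m) (dvar (cell_alg m)))
  else comorphism i.

Lemma cell_pt_dhom n R (f : SHom (cell_alg n) R) (a : R) (ha : is_odd a) :
  shom_compose (dhom char2 f ha) (cell_pt n.+1) =
  pmul (shom_compose f (cell_pt n)) (xp char2 (v n) a).
Proof.
rewrite /= pmul_natural shom_composeA dhom_inj xp_natural //; last exact: dvar_odd.
by rewrite dhom_var.
Qed.

Lemma dhom_eta n R (f : SHom (cell_alg n.+1) R) :
  f = dhom char2 (shom_compose f (dinj _)) (shom_homog f (dvar_odd _)).
Proof. by apply: dhom_uniq; rewrite ?dhom_inj // dhom_var. Qed.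

Lemma cellP n R (g : point G R) :
  cell n g <-> exists f : SHom (cell_alg n) R, shom_compose f (cell_pt n) = g.
Proof.
elim: n R g => [|n IH] R g; first exact: evenptP.
split=> [[h [a [ha /IH[f <-] ->]]]|[f <-]].
  by exists (dhom char2 f ha); apply: cell_pt_dhom.
rewrite (dhom_eta f) cell_pt_dhom.
exists (shom_compose (shom_compose f (dinj _)) (cell_pt n)), (f (dvar _)).
by split => //; [exact: (shom_homog f (dvar_odd _))|apply/IH; eexists].
Qed.

(** Setting the last variable to 0 turns [cell_pt n.+1] into [cell_pt n]. *)
Lemma cell_pt_surj_pred n : (forall b, exists a, cell_pt n.+1 a = b) ->
  forall b, exists a, cell_pt n a = b.
Proof.
move=> sj b; have [a ha] := sj (dinj _ b); exists a.
have := @cell_pt_dhom n _ (shom_id _) 0 (homog0 true); rewrite xp0 // pmulg1 shom_1compose => <-.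
rewrite -[LHS]/(ddrop _ char2 (cell_pt n.+1 a)) ha.
by rewrite ddropE.
Qed.

Section ZStep.
Variable n : nat.
Hypotheses (nd : (n < d)%N) (sj : forall b, exists a, cell_pt n.+1 a = b).
Let B := cell_alg n.+1.
Let th : point G B := cell_pt n.+1.
Let z : B := dvar (cell_alg n).

Fact th_inj R (f f' : SHom B R) : shom_compose f th = shom_compose f' th -> f = f'.
Proof. exact: shom_surj_inj. Qed.

(** Left translation by x_n(s) preserves P_(n+1), and [fz] is its effect on coordinates. Thus [fz z]
    is the last coordinate of x_n(s)g, and [beta] is the coefficient of s in it. *)
Fact zlift : exists f : SHom B (sdual_salg B),
  shom_compose f th = pmul (xp char2 (v n) (dvar B)) (shom_compose (dinj B) th).
Proof.
apply/(cellP n.+1); apply: cellM => //; first exact: (cell_xp n (dvar_odd B)).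
by apply/cellP; eexists.
Qed.

Let fz : SHom B (sdual_salg B) := sval (cid zlift).
Fact fzE : shom_compose fz th = pmul (xp char2 (v n) (dvar B)) (shom_compose (dinj B) th).
Proof. exact: (svalP (cid zlift)). Qed.

Definition beta : B := dim (fz z).

Fact beta_even : is_even beta.
Proof. by have /sdual_odd[] := shom_homog fz (dvar_odd _). Qed.

(** At s = 0 the translation is the identity, which fixes the constant term. *)
Fact fz_z : fz z = dinj B z + dinj B beta * dvar B.
Proof.
rewrite [LHS]ddecomp; congr (dinj B _ + _).
suff e : shom_compose (ddrop B char2) fz = shom_id B.
  by rewrite -ddropE // -[LHS]/(shom_compose (ddrop B char2) fz z) e.
apply: th_inj; rewrite -shom_composeA fzE pmul_natural shom_composeA ddrop_inj.
by rewrite xp_natural ?ddropE // ?xp0 ?pmul1 //; apply: dvar_odd.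
Qed.

(* With g' = h x(a), the function z is left invariant under h, so z(g'g) = z(x(a)g). *)
Fact z_mul R (f' f k : SHom B R) :
  shom_compose k th = pmul (shom_compose f' th) (shom_compose f th) ->
  k z = f z + f beta * f' z.
Proof.
move=> kE; pose a := f' z; have ha : is_odd a by apply: shom_homog; apply: dvar_odd.
pose u : SHom (sdual_salg B) R := dhom char2 f ha.
pose f2 := shom_compose u fz.
have f2E : shom_compose f2 th = pmul (xp char2 (v n) a) (shom_compose f th).
  rewrite -shom_composeA fzE pmul_natural shom_composeA dhom_inj xp_natural //.
    by rewrite dhom_var.
  exact: dvar_odd.
have f2z : f2 z = f z + f beta * a.
  rewrite -[LHS]/(u (fz z)) fz_z shomD shomM dhom_var.
  by rewrite -[u (dinj _ z)]/(shom_compose u (dinj B) z) -[u (dinj _ beta)]/(shom_compose u (dinj B) beta) dhom_inj.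
rewrite -f2z.
pose f0 g := shom_compose (g : SHom B R) (dinj (cell_alg n)).
have dec (g : SHom B R) : shom_compose g th =
    pmul (shom_compose (f0 g) (cell_pt n)) (xp char2 (v n) (g z)).
  by rewrite [in LHS](dhom_eta g) cell_pt_dhom.
have cf (g : SHom B R) : cell n (shom_compose (f0 g) (cell_pt n)) by apply/cellP; eexists.
have /cellP[k0 k0E] := cellM (ltnW nd) (cf f') (cf f2).
have ho : is_odd (f2 z) by apply: shom_homog; apply: dvar_odd.
suff -> : k = dhom char2 k0 ho by rewrite dhom_var.
apply: th_inj; rewrite kE cell_pt_dhom k0E -pmulA -dec f2E pmulA; congr pmul.
exact: dec.
Qed.

Fact z_point R (a : R) : is_odd a ->
  exists2 f : SHom B R, f z = a & shom_compose f th = xp char2 (v n) a.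
Proof.
move=> ha; have /cellP[e eE] := cell1 n R.
exists (dhom char2 e ha); first exact: dhom_var.
by rewrite cell_pt_dhom eE pmul1.
Qed.

(** The last coordinate of x_n(s)g'g is computed for both bracketings by [z_mul]; the coefficients
    of the fresh variable s are then compared. *)
Fact beta_mul R (f' f k : SHom B R) :
  shom_compose k th = pmul (shom_compose f' th) (shom_compose f th) ->
  k beta = f' beta * f beta.
Proof.
move=> kE; pose j := dinj R.
have [w wz wE] := z_point (dvar_odd R).
have nat (g : SHom B R) : shom_compose (shom_compose j g) th = shom_compose j (shom_compose g th).
  by rewrite shom_composeA.
have cl (g g' : SHom B (sdual_salg R)) : exists m : SHom B (sdual_salg R),
    shom_compose m th = pmul (shom_compose g th) (shom_compose g' th).
  by apply/(cellP n.+1); apply: cellM => //; apply/cellP; eexists.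
have [m1 m1E] := cl w (shom_compose j k).
have [m2 m2E] := cl w (shom_compose j f').
have m12 : shom_compose m1 th = pmul (shom_compose m2 th) (shom_compose (shom_compose j f) th).
  by rewrite m1E m2E -pmulA !nat kE pmul_natural.
have := z_mul m12; rewrite (z_mul m1E) (z_mul m2E) wz.
have kz : k z = f z + f beta * f' z by exact: z_mul.
have ev (g : SHom B R) : is_even (g beta) by apply: shom_homog; apply: beta_even.
rewrite -![(shom_compose j _) _]/(j _) kz shomD shomM mulrDr addrA => /addrI.
rewrite mulrA -shomM => /(congr1 (@dim _ _)) /=.
rewrite !mulr1 !mul0r !addr0 => ->.
exact: even_comm_l.
Qed.

Fact beta_one R (f : SHom B R) : shom_compose f th = pone G R -> f beta = 1.
Proof.
move=> fE; pose j := dinj R.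
have [w wz wE] := z_point (dvar_odd R).
have fj : shom_compose (shom_compose j f) th = pone G (sdual_salg R).
  by rewrite -shom_composeA fE pone_natural.
have h1 : shom_compose w th = pmul (shom_compose w th) (shom_compose (shom_compose j f) th).
  by rewrite fj pmulg1.
have fz0 : f z = 0.
  have [f0 f0z f0E] := z_point (homog0 true : is_odd (0 : R)).
  suff -> : f = f0 by [].
  by apply: th_inj; rewrite fE f0E xp0.
have := z_mul h1; rewrite wz -![(shom_compose j _) _]/(j _) fz0 shom0 add0r.
move/(congr1 (@dim _ _)) => /=; rewrite mulr1 mul0r addr0 => <-.
by [].
Qed.

(** Passing to the derived super-subgroup makes the grouplike function beta equal to 1, which is the
    family [F1]. There z is primitive, so a second passage makes z vanish, and a point of P_(n+1)
    with z = 0 lies in P_n. *)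
Lemma solvable_within_cellS :
  solvable_within (cell n) -> solvable_within (cell n.+1).
Proof.
move=> sn.
pose F1 R (g : point G R) := exists2 f : SHom B R, f beta = 1 & shom_compose f th = g.
have ptE (D : supergroup K) (j : supergroup_hom D G) (fD : SHom B (coord_alg D)) R (x : point D R) :
    shom_compose fD th = comorphism j ->
    shom_compose (shom_compose x fD) th = point_map j x.
  by move=> e; rewrite -shom_composeA e.
apply: (@solvable_within_step _ _ _ F1).
  apply: solvable_within_step sn _ => D j cj jF R x kx.
  (* The hypothesis at the universal point of [D] gives a morphism [fD] that pulls z and beta back
     to K[D], where the results on primitive and grouplike elements apply. *)
  have [fD fb fE] := jF _ (shom_id (coord_alg D)).
  rewrite /point_map shom_1compose in fE.
  have zx : x (fD z) = 0.
    apply: (kills_primitive _ _ kx); first exact: shom_homog (dvar_odd _).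
    move=> S g h; have := @z_mul S (shom_compose g fD) (shom_compose h fD) (shom_compose (pmul g h) fD).
    rewrite !(ptE _ j) // point_mapM => /(_ erefl).
    rewrite -![(shom_compose _ _) _]/(_ (fD _)) fb shom1 mul1r addrC.
    by [].
  rewrite -(ptE _ _ fD) // [shom_compose x fD]dhom_eta cell_pt_dhom.
  rewrite -[(shom_compose x fD) _]/(x (fD z)) zx xp0 // pmulg1.
  by apply/cellP; eexists.
move=> D j cj jF R x kx.
have /cellP[fD fE] := jF _ (shom_id (coord_alg D)).
rewrite /point_map shom_1compose in fE.
exists (shom_compose x fD); last exact: ptE.
apply: (kills_grouplike _ _ _ kx).
- exact: shom_homog beta_even.
- have : shom_compose (shom_compose (counit D) fD) th = pone G _.
    by rewrite (ptE _ j) // point_map1.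
  exact: beta_one.
- move=> S g h; have := @beta_mul S (shom_compose g fD) (shom_compose h fD) (shom_compose (pmul g h) fD).
  by rewrite !(ptE _ j) // point_mapM => /(_ erefl).
Qed.

End ZStep.
End EvenPart.

(** * The big cell is the whole supergroup *)

Section OddNakayama.
Variables (K : fieldType) (char2 : 2%N \notin [pchar K]) (A : SAlg K).

Definition odd_products (x : A) : Prop :=
  exists y z, [/\ is_odd y, is_odd z & x = y * z].

Variable S : A -> Prop.
Hypothesis S_hpart : forall i a, S a -> S (hpart i a).

(** Generators are discarded one by one. Modulo [S] and the rest of [L], every odd element is a
    multiple of [o]; as [o] is itself congruent to a combination of products of two odd elements, it
    becomes a combination of terms containing o^2 = 0. *)
Lemma odd_nakayama (L : seq A) : (forall o, o \in L -> is_odd o) ->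
  (forall y, is_odd y -> in_ideal_generated (fun x => S x \/ x \in L) y) ->
  (forall y, is_odd y ->
     exists2 u, in_ideal_generated S u & in_ideal_generated odd_products (y - u)) ->
  forall y, is_odd y -> in_ideal_generated S y.
Proof.
move=> + + hJ; elim: L => [|o L ih] oL gL.
  by move=> y /gL; apply: ideal_gen_ext => x [].
have oo : is_odd o by apply: oL; rewrite mem_head.
have oL' x : x \in L -> is_odd x by move=> xL; apply: oL; rewrite inE xL orbT.
(* The element 0 is included to make the set stable under homogeneous parts. *)
pose T (x : A) := S x \/ (x \in L) \/ x = 0.
have T_hpart i x : T x -> T (hpart i x).
  case=> [/(@S_hpart i)|]; first by left.
  case=> [xL|->]; last by right; right; rewrite linear0.
  by right; rewrite (homog_hpart _ (oL' _ xL)); case: eqP; [left|right].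
have T0 x : in_ideal_generated T x -> in_ideal_generated (fun x => S x \/ x \in L) x.
  move=> [s [sT ->]]; apply: ideal_gen_sum => p ps.
  case: (sT _ ps) => [h|[h| ->]]; last by rewrite mul0r; exact: ideal_gen0.
    by apply: ideal_gen_incl; left.
  by apply: ideal_gen_incl; right.
have dec x : in_ideal_generated (fun x => S x \/ x \in o :: L) x ->
    exists g b, in_ideal_generated T g /\ x = g + o * b.
  move=> [s [sS ->]]; elim: s sS => [|p s ihs] sS.
    by exists 0, 0; rewrite big_nil mulr0 addr0; split => //; exact: ideal_gen0.
  have [|g [b [hg e]]] := ihs; first by move=> q qs; apply: sS; rewrite inE qs orbT.
  rewrite big_cons e; have := sS p (mem_head _ _); rewrite inE => -[h|/orP[/eqP ->|h]].
  - exists (p.1 * p.2 + g), b; rewrite addrA; split => //; apply: ideal_genD => //.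
    by apply: ideal_gen_incl; left.
  - by exists g, (p.2 + b); rewrite mulrDr addrCA.
  - exists (p.1 * p.2 + g), b; rewrite addrA; split => //; apply: ideal_genD => //.
    by apply: ideal_gen_incl; right; left.
have oT : in_ideal_generated T o.
  have [u hu [s [sP e]]] := hJ _ oo.
  have -> : o = u + \sum_(p <- s) p.1 * p.2 by rewrite -e addrC subrK.
  apply: ideal_genD; first by apply: ideal_gen_ext hu => x; left.
  apply: ideal_gen_sum => p ps; apply: ideal_genMr.
  have [x [y [hx hy ->]]] := sP _ ps.
  have [g [b [hg ->]]] := dec _ (gL _ hx); have [g' [b' [hg' ->]]] := dec _ (gL _ hy).
  rewrite mulrDl !mulrDr; apply: ideal_genD; first by apply: ideal_genD; exact: ideal_genMr.
  apply: ideal_genD; first exact: ideal_genMl.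
  have -> : o * b * (o * b') = 0.
    by rewrite (odd_ginv b oo) -mulrA (mulrA o) (odd_sqr char2 oo) mul0r mulr0.
  exact: ideal_gen0.
apply: ih => // y /gL/dec[g [b [hg ->]]]; apply/T0/ideal_genD => //.
exact: ideal_genMr.
Qed.
End OddNakayama.

Lemma predn_addr k l : ((k + l).-1 <= k + l.-1)%N.
Proof. by case: l => [|l]; rewrite ?addn0 ?addnS ?leq_pred. Qed.

(** * The filtration by odd variables *)

Section Filtration.
Variables (K : fieldType) (E : supergroup K).
Hypothesis Eev : forall c : coord_alg E, is_even c.
Notation cell_alg := (cell_alg E).

(** The k-th power of the ideal generated by s_0, ..., s_(n-1). The coefficient of the last variable
    needs one order less; 0.-1 = 0 agrees with order 0 being no condition. *)
Fixpoint fil n : nat -> cell_alg n -> Prop :=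
  if n is m.+1 return nat -> cell_alg n -> Prop
  then fun k (x : sdual (cell_alg m)) => fil k (dre x) /\ fil k.-1 (dim x)
  else fun k x => k = 0%N \/ x = 0.

Lemma fil_0 n (x : cell_alg n) : fil 0 x.
Proof. by elim: n x => [|n ih] x /=; [left|split]. Qed.
Lemma fil0 n k : fil k (0 : cell_alg n).
Proof. by elim: n k => [|n ih] k /=; [right|split; apply: ih]. Qed.
Lemma filD n k (x y : cell_alg n) : fil k x -> fil k y -> fil k (x + y).
Proof.
elim: n k x y => [|n ih] k x y /=.
  by case=> [->|->]; [left|rewrite add0r].
by move=> [x1 x2] [y1 y2]; split; apply: ih.
Qed.
Lemma filN n k (x : cell_alg n) : fil k x -> fil k (- x).
Proof.
elim: n k x => [|n ih] k x /=.
  by case=> [->|->]; [left|rewrite oppr0; right].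
by move=> [x1 x2]; split; apply: ih.
Qed.
Lemma filB n k (x y : cell_alg n) : fil k x -> fil k y -> fil k (x - y).
Proof. by move=> hx hy; apply: filD => //; apply: filN. Qed.
Lemma filZ n k (c : K) (x : cell_alg n) : fil k x -> fil k (c *: x).
Proof.
elim: n k x => [|n ih] k x /=.
  by case=> [->|->]; [left|rewrite scaler0; right].
by move=> [x1 x2]; split; apply: ih.
Qed.
Lemma fil_le n k l (x : cell_alg n) : (k <= l)%N -> fil l x -> fil k x.
Proof.
elim: n k l x => [|n ih] k l x /= kl.
  by case=> [l0|->]; [left; apply/eqP; rewrite -leqn0 -l0|right].
move=> [x1 x2]; split; first exact: ih x1.
by apply: ih x2; rewrite -!subn1 leq_sub2r.
Qed.
Lemma fil_hpart n k i (x : cell_alg n) : fil k x -> fil k (hpart i x).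
Proof.
elim: n k i x => [|n ih] k i x /=.
  by case=> [->|->]; [left|rewrite linear0; right].
by move=> [x1 x2]; split; apply: ih.
Qed.
Lemma fil_ginv n k (x : cell_alg n) : fil k x -> fil k (ginv x).
Proof. by move=> h; rewrite ginvE; apply: filB; apply: fil_hpart. Qed.
Lemma filM n k l (x y : cell_alg n) : fil k x -> fil l y -> fil (k + l) (x * y).
Proof.
elim: n k l x y => [|n ih] k l x y.
  move=> [->|->]; last by rewrite mul0r; right.
  by move=> [->|->]; [left|rewrite mulr0; right].
move=> [x1 x2] [y1 y2]; split; first exact: ih.
apply: filD; [apply: fil_le (ih _ _ _ _ x1 y2)|apply: fil_le (ih _ _ _ _ x2 (fil_ginv y1))].
  exact: predn_addr.
by rewrite addnC [(_ + l)%N]addnC predn_addr.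
Qed.
Lemma fil_sum n k (I : eqType) (r : seq I) (F : I -> cell_alg n) :
  (forall j, j \in r -> fil k (F j)) -> fil k (\sum_(j <- r) F j).
Proof.
elim: r => [|j r ih] h; first by rewrite big_nil; exact: fil0.
rewrite big_cons; apply: filD; first by apply: h; rewrite mem_head.
by apply: ih => l lr; apply: h; rewrite inE lr orbT.
Qed.
Lemma fil_odd n (x : cell_alg n) : is_odd x -> fil 1 x.
Proof.
elim: n x => [|n ih] x.
  by move=> hx; right; rewrite -(Eev x) (hpart_other hx).
by move=> /sdual_odd[h _]; split; [exact: ih|exact: fil_0].
Qed.
Lemma fil_top n (x : cell_alg n) : fil n.+1 x -> x = 0.
Proof.
elim: n x => [|n ih] x /=; first by case.
by case: x => a b [/= ha hb]; rewrite (ih b hb) (ih a) //; apply: fil_le ha.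
Qed.

Fixpoint cell_base n : SHom (coord_alg E) (cell_alg n) :=
  if n is m.+1 return SHom (coord_alg E) (cell_alg n)
  then shom_compose (dinj (cell_alg m)) (cell_base m) else shom_id _.
Fixpoint cell_var n (k : nat) : cell_alg n :=
  if n is m.+1 return cell_alg n
  then if k == m then dvar (cell_alg m) else dinj (cell_alg m) (cell_var m k) else 0.

(** Substitution of [x k] for s_k and of [f] for the coefficients. [f] is a bare function because it
    will be a section of K[G] -> K[E] chosen without additivity. *)
Fixpoint cell_eval (C : SAlg K) (f : coord_alg E -> C) (x : nat -> C) n : cell_alg n -> C :=
  if n is m.+1 return cell_alg n -> C
  then fun b : sdual (cell_alg m) => cell_eval f x (dre b) + cell_eval f x (dim b) * x m
  else f.

Lemma cell_eval_natural (C D : SAlg K) (g : SHom C D) f x n (b : cell_alg n) :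
  g (cell_eval f x b) = cell_eval (g \o f) (g \o x) b.
Proof. by elim: n b => [|n ih] b //=; rewrite shomD shomM !ih. Qed.

Lemma cell_eval_ext (C : SAlg K) (f g : coord_alg E -> C) x y n (b : cell_alg n) :
  f =1 g -> (forall k, (k < n)%N -> x k = y k) -> cell_eval f x b = cell_eval g y b.
Proof.
move=> fg; elim: n b => [|n ih] b xy //=.
by rewrite xy // !ih // => k kn; apply: xy; apply: ltnW.
Qed.

Lemma cell_eval_id n (b : cell_alg n) : cell_eval (cell_base n) (cell_var n) b = b.
Proof.
elim: n b => [|n ih] b //=.
have e (c : cell_alg n) :
    cell_eval (shom_compose (dinj _) (cell_base n)) (cell_var n.+1) c = dinj _ c.
  rewrite -{2}(ih c) cell_eval_natural; apply: cell_eval_ext => // k kn /=.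
  by rewrite (ltn_eqF kn).
by rewrite !e eqxx -ddecomp.
Qed.

Lemma fil_cell_var n k : fil 1 (cell_var n k).
Proof.
elim: n k => [|n ih] k /=; first by right.
case: eqP => _; first by split; [exact: fil0|exact: fil_0].
by split; [exact: ih|exact: fil_0].
Qed.

Lemma fil_cell_eval N n k (b : cell_alg n) : fil k b ->
  fil k (cell_eval (cell_base N) (cell_var N) b).
Proof.
elim: n k b => [|n ih] k b.
  by case=> [->|->]; [exact: fil_0|rewrite /= shom0; exact: fil0].
move=> [b1 b2] /=; apply: filD; first exact: ih.
apply: fil_le (filM (ih _ _ b2) (fil_cell_var N n)).
by rewrite addn1; apply: leqSpred.
Qed.

(** Coefficients are known up to order 1 and variables, themselves of order 1, up to order 2; either
    replacement changes a term of order k only in order k + 1. A constant of order k > 0 is 0, which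
    is where [sg 0 = 0] enters. *)
Lemma cell_eval_close N (A : SAlg K) (th : SHom A (cell_alg N)) sg y n k (b : cell_alg n) :
  (forall c, fil 1 (th (sg c) - cell_base N c)) -> sg 0 = 0 ->
  (forall l, (l < n)%N -> fil 2 (th (y l) - cell_var N l)) -> fil k b ->
  fil k.+1 (th (cell_eval sg y b) - cell_eval (cell_base N) (cell_var N) b).
Proof.
move=> hsg sg0; elim: n k b => [|n ih] k b hy.
  case=> [->|->] /=; first exact: hsg.
  by rewrite sg0 !shom0 subr0; exact: fil0.
move=> [b1 b2] /=; rewrite shomD shomM opprD addrACA; apply: filD.
  by apply: ih => // l ln; apply: hy; apply: ltnW.
have ih2 := ih _ _ (fun l ln => hy l (ltnW ln)) b2.
set u := th (cell_eval sg y _) in ih2 *; set u' := cell_eval _ _ _ in ih2 *.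
have hyn := hy n (ltnSn n).
have -> : u * th (y n) - u' * cell_var N n =
    u' * (th (y n) - cell_var N n) + (u - u') * th (y n).
  by rewrite mulrBr mulrBl [RHS]addrC addrA subrK.
apply: filD.
  apply: fil_le (filM (fil_cell_eval N b2) hyn).
  by rewrite addn2 ltnS; apply: leqSpred.
have h1 : fil 1 (th (y n)).
  have -> : th (y n) = th (y n) - cell_var N n + cell_var N n by rewrite subrK.
  apply: filD; last exact: fil_cell_var.
  by apply: fil_le hyn.
by apply: fil_le (filM ih2 h1); rewrite addn1 ltnS; apply: leqSpred.
Qed.

End Filtration.

Lemma even_part_even (K : fieldType) (G E : supergroup K) (i : supergroup_hom E G) :
  is_even_part i -> forall c : coord_alg E, is_even c.
Proof.
move=> [ci ki] c; have [b hb] := ci c.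
have : comorphism i (hpart true b) = 0.
  apply/ki; rewrite -[hpart true b]mulr1; apply: ideal_gen_incl; exact: hpart_homog.
rewrite shom_comp hb => h; rewrite /homogeneous -[in RHS](salg_compD c) h.
by rewrite addr0.
Qed.

Lemma eps_tangent (K : fieldType) (G : supergroup K) (w : coord_alg G -> K) x s :
  tangent w ->
  (forall R (g h : point G R), pmul g h x = \sum_(p <- s) g p.1 * h p.2) ->
  \sum_(p <- s) (eps p.1 * w p.2) = w x.
Proof.
move=> hw sE.
have -> : x = \sum_(p <- s) eps p.1 *: p.2.
  transitivity (pmul (pone G _) (shom_id _) x); first by rewrite pmul1.
  by rewrite sE; apply: eq_bigr => p _; rewrite epsE -scalerAl mul1r.
elim: s {sE} => [|p s ih]; first by rewrite !big_nil tan0.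
by rewrite !big_cons (tan_lin hw) ih.
Qed.

(* The odd cotangent space at the identity is the odd component modulo this subspace. *)
Definition cotangent_null (K : fieldType) (G : supergroup K) (y : coord_alg G) : Prop :=
  exists s : seq (coord_alg G * coord_alg G),
  (forall p, p \in s -> [/\ is_even p.1, eps p.1 = 0 & is_odd p.2]) /\
  y = \sum_(p <- s) p.1 * p.2.

Definition cotangent_span (K : fieldType) (G : supergroup K) d
    (v : nat -> coord_alg G -> K) (a : nat -> coord_alg G) : Prop :=
  forall y, is_odd y -> cotangent_null (y - \sum_(k < d) v k y *: a k).

Lemma cotangent_spanE (K : fieldType) (G : supergroup K) d
    (v : nat -> coord_alg G -> K) (a : nat -> coord_alg G) y :
  cotangent_span d v a -> is_odd y -> exists s : seq (coord_alg G * coord_alg G),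
  (forall p, p \in s -> [/\ is_even p.1, eps p.1 = 0 & is_odd p.2]) /\
  y = \sum_(k < d) v k y *: a k + \sum_(p <- s) p.1 * p.2.
Proof.
move=> h /h[s [sP e]]; exists s; split => //.
by rewrite -e addrC subrK.
Qed.

(** * Bijectivity of the cell map *)

Section BigCell.
Variables (K : fieldType) (char2 : 2%N \notin [pchar K]).
Variables (G E : supergroup K) (i : supergroup_hom E G) (hE : is_even_part i).
Let A := coord_alg G.
Let Eev := even_part_even hE.
Let pr : point G (coord_alg E) := comorphism i.
Variables (v : nat -> A -> K) (hv : forall n, tangent (v n)) (d : nat) (a : nat -> A).
Hypotheses
  (a_odd : forall k, (k < d)%N -> is_odd (a k))
  (va : forall k l, (k < d)%N -> (l < d)%N -> v k (a l) = (k == l)%:R)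
  (va_span : cotangent_span d v a)
  (L : seq A) (L_odd : forall o, o \in L -> is_odd o)
  (L_gen : forall y, is_odd y -> in_ideal_generated (fun x => x \in L) y).

Fact pr_surj c : exists x : A, pr x = c. Proof. by case: hE => ci _; apply: ci. Qed.
Fact pr_eq0 (x : A) : pr x = 0 <-> in_ideal_generated (is_odd) x.
Proof. by case: hE. Qed.
Fact pr_odd (x : A) : is_odd x -> pr x = 0.
Proof. by move=> hx; apply/pr_eq0; rewrite -[x]mulr1; apply: ideal_gen_incl. Qed.

Fact even_section : exists sg : coord_alg E -> A,
  [/\ forall c, is_even (sg c), forall c, pr (sg c) = c & sg 0 = 0].
Proof.
have h c : exists x : A, [/\ is_even x, pr x = c & c = 0 -> x = 0].
  have [->|c0] := eqVneq c 0; first by exists 0; split => //; [exact: homog0|exact: shom0].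
  have [x hx] := pr_surj c; exists (hpart false x); split; first exact: hpart_homog.
    by rewrite shom_comp hx (Eev c).
  by move=> e; rewrite e eqxx in c0.
have [sg hsg] := boolp.choice h; exists sg; split=> [c|c|]; try by case: (hsg c).
by case: (hsg 0) => _ _; apply.
Qed.

Let sg : coord_alg E -> A := sval (cid even_section).
Fact sg_even c : is_even (sg c).
Proof. by have [h _ _] := svalP (cid even_section). Qed.
Fact sgK c : pr (sg c) = c.
Proof. by have [_ h _] := svalP (cid even_section). Qed.
Fact sg_0 : sg 0 = 0.
Proof. by have [_ _ h] := svalP (cid even_section). Qed.

Let cl (x : A) : seq (A * A) := sval (cid (comult_list x)).
Fact clE x R (g h : point G R) : pmul g h x = \sum_(p <- cl x) g p.1 * h p.2.
Proof. exact: (svalP (cid (comult_list x))). Qed.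

(* The E-invariant lift of a k modulo the square of the odd ideal: sum of S(a')a''. *)
Definition lift_inv (k : nat) : A :=
  if (k < d)%N then \sum_(p <- cl (a k)) sg (pinv pr p.1) * hpart true p.2 else 0.
Let y := lift_inv.

Fact y_odd k : is_odd (y k).
Proof.
rewrite /y /lift_inv; case: ltnP => _; last exact: homog0.
by apply: homog_sum => p _; apply: (homogM (sg_even _) (hpart_homog _ _)).
Qed.

Let SY (x : A) := x = 0 \/ exists2 k, (k < d)%N & x = y k.
Fact SY_hpart j x : SY x -> SY (hpart j x).
Proof.
case=> [->|[k kd ->]]; first by left; rewrite linear0.
by rewrite (homog_hpart _ (y_odd k)); case: eqP => _; [right; exists k|left].
Qed.

Let SJ := @odd_products K A.
Fact SJ_hpart j x : SJ x -> SJ (hpart j x).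
Proof.
case=> u [w [hu hw ->]]; rewrite (homog_hpart _ (homogM hu hw)); case: eqP => _.
  by exists u, w.
by exists 0, 0; rewrite mul0r; split => //; exact: homog0.
Qed.

Fact J2_sideal : is_sideal (in_ideal_generated SJ).
Proof.
apply: (ideal_gen_sideal SJ_hpart (f := counit G)) => _ [u [w [hu hw ->]]].
by rewrite shomM -[counit G u]/(eps u) eps_odd // mul0r.
Qed.

Section ModJ2.
Let R := qsalg J2_sideal.
Let rho : point G R := qproj J2_sideal.
Fact rho_oddM (u w : A) : is_odd u -> is_odd w -> rho (u * w) = 0.
Proof.
move=> hu hw; apply/qproj_eq0; rewrite -[u * w]mulr1; apply: ideal_gen_incl.
by exists u, w.
Qed.

Fact rho0_linear : linear (fun x : A => rho (hpart false x)).
Proof. by move=> c x z; rewrite linearP shomP. Qed.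
Fact rho0M : {morph (fun x : A => rho (hpart false x)) : x z / x * z}.
Proof.
move=> x z; rewrite hpartM0 shomD (rho_oddM (hpart_homog _ _) (hpart_homog _ _)) addr0.
exact: shomM.
Qed.
Fact rho01 : rho (hpart false 1) = 1.
Proof. by rewrite salg_comp1 shom1. Qed.
Fact rho0H j x : rho (hpart false (hpart j x)) = hpart j (rho (hpart false x)).
Proof.
by rewrite -shom_comp; congr (rho _); rewrite !salg_compK; case: j.
Qed.
(** Modulo J^2 the projection to the even part is multiplicative, so [rho0] is an even point over
    A/J^2. The point [u], the product of the inverse of [rho0] with [rho], isolates the odd
    directions. *)
Let rho0 : point G R := mk_shom rho0_linear rho0M rho01 rho0H.
Fact rho0E x : rho0 x = rho (hpart false x). Proof. by []. Qed.
Fact rho0_evenpt : evenpt rho0.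
Proof. by move=> x hx; rewrite rho0E (hpart_other hx) shom0. Qed.

Fact rho0_factor : exists e : SHom (coord_alg E) R, shom_compose e pr = rho0.
Proof. by have /(evenptP hE)[e he] := rho0_evenpt; exists e. Qed.

Fact J2_pr x : in_ideal_generated SJ x -> pr x = 0.
Proof. by apply: ideal_gen_zero => _ [u [w [hu hw ->]]]; rewrite shomM pr_odd ?mul0r. Qed.
Fact kappa_ex : exists ka : SHom R (coord_alg E), shom_compose ka rho = pr.
Proof.
apply: shom_factor; first exact: qproj_surj.
by move=> x /qproj_eq0; apply: J2_pr.
Qed.

(** An even element of J is a sum of products of two odd elements and so lies in J^2. Hence the even
    part of A/J^2 embeds into K[E]. *)
Fact kappa_inj (ka : SHom R (coord_alg E)) : shom_compose ka rho = pr ->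
  forall r : R, is_even r -> ka r = 0 -> r = 0.
Proof.
move=> kaE r hr; have [x hx] := qproj_surj (r : R).
have -> : r = rho (hpart false x) by rewrite shom_comp hx.
rewrite -[ka _]/(shom_compose ka rho (hpart false x)) kaE => /pr_eq0[s [so e]].
have -> : rho (hpart false x) = rho (\sum_(p <- s) p.1 * hpart true p.2).
  rewrite -(hpartK false x) e linear_sum; congr (rho _); apply: eq_big_seq => p /so hp.
  by rewrite /= hpartM0 hp (hpart_other hp) mul0r add0r.
rewrite shom_sum big_seq big1 // => p /so hp.
by apply: rho_oddM => //; apply: hpart_homog.
Qed.

Let u : point G R := pmul (pinv rho0) rho.

Fact u_a k : (k < d)%N -> u (a k) = rho (y k).
Proof.
move=> kd; have hu : is_odd (u (a k)) by apply: shom_homog; apply: a_odd.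
have [e eE] := rho0_factor.
have esg c : e c = rho (sg c).
  by rewrite -{1}(sgK c) -[LHS]/(shom_compose e pr (sg c)) eE rho0E sg_even.
rewrite -hu clE linear_sum /y /lift_inv kd shom_sum; apply: eq_bigr => p _.
have -> : pinv rho0 p.1 = e (pinv pr p.1).
  by rewrite -[RHS]/(shom_compose e (pinv pr) p.1) pinv_natural eE.
rewrite esg shomM shom_comp.
by rewrite [LHS]hpartM1 -!shom_comp sg_even (hpart_other (sg_even _)) shom0 mul0r addr0.
Qed.

(** Even values can be compared in K[E] by [kappa_inj], and there [rho0] and [rho] both become the
    universal point of E. *)
Fact u_even x : is_even x -> u x = (eps x)%:A.
Proof.
move=> hx; have [ka kaE] := kappa_ex.
apply/eqP; rewrite -subr_eq0 -(shom_scal1 u) -shomB; apply/eqP.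
apply: (kappa_inj kaE).
  by apply: shom_homog; apply: homogB => //; apply: homogZ1.
rewrite -[LHS]/(shom_compose ka u _) pmul_natural pinv_natural kaE.
have -> : shom_compose ka rho0 = pr.
  apply: shom_ext => z; rewrite -[LHS]/(shom_compose ka rho (hpart false z)) kaE.
  by rewrite shom_comp (Eev _).
by rewrite pmulV epsE epsB epsZ eps1 mulr1 subrr scale0r.
Qed.

Fact uE x : u x = (eps x)%:A + \sum_(k < d) v k x *: rho (y k).
Proof.
rewrite -{1}(salg_compD x) shomD u_even; last exact: hpart_homog.
have -> : eps (hpart false x) = eps x.
  by rewrite -[in RHS](salg_compD x) epsD (eps_odd (hpart_homog true x)) addr0.
congr (_ + _); have [s [sP e]] := cotangent_spanE va_span (hpart_homog true x).
rewrite e shomD shom_sum [X in _ + X]shom_sum [X in _ + X]big_seq [X in _ + X]big1 ?addr0.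
  apply: eq_bigr => k _; rewrite shomZ u_a //; congr (_ *: _).
  rewrite -[in RHS](salg_compD x) -[hpart false x]scale1r (tan_lin (hv k)).
  by rewrite (tan_even (hv k) (hpart_homog false x)) mulr0 add0r.
by move=> p /sP[h1 h2 h3]; rewrite shomM u_even // h2 scale0r mul0r.
Qed.

(** Expand [rho] as the product of [rho0] and [u], using the formula [uE] for [u]. The counit part
    contributes [rho0 x], which is 0 for odd [x]; the rest is a combination of the y_k modulo
    J^2. *)
Fact odd_in_y x : is_odd x ->
  exists2 w, in_ideal_generated SY w & in_ideal_generated SJ (x - w).
Proof.
move=> hx.
pose w := \sum_(k < d) (\sum_(p <- cl x) v k p.2 *: hpart false p.1) * y k.
exists w.
  apply: ideal_gen_sum => k _; apply: (ideal_genMl SY_hpart).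
  by rewrite -[y k]mulr1; apply: ideal_gen_incl; right; exists k.
apply/(qproj_eq0 J2_sideal)/eqP; rewrite shomB subr_eq0; apply/eqP.
have -> : qproj J2_sideal x = pmul rho0 u x by rewrite /u pmulA pmulgV pmul1.
rewrite clE.
have -> : \sum_(p <- cl x) rho0 p.1 * u p.2 = \sum_(p <- cl x) rho0 p.1 * (eps p.2)%:A
   + \sum_(p <- cl x) \sum_(k < d) rho0 p.1 * (v k p.2 *: rho (y k)).
  rewrite -big_split; apply: eq_bigr => p _.
  by rewrite uE mulrDr mulr_sumr.
have -> : \sum_(p <- cl x) rho0 p.1 * (eps p.2)%:A = rho0 x.
  by rewrite -[in RHS](pmulg1 rho0) clE; apply: eq_bigr => p _; rewrite epsE.
rewrite (rho0_evenpt hx) add0r exchange_big shom_sum; apply: eq_bigr => k _.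
rewrite shomM shom_sum mulr_suml; apply: eq_bigr => p _.
by rewrite shomZ rho0E -scalerAr -scalerAl.
Qed.
End ModJ2.

Fact odd_gen_y x : is_odd x -> in_ideal_generated SY x.
Proof.
apply: (odd_nakayama char2 SY_hpart L_odd); last exact: odd_in_y.
by move=> z /L_gen; apply: ideal_gen_ext => t; right.
Qed.

(** A remainder in the ideal of y_n, ..., y_(d-1) has the form g + c y_n with g in the ideal of the
    later generators. Expanding c at the previous stage leaves an error whose y_n part disappears
    because y_n^2 = 0. *)
Lemma cell_eval_onto (x : A) : exists b : cell_alg E d, cell_eval sg y b = x.
Proof.
pose T n (z : A) := z = 0 \/ exists2 k, (n <= k < d)%N & z = y k.
have T_hpart n j z : T n z -> T n (hpart j z).
  case=> [->|[k kd ->]]; first by left; rewrite linear0.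
  by rewrite (homog_hpart _ (y_odd k)); case: eqP => _; [right; exists k|left].
have Tdec n z : in_ideal_generated (T n) z ->
    exists g c, in_ideal_generated (T n.+1) g /\ z = g + c * y n.
  move=> [s [sS ->]]; elim: s sS => [|p s ihs] sS.
    by exists 0, 0; rewrite big_nil mul0r addr0; split => //; exact: ideal_gen0.
  have [|g [c [hg e]]] := ihs; first by move=> q qs; apply: sS; rewrite inE qs orbT.
  rewrite big_cons e; have [->|[k /andP[nk kd] ->]] := sS p (mem_head _ _).
    by exists g, c; rewrite mul0r add0r.
  have [kn|kn] := eqVneq k n.
    exists g, (ginv p.2 + c); split => //.
    by rewrite kn (odd_ginv _ (y_odd n)) mulrDl addrCA.
  exists (y k * p.2 + g), c; rewrite addrA; split => //; apply: ideal_genD => //.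
  apply: ideal_gen_incl; right; exists k => //.
  by rewrite kd ltn_neqAle eq_sym kn nk.
have key n : (n <= d)%N -> forall z, exists b : cell_alg E n,
    in_ideal_generated (T n) (z - cell_eval sg y b).
  elim: n => [|n ih] nd z.
    exists (pr z) => /=.
    have /pr_eq0[s [so ->]] : pr (z - sg (pr z)) = 0 by rewrite shomB sgK subrr.
    apply: ideal_gen_sum => p /so /odd_gen_y h; apply: ideal_genMr.
    apply: ideal_gen_ext h => t [->|[k kd ->]]; first by left.
    by right; exists k.
  have [b /Tdec[g [c [hg e]]]] := ih (ltnW nd) z.
  have [b' /Tdec[g' [c' [hg' e']]]] := ih (ltnW nd) c.
  exists (SDual b b' : cell_alg E n.+1) => /=.
  rewrite opprD addrA e -addrA -mulrBl e' mulrDl.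
  rewrite -mulrA (odd_sqr char2 (y_odd n)) mulr0 addr0.
  by apply: ideal_genD => //; apply: ideal_genMr.
have [b [s [sT e]]] := key d (leqnn d) x; exists b.
apply/eqP; rewrite eq_sym -subr_eq0 e big_seq big1 // => p /sT[->|[k]]; first by rewrite mul0r.
by case/andP => h1 h2; move: (leq_ltn_trans h1 h2); rewrite ltnn.
Qed.

Let th n : point G (cell_alg E n) := cell_pt i char2 v n.

Fact th_base n x : fil 1 (th n x - cell_base E n (pr x)).
Proof.
elim: n => [|n ih]; first by right; rewrite subrr.
split; last exact: fil_0.
have -> : dre (th n.+1 x - cell_base E n.+1 (pr x)) = th n x - cell_base E n (pr x).
  rewrite -(ddropE char2) shomB.
  have := @cell_pt_dhom _ _ _ i char2 _ hv n _ (shom_id _) 0 (homog0 true).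
  rewrite xp0 // pmulg1 shom_1compose => e.
  congr (_ - _); last exact: ddropE.
  exact: (congr1 (fun k : SHom _ _ => k x) e).
by [].
Qed.

Fixpoint odd_pt n : point G (cell_alg E n) :=
  if n is m.+1 return point G (cell_alg E n)
  then pmul (shom_compose (dinj _) (odd_pt m)) (xp char2 (v m) (dvar (cell_alg E m)))
  else pone G _.

Fact th_odd_pt n : th n = pmul (shom_compose (cell_base E n) pr) (odd_pt n).
Proof.
elim: n => [|n ih]; first by rewrite pmulg1; apply: shom_ext.
rewrite /th /= -/(th n) ih pmul_natural -pmulA; congr pmul.
by rewrite shom_composeA.
Qed.

Fact odd_ptE n x :
  fil 2 (odd_pt n x - ((eps x)%:A + \sum_(k < n) v k x *: cell_var E n k)).
Proof.
elim: n x => [|n ih] x.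
  by right; rewrite big_ord0 addr0 /= epsE subrr.
pose s := cl x.
have e1 : odd_pt n.+1 x = dinj _ (odd_pt n x) +
   \sum_(p <- s) dinj _ (odd_pt n p.1) * (v n p.2 *: dvar _).
  rewrite -[odd_pt n.+1]/(pmul (shom_compose (dinj _) (odd_pt n)) (xp char2 (v n) (dvar _))).
  have -> : odd_pt n x = \sum_(p <- s) odd_pt n p.1 * (eps p.2)%:A.
    by rewrite -[in LHS](pmulg1 (odd_pt n)) clE; apply: eq_bigr => p _; rewrite epsE.
  rewrite clE shom_sum -big_split.
  apply: eq_bigr => p _; rewrite [LHS](_ : _ = dinj _ (odd_pt n p.1) * xp char2 (v n) (dvar _) p.2) //.
  rewrite xpE //; last exact: dvar_odd.
  by rewrite shomM (shom_scal1 (dinj _)) mulrDr.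
have e2 : \sum_(p <- s) (eps p.1 * v n p.2) = v n x by apply: eps_tangent => // R; exact: clE.
pose D2 := \sum_(p <- s) v n p.2 *: (odd_pt n p.1 - (eps p.1)%:A).
have e3 : \sum_(p <- s) dinj _ (odd_pt n p.1) * (v n p.2 *: dvar _) =
    dinj _ (D2 + (v n x)%:A) * dvar (cell_alg E n).
  have -> : D2 + (v n x)%:A = \sum_(p <- s) v n p.2 *: odd_pt n p.1.
    rewrite -e2 scaler_suml -big_split; apply: eq_bigr => p _ /=.
    by rewrite scalerBr scalerA [eps _ * _]mulrC subrK.
  rewrite shom_sum mulr_suml; apply: eq_bigr => p _.
  by rewrite shomZ -scalerAr -scalerAl.
have e4 : (eps x)%:A + \sum_(k < n.+1) v k x *: cell_var E n.+1 k =
    dinj _ ((eps x)%:A + \sum_(k < n) v k x *: cell_var E n k) + v n x *: dvar (cell_alg E n).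
  have eS : cell_var E n.+1 n = dvar (cell_alg E n) by rewrite /= eqxx.
  have eL (k : 'I_n) : cell_var E n.+1 k = dinj (cell_alg E n) (cell_var E n k).
    by rewrite /= (ltn_eqF (ltn_ord k)).
  rewrite big_ord_recr eS addrA; congr (_ + _).
  rewrite shomD shom_scal1 shom_sum; congr (_ + _); apply: eq_bigr => k _.
  by rewrite shomZ -eL.
rewrite e1 e3 e4 shomD mulrDl shom_scal1 -scalerAl mul1r opprD addrACA -shomB.
rewrite addrK.
set D1 := odd_pt n x - _.
have -> : dinj _ D1 + dinj _ D2 * dvar _ = SDual D1 D2 :> cell_alg E n.+1.
  by rewrite [RHS]ddecomp.
split; first exact: ih.
apply: fil_sum => p _; apply: filZ.
rewrite -[odd_pt n p.1 - _](subrK (\sum_(k < n) v k p.1 *: cell_var E n k)).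
apply: filD; first by rewrite -addrA -opprD; apply: fil_le (ih _).
apply: fil_sum => k _; apply: filZ; exact: fil_cell_var.
Qed.

(** With exact lifts instead of [sg], the value of [th d] at y_k would be the value at a_k of pr^-1
    th = [odd_pt], which is s_k up to order 2. The lifts are correct only up to order 1, but each is
    multiplied by an odd factor, which has order at least 1. *)
Fact th_y k : (k < d)%N -> fil 2 (th d (y k) - cell_var E d k).
Proof.
move=> kd.
pose w := \sum_(p <- cl (a k)) cell_base E d (pinv pr p.1) * th d (hpart true p.2).
have h1 : fil 2 (th d (y k) - w).
  rewrite /y /lift_inv kd shom_sum -sumrB; apply: fil_sum => p _.
  rewrite shomM -mulrBl; apply: (@filM _ _ _ 1 1).
    by rewrite -{2}(sgK (pinv pr p.1)); apply: th_base.
  by apply: fil_odd Eev _ _ _; apply: shom_homog; apply: hpart_homog.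
have wE : w = odd_pt d (a k).
  have -> : odd_pt d = pmul (shom_compose (cell_base E d) (pinv pr)) (th d).
    by rewrite th_odd_pt pinv_natural pmulA pmulV pmul1.
  have ha : is_odd (pmul (shom_compose (cell_base E d) (pinv pr)) (th d) (a k)).
    by apply: shom_homog; apply: a_odd.
  rewrite -ha clE linear_sum; apply: eq_bigr => p _.
  have hc : is_even (cell_base E d (pinv pr p.1)) by exact: shom_homog (Eev _).
  have hc' : hpart true (cell_base E d (pinv pr p.1)) = 0 by exact: hpart_other hc.
  by rewrite [RHS]hpartM1 [X in X * _ + _]hc [X in _ + X * _]hc' mul0r addr0 shom_comp.
have h2 := odd_ptE d (a k).
rewrite -[th d (y k)](subrK w) -addrA; apply: filD => //.
have <- : (eps (a k))%:A + \sum_(l < d) v l (a k) *: cell_var E d l = cell_var E d k.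
  rewrite (eps_odd (a_odd kd)) scale0r add0r (bigD1 (Ordinal kd)) //= va // eqxx scale1r.
  rewrite big1 ?addr0 // => l lk; rewrite va //.
  by rewrite (_ : (l == k :> nat) = false) ?scale0r //; apply/negbTE.
by rewrite wE.
Qed.

(** Evaluation at [sg] and the y_k inverts [th d] with an error one order higher, and nothing
    nonzero has order d + 1. Surjectivity follows by successive approximation. For injectivity,
    write x as an evaluation of some b: if th x = 0 then b lies in every order, so it is 0. *)
Lemma cell_pt_bij : (forall b, exists x, th d x = b) /\ (forall x, th d x = 0 -> x = 0).
Proof.
have close n (b : cell_alg E d) : fil n b -> fil n.+1 (th d (cell_eval sg y b) - b).
  move=> hb; rewrite -{2}(cell_eval_id b); apply: cell_eval_close => //.
  - by move=> c; rewrite -{2}(sgK c); apply: th_base.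
  - exact: sg_0.
  - exact: th_y.
split=> [b|x].
  suff key n : exists x, fil n (b - th d x).
    have [x hx] := key d.+1; exists x.
    by apply/eqP; rewrite eq_sym -subr_eq0; apply/eqP/fil_top.
  elim: n => [|n [x hx]]; first by exists 0; exact: fil_0.
  exists (x + cell_eval sg y (b - th d x)).
  by rewrite shomD opprD addrA -opprB; apply: filN; apply: close.
have [b <-] := cell_eval_onto x => hb.
suff -> : b = 0.
  elim: (d) => [|n ih] /=; first exact: sg_0.
  by rewrite ih mul0r addr0.
suff key n : fil n b by apply: (fil_top (key d.+1)).
elim: n => [|n ih]; first exact: fil_0.
by have := close _ _ ih; rewrite hb sub0r => /filN; rewrite opprK.
Qed.

Lemma cell_all R (g : point G R) : cell char2 v d g.
Proof.
have [sj ij] := cell_pt_bij.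
apply/(cellP hE _ hv); apply: shom_factor => // x /ij ->; exact: shom0.
Qed.

End BigCell.

(** * Odd tangent vectors *)

Lemma odd_generators (K : fieldType) (G : supergroup K) : algebraic_supergroup G ->
  exists L : seq (coord_alg G), (forall o, o \in L -> is_odd o) /\
    forall y, is_odd y -> in_ideal_generated (fun x => x \in L) y.
Proof.
(* The element 0 makes [L] stable under homogeneous parts. *)
move=> [s sP]; pose L := 0 :: [seq hpart true x | x <- s].
have Lo o : o \in L -> is_odd o.
  by rewrite inE => /orP[/eqP ->|/mapP[x _ ->]]; [exact: homog0|exact: hpart_homog].
have Lh i x : x \in L -> hpart i x \in L.
  by move=> xL; rewrite (homog_hpart _ (Lo _ xL)); case: eqP => // _; rewrite mem_head.
exists L; split => // y <-; move: y; apply: sP.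
- move=> x xs; rewrite -[hpart true x]mulr1; apply: ideal_gen_incl.
  by rewrite inE; apply/orP; right; apply: map_f.
- by rewrite (hpart_other homog1); exact: ideal_gen0.
- move=> c x y hx hy; rewrite linearP; apply: ideal_genD => //.
  by rewrite -[hpart true x]mul1r scalerAl; apply: ideal_genMl.
- move=> x y hx hy; rewrite hpartM1; apply: ideal_genD; last exact: ideal_genMr.
  exact: ideal_genMl.
Qed.

Section TangentBasis.
Variables (K : fieldType) (G : supergroup K).
Let A := coord_alg G.
Variables (L : seq A) (L_odd : forall o, o \in L -> is_odd o)
  (L_gen : forall y, is_odd y -> in_ideal_generated (fun x => x \in L) y).

Notation M := (@cotangent_null K G).

Lemma cnull0 : M 0. Proof. by exists [::]; rewrite big_nil. Qed.
Lemma cnullD x y : M x -> M y -> M (x + y).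
Proof.
move=> [s [sP ->]] [t [tP ->]]; exists (s ++ t); rewrite big_cat; split => // p.
by rewrite mem_cat => /orP[/sP|/tP].
Qed.
Lemma cnullZ (c : K) x : M x -> M (c *: x).
Proof.
move=> [s [sP ->]]; exists [seq (c *: p.1, p.2) | p <- s]; split.
  move=> _ /mapP[p /sP[h1 h2 h3] ->]; split => //=; first exact: homogZ.
  by rewrite epsZ h2 mulr0.
by rewrite big_map scaler_sumr; apply: eq_bigr => p _; rewrite scalerAl.
Qed.
Lemma cnullB x y : M x -> M y -> M (x - y).
Proof. by move=> hx hy; rewrite -scaleN1r; apply: cnullD => //; apply: cnullZ. Qed.
Lemma cnullM x y : is_even x -> is_odd y -> M (x * y - eps x *: y).
Proof.
move=> hx hy; exists [:: (x - (eps x)%:A, y)]; split.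
  move=> p; rewrite inE => /eqP ->; split => //=; last by rewrite epsB epsZ eps1 mulr1 subrr.
  by apply: homogB => //; apply: homogZ1.
by rewrite big_seq1 /= mulrBl -scalerAl mul1r.
Qed.

Definition cspan d (a : nat -> A) : Prop :=
  (forall k, (k < d)%N -> is_odd (a k)) /\
  forall y, is_odd y -> exists c : nat -> K, M (y - \sum_(k < d) c k *: a k).

Fact cspan_ex : exists d, exists a, cspan d a.
Proof.
exists (size L), (nth 0 L); split; first by move=> k kL; apply: L_odd; apply: mem_nth.
move=> y hy; have [s [sL e]] := L_gen hy.
have {e} -> : y = \sum_(p <- s) hpart false p.2 * p.1.
  rewrite -hy e linear_sum; apply: eq_big_seq => p /sL /L_odd hp.
  by rewrite /= hpartM1 hp (hpart_other hp) mul0r add0r (even_comm_l _ (hpart_homog _ _)).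
elim: s sL => [|p s ih] sL.
  exists (fun=> 0); rewrite big_nil big1 ?subr0 => [|k _]; first exact: cnull0.
  by rewrite scale0r.
have [|c hc] := ih; first by move=> q qs; apply: sL; rewrite inE qs orbT.
have pL := sL p (mem_head _ _).
pose j := index p.1 L; have jL : (j < size L)%N by rewrite index_mem.
exists (fun k => c k + eps (hpart false p.2) *+ (k == j)).
have -> : \sum_(k < size L) (c k + eps (hpart false p.2) *+ (k == j :> nat)) *: nth 0 L k =
    \sum_(k < size L) c k *: nth 0 L k + eps (hpart false p.2) *: p.1.
  under eq_bigr do rewrite scalerDl.
  rewrite big_split; congr (_ + _); rewrite (bigD1 (Ordinal jL)) //= eqxx mulr1n nth_index //.
  rewrite big1 ?addr0 // => k kj; rewrite (_ : (k == j :> nat) = false) ?scale0r //.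
  exact/negbTE.
rewrite big_cons [X in _ - X]addrC opprD addrACA; apply: cnullD => //.
by apply: cnullM; [exact: hpart_homog|exact: L_odd].
Qed.

(** A spanning family of least length is a basis: a relation with nonzero coefficient at j would
    allow a_j to be dropped, the others being enumerated by [bump j]. *)
Lemma cotangent_basis : exists (d : nat) (a : nat -> A), cspan d a /\ (forall c : nat -> K, M (\sum_(k < d) c k *: a k) -> forall k, (k < d)%N -> c k = 0).
Proof.
pose P d := asbool (exists a, cspan d a).
have exP : exists d, P d by have [d h] := cspan_ex; exists d; apply/asboolP.
case: (ex_minnP exP) => d /asboolP[a ha] dmin; exists d, a; split => // c hc j jd.
apply: contrapT => /eqP cj.
case: d => [//|d] in a ha dmin c hc j jd cj *.
suff : P d by move/dmin; rewrite ltnn.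
pose o : 'I_d.+1 := Ordinal jd.
apply/asboolP; exists (fun k => a (bump j k)); split.
  move=> k kd; apply: ha.1; rewrite /bump.
  by case: (j <= k)%N; [rewrite add1n|rewrite add0n ltnS ltnW].
move=> y /ha.2[c' hc'].
pose t := c' j / c j.
exists (fun k => c' (bump j k) - t * c (bump j k)).
have := cnullD hc' (cnullZ t hc); congr (M _).
rewrite scaler_sumr -addrA; congr (_ + _).
apply: oppr_inj; rewrite opprD !opprK -sumrB.
rewrite (bigD1_ord o) //= scalerA -scalerBl /t divfK // subrr scale0r add0r.
by apply: eq_bigr => k _; rewrite scalerA -scalerBl.
Qed.

(** [v k] is the k-th coordinate of the odd part modulo [cotangent_null]. The Leibniz rule comes
    from the congruence xy = eps(x) y for even x and odd y ([cnullM]). Coordinates with index at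
    least d are set to 0, which keeps every [v n] tangent. *)
Lemma tangent_basis : exists (d : nat) (a : nat -> A) (v : nat -> A -> K),
  [/\ forall n, tangent (v n),
      forall k, (k < d)%N -> is_odd (a k),
      forall k l, (k < d)%N -> (l < d)%N -> v k (a l) = (k == l)%:R &
      cotangent_span d v a].
Proof.
have [d [a [[a_odd a_span] a_free]]] := cotangent_basis.
pose rep y (c : nat -> K) := M (hpart true y - \sum_(k < d) c k *: a k).
have ex y : exists c : nat -> K, rep y c /\ forall k, (d <= k)%N -> c k = 0.
  have [c hc] := a_span _ (hpart_homog true y).
  exists (fun k => if (k < d)%N then c k else 0); split; last by move=> k; rewrite leqNgt => /negbTE ->.
  by rewrite /rep; under eq_bigr do rewrite ltn_ord.
have [w wP] := boolp.choice ex.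
have uniq y c : rep y c -> forall k, (k < d)%N -> w y k = c k.
  move=> hc k kd; apply/eqP; rewrite -subr_eq0; apply/eqP.
  apply: (a_free (fun k => w y k - c k)) kd.
  have := cnullB hc (wP y).1; congr (M _).
  rewrite opprB addrC addrA subrK -sumrB.
  by apply: eq_bigr => l _; rewrite scalerBl.
have uniq' y c : rep y c -> (forall k, (d <= k)%N -> c k = 0) -> forall k, w y k = c k.
  move=> hc c0 k; case: (ltnP k d) => kd; first exact: uniq.
  by rewrite c0 // (wP y).2.
pose v k y := w y k.
have hv n : tangent (v n).
  split.
  - move=> c x y; apply: (uniq' _ (fun n => c * w x n + w y n)).
      rewrite /rep linearP; have := cnullD (cnullZ c (wP x).1) (wP y).1; congr (M _).
      rewrite scalerBr addrACA -opprD; congr (_ - _).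
      rewrite scaler_sumr -big_split; apply: eq_bigr => k _.
      by rewrite scalerDl scalerA.
    by move=> k dk; rewrite !(wP _).2 // mulr0 addr0.
  - move=> x hx; apply: (uniq' _ (fun=> 0)) => //.
    rewrite /rep (hpart_other hx) big1 ?subr0; first exact: cnull0.
    by move=> k _; rewrite scale0r.
  - move=> x y; apply: (uniq' _ (fun n => eps x * w y n + w x n * eps y)).
      rewrite /rep hpartM1.
      have e z : eps (hpart false z) = eps z.
        by rewrite -[in RHS](salg_compD z) epsD (eps_odd (hpart_homog true z)) addr0.
      have h1 := cnullM (hpart_homog false x) (hpart_homog true y).
      have h2 := cnullM (hpart_homog false y) (hpart_homog true x).
      have := cnullD (cnullD h1 h2) (cnullD (cnullZ (eps x) (wP y).1) (cnullZ (eps y) (wP x).1)).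
      congr (M _); rewrite !e (even_comm_l _ (hpart_homog false y)).
      rewrite !scalerBr addrACA !subrKA [LHS]addrACA -opprD; congr (_ - _).
      rewrite !scaler_sumr -big_split; apply: eq_bigr => k _.
      by rewrite scalerDl !scalerA [w x k * _]mulrC.
    by move=> k dk; rewrite !(wP _).2 // mulr0 mul0r addr0.
exists d, a, v; split => //.
- move=> k l kd ld; apply: (uniq' _ (fun k => (k == l)%:R)).
    rewrite /rep (a_odd _ ld) (bigD1 (Ordinal ld)) //= eqxx scale1r big1 ?addr0 ?subrr.
      exact: cnull0.
    by move=> m ml; rewrite (_ : (m == l :> nat) = false) ?scale0r //; apply/negbTE.
  by move=> m dm; rewrite gtn_eqF //; apply: leq_trans ld dm.
- by move=> y hy; have [+ _] := wP y; rewrite /rep hy.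
Qed.

End TangentBasis.

(** * Flags for trigonalizable groups *)

Section RowTensor.
Variables (K : fieldType) (k : nat) (R : lmodType K).
Notation V := 'rV[K]_k.

Definition tcoord (j : 'I_k) (x : tensor V R) : R :=
  tensor_lift (fun (w : V) (r : R) => w 0 j *: r) x.

Fact tcoord_bilin j : bilinear_map (fun (w : V) (r : R) => w 0 j *: r).
Proof.
split=> [r c w w'|w c r r']; first by rewrite !mxE scalerDl scalerA.
by rewrite scalerDr !scalerA mulrC.
Qed.
Lemma tcoord_linear j : linear (tcoord j).
Proof. exact: tensor_lift_linear (tcoord_bilin j). Qed.
HB.instance Definition _ j := GRing.isLinear.Build K (tensor V R) R _ (tcoord j) (tcoord_linear j).
Lemma tcoordE j w r : tcoord j (tens w r) = w 0 j *: r.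
Proof. exact: tensor_lift_tens (tcoord_bilin j). Qed.
Lemma tcoordD j x y : tcoord j (x + y) = tcoord j x + tcoord j y.
Proof. exact: linearD. Qed.
Lemma tcoord0 j : tcoord j 0 = 0. Proof. exact: linear0. Qed.
Lemma tcoord_sum j (I : Type) (r : seq I) (F : I -> tensor V R) :
  tcoord j (\sum_(i <- r) F i) = \sum_(i <- r) tcoord j (F i).
Proof. exact: linear_sum. Qed.

Lemma tcoord_decomp x : x = \sum_j tens (delta_mx 0 j : V) (tcoord j x).
Proof.
elim/tens_ind: x => [x y hx hy||w r].
- rewrite {1}hx {1}hy -big_split; apply: eq_bigr => j _.
  by rewrite tcoordD tensDr.
- by rewrite big1 // => j _; rewrite tcoord0 tens0r.
rewrite {1}[w]row_sum_delta tens_suml; apply: eq_bigr => j _.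
by rewrite tcoordE tensZl tensZr.
Qed.

Lemma tcoord_ext x y : (forall j, tcoord j x = tcoord j y) -> x = y.
Proof.
by move=> h; rewrite (tcoord_decomp x) (tcoord_decomp y); apply: eq_bigr => j _; rewrite h.
Qed.

Definition tmk (u : 'I_k -> R) : tensor V R := \sum_j tens (delta_mx 0 j : V) (u j).
Lemma tcoord_mk j u : tcoord j (tmk u) = u j.
Proof.
rewrite /tmk tcoord_sum (bigD1 j) //= tcoordE mxE !eqxx scale1r big1 ?addr0 // => l lj.
by rewrite tcoordE mxE eqxx [j == l]eq_sym (negbTE lj) scale0r.
Qed.
End RowTensor.

Section RowModule.
Variables (K : fieldType) (E : supergroup K) (k : nat) (Z : 'M[coord_alg E]_k).
Hypotheses
  (ZM : forall R (g h : point E R) i j, pmul g h (Z i j) = \sum_l h (Z i l) * g (Z l j))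
  (Z1 : forall R i j, pone E R (Z i j) = (i == j)%:R).
Notation V := 'rV[K]_k.

(** Row vectors are multiplied by the matrix on the right, which is why [h] precedes [g] in [ZM]. *)
Definition row_act (R : comAlgType K) (g : point E (even_salg R)) (x : tensor V R) : tensor V R :=
  tmk (fun l => \sum_j tcoord j x * (g (Z j l) : R)).

Lemma tcoord_act R (g : point E (even_salg R)) x l :
  tcoord l (row_act g x) = \sum_j tcoord j x * (g (Z j l) : R).
Proof. exact: tcoord_mk. Qed.

Fact row_actD R (g : point E (even_salg R)) x y : row_act g (x + y) = row_act g x + row_act g y.
Proof.
apply: tcoord_ext => l; rewrite tcoordD !tcoord_act -big_split.
by apply: eq_bigr => j _; rewrite tcoordD mulrDl.
Qed.

Fact tcoord_tensor_act (R : comAlgType K) (r : R) (x : tensor V R) j :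
  tcoord j (tensor_act r x) = r * tcoord j x.
Proof.
have bb : bilinear_map (fun (v : V) (w : R) => tens v (r * w)).
  split=> [w c v v'|v c w w']; first by rewrite tensDl tensZl.
  by rewrite mulrDr -scalerAr tensDr tensZr.
elim/tens_ind: x => [x y hx hy||w s].
- have -> : tensor_act r (x + y) = tensor_act r x + tensor_act r y by exact: (tensor_liftD _ _ bb).
  by rewrite !tcoordD hx hy mulrDr.
- by have -> : tensor_act r 0 = 0 :> tensor V R; [exact: (tensor_lift0 bb)|rewrite !tcoord0 mulr0].
by rewrite /tensor_act /tensor_mapr tensor_lift_tens // !tcoordE scalerAr.
Qed.

Fact tcoord_mapr (R R' : comAlgType K) (f : {lrmorphism R -> R'}) (x : tensor V R) j :
  tcoord j (tensor_mapr f x) = f (tcoord j x).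
Proof.
have bb : bilinear_map (fun (v : V) (w : R) => tens v (f w)).
  split=> [w c v v'|v c w w']; first by rewrite tensDl tensZl.
  by rewrite linearP tensDr tensZr.
elim/tens_ind: x => [x y hx hy||w s].
- have -> : tensor_mapr f (x + y) = tensor_mapr f x + tensor_mapr f y by exact: (tensor_liftD _ _ bb).
  by rewrite !tcoordD hx hy linearD.
- by have -> : tensor_mapr f 0 = 0 :> tensor V R'; [exact: (tensor_lift0 bb)|rewrite !tcoord0 linear0].
by rewrite /tensor_mapr tensor_lift_tens // !tcoordE linearZ.
Qed.

Fact row_actZ (R : comAlgType K) (g : point E (even_salg R)) (r : R) x :
  row_act g (tensor_act r x) = tensor_act r (row_act g x).
Proof.
apply: tcoord_ext => l; rewrite tcoord_tensor_act !tcoord_act mulr_sumr.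
by apply: eq_bigr => j _; rewrite tcoord_tensor_act mulrA.
Qed.
Fact row_act1 R x : row_act (pone E (even_salg R)) x = x.
Proof.
apply: tcoord_ext => l; rewrite tcoord_act (bigD1 l) //= Z1 eqxx mulr1 big1 ?addr0 // => j jl.
by rewrite Z1 (negbTE jl) mulr0.
Qed.
Fact row_actM R (g h : point E (even_salg R)) x :
  row_act (pmul g h) x = row_act g (row_act h x).
Proof.
apply: tcoord_ext => l; rewrite !tcoord_act.
under eq_bigr do rewrite ZM mulr_sumr.
rewrite exchange_big; apply: eq_bigr => j _.
by rewrite tcoord_act mulr_suml; apply: eq_bigr => m _; rewrite mulrA.
Qed.
Fact row_act_natural (R R' : comAlgType K) (f : {lrmorphism R -> R'})
    (g : point E (even_salg R)) x :
  row_act (shom_compose (even_shom f) g : point E (even_salg R'))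
    (tensor_mapr f x) = tensor_mapr f (row_act g x).
Proof.
apply: tcoord_ext => l; rewrite tcoord_mapr !tcoord_act linear_sum.
by apply: eq_bigr => j _; rewrite rmorphM tcoord_mapr.
Qed.

Definition row_module : gmodule E :=
  @MkGModule K E V row_act row_actD row_actZ row_act1 row_actM row_act_natural.
End RowModule.

Section EvenAlg.
Variables (K : fieldType) (A : SAlg K).
Hypothesis Aev : forall c : A, is_even c.
Fact ev_mulC : @commutative A A *%R.
Proof. by move=> x y; apply: even_comm_l. Qed.
(** A copy of [A] indexed by a proof of commutativity, so that a [comAlgType] can be declared on it.
    Modules are tested on such algebras only, and [ev_point] is the universal point of E in this
    setting. *)
Definition calg of @commutative A A *%R : Type := A.
HB.instance Definition _ h := GRing.Algebra.copy (calg h) (salg_alg A).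
HB.instance Definition _ h := GRing.PzRing_hasCommutativeMul.Build (calg h) h.
Definition ev_calg : comAlgType K := calg ev_mulC.
Let idf (x : A) : even_salg ev_calg := x.
Fact idf_linear : linear idf. Proof. by []. Qed.
Fact idfM : {morph idf : x y / x * y}. Proof. by []. Qed.
Fact idfH i a : idf (hpart i a) = hpart i (idf a).
Proof.
case: i; rewrite /idf /=; last exact: Aev.
by rewrite (hpart_other (Aev a)).
Qed.
Definition ev_point : SHom A (even_salg ev_calg) := mk_shom idf_linear idfM erefl idfH.
Lemma ev_pointE x : ev_point x = x. Proof. by []. Qed.
End EvenAlg.

Section Flag.
Variables (K : fieldType) (E : supergroup K).
Hypotheses (Eev : forall c : coord_alg E, is_even c) (tE : trigonalizable E).
Let A := coord_alg E.

Definition smx m n (M : 'M[K]_(m, n)) : 'M[A]_(m, n) := map_mx (in_alg A) M.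

Lemma smxM m n p (M : 'M[K]_(m, n)) (N : 'M_(n, p)) : smx (M *m N) = smx M *m smx N.
Proof. exact: map_mxM. Qed.
Lemma smx1 n : smx (1%:M : 'M_n) = 1%:M. Proof. exact: map_mx1. Qed.
Lemma smx0 m n : smx (0 : 'M_(m, n)) = 0. Proof. exact: map_mx0. Qed.
Lemma smx_point R (g : point E R) m n (M : 'M[K]_(m, n)) :
  map_mx g (smx M) = map_mx (in_alg R) M.
Proof. by apply/matrixP => i j; rewrite !mxE shom_scal1. Qed.

Section Irreducible.
Variables (k : nat) (Z : 'M[A]_k).
Hypotheses
  (ZM : forall R (g h : point E R), map_mx (pmul g h) Z = map_mx h Z *m map_mx g Z)
  (Z1 : forall R, map_mx (pone E R) Z = 1%:M).
Hypothesis Zirr : forall m (U : 'M[K]_(m, k)) (Y : 'M[A]_m), (0 < m)%N -> row_free U ->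
  smx U *m Z = Y *m smx U -> m = k.

Fact ZM' R (g h : point E R) i j : pmul g h (Z i j) = \sum_l h (Z i l) * g (Z l j).
Proof.
have /matrixP/(_ i j) := ZM g h; rewrite !mxE => ->.
by apply: eq_bigr => l _; rewrite !mxE.
Qed.
Fact Z1' R i j : pone E R (Z i j) = (i == j)%:R.
Proof. by have /matrixP/(_ i j) := Z1 R; rewrite !mxE. Qed.
Let V := row_module ZM' Z1'.

Fact sub_row_span (W : 'rV[K]_k -> Prop) m (U : 'M[K]_(m, k)) : @submodule _ _ V W ->
  (forall i, W (row i U)) -> forall w, (w <= U)%MS -> W w.
Proof.
move=> sW WU w /submxP[c ->]; rewrite mulmx_sum_row.
have [W0 Wl _] := sW; elim/big_ind: _ => // [x y hx hy|i _].
  by rewrite -[x]scale1r; apply: Wl.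
by rewrite -[_ *: _]addr0; apply: Wl.
Qed.

(** A matrix of largest rank with rows in [W] spans [W], since any further vector of [W] would raise
    the rank. *)
Fact submodule_rowspace (W : 'rV[K]_k -> Prop) : @submodule _ _ V W ->
  exists U : 'M[K]_k, forall w, W w <-> (w <= U)%MS.
Proof.
move=> sW; have [W0 Wl Ws] := sW.
pose P m := asbool (exists U : 'M[K]_k, (forall i, W (row i U)) /\ \rank U = m).
have exP : exists m, P m.
  by exists 0%N; apply/asboolP; exists 0; rewrite mxrank0; split => // i; rewrite row0.
have bd m : P m -> (m <= k)%N by move=> /asboolP[U [_ <-]]; apply: rank_leq_row.
case: (ex_maxnP exP bd) => m /asboolP[U [WU rU]] mmax.
exists U => w; split; last exact: sub_row_span.
move=> Ww; apply: contrapT => /negP nw.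
have sub : (U <= U + w)%MS by exact: addsmxSl.
have : (\rank U < \rank (U + w)%MS)%N.
  rewrite ltn_neqAle mxrankS // andbT; have [_ ->] := mxrank_leqif_sup sub.
  by rewrite addsmx_sub submx_refl.
rewrite rU ltnNge mmax //; apply/asboolP; exists (U + w)%MS; split => // i.
have : (row i (U + w)%MS <= col_mx U w)%MS by rewrite (submx_trans (row_sub i _)) // addsmxE.
apply: sub_row_span => // j; rewrite -(splitK j).
by case: (split j) => l /=; rewrite ?rowKu ?rowKd ?(ord1 l) ?row_id.
Qed.

(** At the universal point the action is multiplication by [Z] itself, so stability of a subspace
    becomes a matrix identity over K[E]. *)
Fact universal_act (w : 'rV[K]_k) (s : seq ('rV[K]_k * A)) :
  row_act Z (ev_point Eev : point E (even_salg (ev_calg Eev))) (tens w (1 : ev_calg Eev)) =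
    \sum_(p <- s) tens p.1 (p.2 : ev_calg Eev) ->
  smx w *m Z = \row_j \sum_(p <- s) p.1 0 j *: p.2.
Proof.
move=> e; apply/rowP => j.
have := tcoord_act Z (ev_point Eev : point E (even_salg (ev_calg Eev))) (tens w (1 : ev_calg Eev)) j.
rewrite e tcoord_sum => {}e; rewrite !mxE.
have e2 : \sum_(p <- s) p.1 0 j *: p.2 = \sum_(p <- s) tcoord j (tens p.1 (p.2 : ev_calg Eev)).
  by apply: eq_bigr => p _; rewrite tcoordE.
refine (etrans _ (esym (etrans e2 e))); apply: eq_bigr => l _.
by rewrite !mxE tcoordE ev_pointE.
Qed.

Lemma irreducible_dim1 : (0 < k)%N -> k = 1%N.
Proof.
move=> k0; have sV : simple_module V.
  split.
    exists (const_mx 1 : 'rV[K]_k); apply/eqP => /rowP/(_ (Ordinal k0)).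
    by rewrite !mxE => /eqP; rewrite oner_eq0.
  move=> W sW; have [U UW] := submodule_rowspace sW.
  have [r0|rpos] := posnP (\rank U).
    by left=> w /UW; move/eqP: r0; rewrite mxrank_eq0 => /eqP -> /submx0null.
  right=> w; apply/UW.
  pose U' := row_base U; pose D := pinvmx U'.
  have fU' : row_free U' by exact: row_base_free.
  have st : smx U' *m Z = (smx U' *m Z *m smx D) *m smx U'.
    apply/row_matrixP => i; rewrite !row_mul.
    have rE : row i (smx U') = smx (row i U') by rewrite /smx map_row.
    rewrite rE.
    have Wr : W (row i U') by apply/UW; rewrite (submx_trans (row_sub i _)) // eq_row_base.
    have [_ _ Ws] := sW.
    have [s [sW' e]] := Ws _ (ev_point Eev) (row i U') 1 Wr.
    have -> := universal_act e.
    have -> : \row_j \sum_(p <- s) p.1 0 j *: p.2 = \sum_(p <- s) (p.2 *: smx p.1 : 'rV[A]_k).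
      apply/rowP => j; rewrite summxE !mxE; apply: eq_bigr => p _.
      by rewrite !mxE mulr_algr.
    rewrite !mulmx_suml; apply: eq_big_seq => p ps.
    rewrite -!scalemxAl -!smxM mulmxKpV //.
    by rewrite eq_row_base; apply/UW; apply: sW'.
  have := Zirr rpos fU' st => rk.
  by rewrite submx_full // /row_full rk.
have [v v0 vall] := tE sV.
have : ((1%:M : 'M[K]_k) <= (v : 'rV[K]_k))%MS.
  apply/row_subP => i; have [c ->] := vall (row i 1%:M).
  exact: scalemx_sub.
move/mxrankS; rewrite mxrank1 => /leq_trans/(_ (rank_leq_row _)).
by case: (k) k0 => [|[]].
Qed.
End Irreducible.

Section FlagStep.
Variables (n r : nat) (X : 'M[A]_n) (P : 'M[K]_(r, n)) (L : 'M[A]_r).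
Hypotheses
  (XM : forall R (g h : point E R), map_mx (pmul g h) X = map_mx h X *m map_mx g X)
  (X1 : forall R, map_mx (pone E R) X = 1%:M)
  (fP : row_free P) (rn : (r < n)%N) (PX : smx P *m X = L *m smx P).

Definition complement_stable k : Prop := (0 < k)%N /\
  exists (B : 'M[K]_(k, n)) (Y : 'M[A]_(k, r)) (Z : 'M[A]_k),
    row_free (col_mx P B) /\ smx B *m X = Y *m smx P + Z *m smx B.

Fact complement_stable_ex : exists k, complement_stable k.
Proof.
pose B := row_base (P^C)%MS; exists (\rank (P^C)%MS).
have rP : \rank P = r by apply/eqP.
split; first by rewrite mxrank_compl rP subn_gt0.
have rf : \rank (col_mx P B) = n.
  have e : (col_mx P B :=: P + P^C)%MS.
    by apply: eqmx_trans (eqmx_sym (addsmxE _ _)) _; apply: adds_eqmx => //; apply: eq_row_base.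
  by rewrite e; apply/eqP; have := addsmx_compl_full P; rewrite /row_full.
have full : row_full (col_mx P B) by apply/eqP.
pose T := smx B *m X *m smx (pinvmx (col_mx P B)).
exists B, (lsubmx T), (rsubmx T); split.
  by rewrite /row_free rf mxrank_compl rP subnKC // ltnW.
rewrite -mul_row_col hsubmxK -map_col_mx -[map_mx _ _]/(smx _) /T -mulmxA -smxM.
by rewrite mulVpmx // smx1 mulmx1.
Qed.

(** Take a stable extension of the row space of [P] by the least number k > 0 of rows. The quotient
    is irreducible, since a nonzero stable subspace of it pulls back to a stable extension and so
    has dimension at least k; trigonalizability then forces k = 1. *)
Lemma flag_step : exists (p : 'rV[K]_n) (l : 'rV[A]_r) (x : A),
  row_free (col_mx P p) /\ smx p *m X = l *m smx P + x *: smx p.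
Proof.
have exP : exists k, asbool (complement_stable k).
  by have [k hk] := complement_stable_ex; exists k; apply/asboolP.
case: (ex_minnP exP) => k /asboolP[k0 [B [Y [Z [fPB BX]]]]] kmin.
(* [C] annihilates the rows of [P] and is a right inverse of [B], so it extracts the action [Z] on
   the quotient. *)
pose D := pinvmx (col_mx P B); pose C := rsubmx D.
have [PC BC] : P *m C = 0 /\ B *m C = 1%:M.
  have := mulmxVp fPB; rewrite -/D -[D]hsubmxK mul_col_row scalar_mx_block => /eq_block_mx[_ h1 _ h2].
  by split.
have ZE : Z = smx B *m X *m smx C.
  by rewrite BX mulmxDl -!mulmxA -!smxM PC BC smx0 mulmx0 add0r smx1 mulmx1.
have pX R (g : point E R) : map_mx (in_alg R) P *m map_mx g X = map_mx g L *m map_mx (in_alg R) P.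
  by rewrite -!(smx_point g) -!map_mxM PX.
have bX R (g : point E R) : map_mx (in_alg R) B *m map_mx g X =
    map_mx g Y *m map_mx (in_alg R) P + map_mx g Z *m map_mx (in_alg R) B.
  by rewrite -!(smx_point g) -!map_mxM -map_mxD BX.
have zX R (g : point E R) : map_mx g Z = map_mx (in_alg R) B *m map_mx g X *m map_mx (in_alg R) C.
  by rewrite {1}ZE !map_mxM !smx_point.
have ZM R (g h : point E R) : map_mx (pmul g h) Z = map_mx h Z *m map_mx g Z.
  rewrite zX XM mulmxA bX mulmxDl -(mulmxA _ _ (map_mx g X)) pX.
  rewrite mulmxDl -!mulmxA -[map_mx _ P *m map_mx _ C]map_mxM PC map_mx0 !mulmx0 add0r.
  by rewrite (zX _ g) !mulmxA.
have Z1 R : map_mx (pone E R) Z = 1%:M.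
  by rewrite zX X1 mulmx1 -map_mxM BC map_mx1.
have k1 : k = 1%N.
  apply: (irreducible_dim1 ZM Z1) => // m U Y' m0 fU UZ.
  have mk : (m <= k)%N by move: fU; rewrite /row_free => /eqP <-; apply: rank_leq_col.
  apply/eqP; rewrite eqn_leq mk; apply: kmin; apply/asboolP; split => //.
  exists (U *m B), (smx U *m Y), Y'; split.
    apply/row_freeP; exists (D *m block_mx 1%:M 0 0 (pinvmx U)).
    have -> : col_mx P (U *m B) = block_mx 1%:M 0 0 U *m col_mx P B.
      by rewrite mul_block_col mul1mx !mul0mx addr0 add0r.
    rewrite -mulmxA (mulmxA _ D) mulmxVp // mul1mx mulmx_block !mul1mx !mul0mx !mulmx0 !addr0 add0r.
    by rewrite mulmxVp // -scalar_mx_block.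
  by rewrite smxM -mulmxA BX mulmxDr !mulmxA UZ.
move: B Y Z {kmin D C PC BC ZE bX zX ZM Z1} fPB BX; rewrite k1 => B Y Z fPB BX.
exists B, Y, (Z 0 0); split => //.
by rewrite BX [Z in LHS]mx11_scalar mul_scalar_mx.
Qed.
End FlagStep.

Lemma flag n (X : 'M[A]_n) :
  (forall R (g h : point E R), map_mx (pmul g h) X = map_mx h X *m map_mx g X) ->
  (forall R, map_mx (pone E R) X = 1%:M) ->
  exists (P : 'M[K]_n) (L : 'M[A]_n), [/\ P \in unitmx,
    forall i j : 'I_n, (i < j)%N -> L i j = 0 & smx P *m X = L *m smx P].
Proof.
move=> XM X1.
pose S r := exists (P : 'M[K]_(r, n)) (L : 'M[A]_r), [/\ row_free P,
    forall i j : 'I_r, (i < j)%N -> L i j = 0 & smx P *m X = L *m smx P].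
suff : S n by case=> P [L [fP Ll PX]]; exists P, L; split => //; rewrite -row_free_unit.
have key r : (r <= n)%N -> S r.
  elim: r => [|r ih] rn.
    exists 0, 0; split; [|by case|by apply/matrixP => -[]].
    by rewrite /row_free mxrank0.
  have [P [L [fP Ll PX]]] := ih (ltnW rn).
  have [p [l [x [fp pX]]]] := flag_step XM X1 fP rn PX.
  rewrite -addn1; exists (col_mx P p), (block_mx L 0 l (x%:M : 'M_1)); split => //.
    move=> i j; rewrite -(splitK i) -(splitK j).
    case: (split i) => i'; case: (split j) => j' /=;
      rewrite ?(block_mxEul, block_mxEur, block_mxEdl, block_mxEdr).
    - exact: Ll.
    - by rewrite mxE.
    - by rewrite ltnNge ltnW // (leq_trans (ltn_ord j')) // leq_addr.
    - by rewrite !ord1 ltnn.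
  rewrite [smx (col_mx _ _)]map_col_mx mul_col_mx -/(smx P) -/(smx p) PX pX.
  by rewrite mul_block_col mul0mx addr0 mul_scalar_mx.
exact: key.
Qed.

End Flag.

(** * The adjoint action on odd tangent vectors *)

Lemma pinvK (K : fieldType) (G : supergroup K) R (g : point G R) : pinv (pinv g) = g.
Proof. by apply: (@pmulIg _ _ _ (pinv g)); rewrite pmulV pmulgV. Qed.

Section LinearPoints.
Variables (K : fieldType) (char2 : 2%N \notin [pchar K]) (G : supergroup K).
Let A := coord_alg G.
Variables (v : nat -> A -> K) (hv : forall n, tangent (v n)).
Implicit Types R S : SAlg K.

(** All parameters are multiples of the same odd [a], so their products vanish and the point is
    first order, with tangent vector the sum of the r_j v_j ([lptE]). *)
Fixpoint lpt m R (r : nat -> R) (a : R) : point G R :=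
  if m is n.+1 then pmul (lpt n r a) (xp char2 (v n) (r n * a)) else pone G R.

Lemma even_odd_mul R (r a : R) : is_even r -> is_odd a ->
  is_odd (r * a).
Proof. exact: homogM. Qed.

Lemma even_mul_odd_sqr R (r s a : R) : is_even r -> is_even s ->
  is_odd a -> (r * a) * (s * a) = 0.
Proof.
move=> hr hs ha; rewrite (even_comm_l a hs) mulrA -(mulrA r) (odd_sqr char2 ha).
by rewrite mulr0 mul0r.
Qed.

Lemma lptE m R (r : nat -> R) (a : R) y : (forall j, is_even (r j)) ->
  is_odd a ->
  lpt m r a y = (eps y)%:A + \sum_(j < m) v j y *: (r j * a).
Proof.
move=> hr ha; elim: m y => [|m ih] y; first by rewrite big_ord0 addr0 /= epsE.
rewrite big_ord_recr addrA.
apply: (first_order_mul (Dg := fun y => \sum_(j < m) v j y *: (r j * a))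
                        (Dh := fun y => v m y *: (r m * a))) => //.
  by move=> z; rewrite xpE //; apply: even_odd_mul.
move=> x z; rewrite mulr_suml big1 // => j _.
by rewrite -scalerAl -scalerAr even_mul_odd_sqr // !scaler0.
Qed.

Definition conjpt R (e g : point G R) : point G R := pmul (pmul e g) (pinv e).
Lemma conjptM R (e g h : point G R) : conjpt e (pmul g h) = pmul (conjpt e g) (conjpt e h).
Proof. by rewrite /conjpt !pmulA -(pmulA _ _ e) pmulV pmulg1. Qed.
Lemma conjpt1 R (e : point G R) : conjpt e (pone G R) = pone G R.
Proof. by rewrite /conjpt pmulg1 pmulgV. Qed.
Lemma conjpt_mul R (e f g : point G R) : conjpt (pmul e f) g = conjpt e (conjpt f g).
Proof.
rewrite /conjpt !pmulA.
have -> : pinv (pmul e f) = pmul (pinv f) (pinv e).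
  apply: (@pmulgI _ _ _ (pmul e f)); rewrite pmulgV -pmulA (pmulA f) pmulgV pmul1.
  by rewrite pmulgV.
by rewrite !pmulA.
Qed.
Lemma conjpt_natural R S (f : SHom R S) (e g : point G R) :
  shom_compose f (conjpt e g) = conjpt (shom_compose f e) (shom_compose f g).
Proof. by rewrite /conjpt !pmul_natural pinv_natural. Qed.

Lemma conjpt_lpt d m R (e : point G R) (t : nat -> nat -> R) (r : nat -> R) (a : R) :
  (forall l j, is_even (t l j)) ->
  (forall j, is_even (r j)) -> is_odd a ->
  (forall j (b : R) y, (j < m)%N -> is_odd b ->
     conjpt e (xp char2 (v j) b) y = (eps y)%:A + \sum_(l < d) v l y *: (t l j * b)) ->
  forall y, conjpt e (lpt m r a) y =
    (eps y)%:A + \sum_(l < d) v l y *: (\sum_(j < m) t l j * r j * a).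
Proof.
move=> ht hr ha; elim: m => [|m ih] te y.
  rewrite conjpt1 epsE big1 ?addr0 // => l _; by rewrite big_ord0 scaler0.
have sE l : \sum_(j < m.+1) t l j * r j * a = \sum_(j < m) t l j * r j * a + t l m * r m * a.
  by rewrite big_ord_recr.
under eq_bigr do rewrite sE scalerDr.
rewrite big_split addrA /= conjptM.
apply: (first_order_mul (Dg := fun y => \sum_(l < d) v l y *: (\sum_(j < m) t l j * r j * a))
                        (Dh := fun y => \sum_(l < d) v l y *: (t l m * r m * a))) => //.
- by apply: ih => j b z jm; apply: te; apply: ltnW.
- move=> z; rewrite te //; last exact: even_odd_mul.
  by congr (_ + _); apply: eq_bigr => l _; rewrite mulrA.
move=> x z; rewrite mulr_suml big1 // => l _; rewrite mulr_sumr big1 // => l' _.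
rewrite -scalerAl -scalerAr mulr_suml big1 ?scaler0 // => j _.
by apply: even_mul_odd_sqr => //; apply: (@homogM _ _ false false).
Qed.

End LinearPoints.

Section Adjoint.
Variables (K : fieldType) (char2 : 2%N \notin [pchar K]).
Variables (G E : supergroup K) (i : supergroup_hom E G) (hE : is_even_part i).
Let A := coord_alg G.
Let Eev := even_part_even hE.
Let pr : point G (coord_alg E) := comorphism i.
Variables (v : nat -> A -> K) (hv : forall n, tangent (v n)) (d : nat) (a : nat -> A).
Hypotheses
  (a_odd : forall k, (k < d)%N -> is_odd (a k))
  (va : forall k l, (k < d)%N -> (l < d)%N -> v k (a l) = (k == l)%:R)
  (va_span : cotangent_span d v a).

Let B := coord_alg E.
Implicit Types R S : SAlg K.
(** The conjugate of x_k(s) by the universal point of E, over K[E][s]. Its coefficients [adm] form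
    the matrix of the adjoint action: Ad(e) v_k is the sum over l of e(adm l k) v_l. *)
Let univ k : point G (sdual_salg B) :=
  conjpt (shom_compose (dinj B) pr) (xp char2 (v k) (dvar B)).
Definition adm (l k : nat) : B := dim (univ k (a l)).

Fact univ_dre k y : dre (univ k y) = (eps y)%:A.
Proof.
rewrite -(ddropE char2) -[LHS]/(shom_compose (ddrop B char2) (univ k) y).
rewrite conjpt_natural xp_natural ?ddropE //; last exact: dvar_odd.
by rewrite xp0 // conjpt1 epsE.
Qed.

(** At an even element the coefficient of s is an odd element of K[E], hence 0. *)
Fact univ_even k y : is_even y -> univ k y = (eps y)%:A.
Proof.
move=> hy; have := shom_homog (univ k) hy; have := univ_dre k y.
case: (univ k y) => p q /= -> /sdual_even[_ /= hq].
have -> : q = 0 by rewrite -(Eev q) (hpart_other hq).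
have -> : ((eps y)%:A : sdual_salg B) = dinj B (eps y)%:A by rewrite shom_scal1.
by [].
Qed.

Fact univE k y : univ k y = (eps y)%:A + \sum_(l < d) v l y *: (dinj B (adm l k) * dvar B).
Proof.
rewrite -{1}(salg_compD y) shomD univ_even; last exact: hpart_homog.
have -> : eps (hpart false y) = eps y.
  by rewrite -[in RHS](salg_compD y) epsD (eps_odd (hpart_homog true y)) addr0.
congr (_ + _); have [s [sP e]] := cotangent_spanE va_span (hpart_homog true y).
rewrite e shomD shom_sum [X in _ + X]shom_sum [X in _ + X]big_seq [X in _ + X]big1 ?addr0.
  apply: eq_bigr => l _; rewrite shomZ; congr (_ *: _).
    rewrite -[in RHS](salg_compD y) -[hpart false y]scale1r (tan_lin (hv l)).
    by rewrite (tan_even (hv l) (hpart_homog false y)) mulr0 add0r.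
  by rewrite [LHS]ddecomp univ_dre (eps_odd (a_odd (ltn_ord l))) scale0r shom0 add0r.
by move=> p /sP[h1 h2 h3]; rewrite shomM univ_even // h2 scale0r mul0r.
Qed.

Lemma conj_xp R (e : point E R) k (b : R) y : is_odd b ->
  conjpt (point_map i e) (xp char2 (v k) b) y =
    (eps y)%:A + \sum_(l < d) v l y *: (e (adm l k) * b).
Proof.
move=> hb; pose u : SHom (sdual_salg B) R := dhom char2 e hb.
have ud x : u (dinj B x) = e x.
  by rewrite -[LHS]/(shom_compose u (dinj B) x) dhom_inj.
have -> : conjpt (point_map i e) (xp char2 (v k) b) = shom_compose u (univ k).
  rewrite conjpt_natural xp_natural //; last exact: dvar_odd.
  by rewrite dhom_var shom_composeA dhom_inj.
rewrite -[LHS]/(u (univ k y)) univE shomD shom_scal1 shom_sum; congr (_ + _).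
by apply: eq_bigr => l _; rewrite shomZ shomM ud dhom_var.
Qed.

Fact coef_extract R (c c' : nat -> R) :
  (forall y, \sum_(l < d) v l y *: (dinj R (c l) * dvar R) =
             \sum_(l < d) v l y *: (dinj R (c' l) * dvar R)) ->
  forall l, (l < d)%N -> c l = c' l.
Proof.
move=> h l ld; have := h (a l).
have E2 (f : nat -> R) : \sum_(m < d) v m (a l) *: (dinj R (f m) * dvar R) = dinj R (f l) * dvar R.
  rewrite (bigD1 (Ordinal ld)) //= va // eqxx scale1r big1 ?addr0 // => m ml.
  rewrite va // (_ : (m == l :> nat) = false) ?scale0r //; exact/negbTE.
rewrite !E2 => /(congr1 (@dim _ _)) /=.
by rewrite !mulr1 !mul0r !addr0.
Qed.

(** Conjugation by ef is computed at once and in two stages; a fresh odd variable, removed by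
    [coef_extract], separates the coordinates. *)
Lemma adm_mul R (e f : point E R) l k : (l < d)%N -> 
  pmul e f (adm l k) = \sum_(j < d) e (adm l j) * f (adm j k).
Proof.
move=> ld; pose j := dinj R.
pose c l := pmul e f (adm l k); pose c' l := \sum_(j < d) e (adm l j) * f (adm j k).
rewrite -[LHS]/(c l) -[RHS]/(c' l); apply: coef_extract => // y.
have ev (S : SAlg K) (g : point E S) x : is_even (g x) by apply: shom_homog; apply: Eev.
apply: (addrI (eps y)%:A).
have e1 := conj_xp (shom_compose j (pmul e f)) k y (dvar_odd R).
have -> : (eps y)%:A + \sum_(l < d) v l y *: (j (c l) * dvar R) =
   conjpt (point_map i (shom_compose j (pmul e f))) (xp char2 (v k) (dvar R)) y.
  by rewrite e1.
rewrite pmul_natural point_mapM conjpt_mul.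
have -> : conjpt (point_map i (shom_compose j f)) (xp char2 (v k) (dvar R)) =
    lpt char2 v d (fun l => j (f (adm l k))) (dvar R).
  apply: shom_ext => z; rewrite conj_xp ?lptE //; try exact: dvar_odd.
  by move=> m; apply: shom_homog.
rewrite (@conjpt_lpt _ char2 _ v d d _ _ (fun l m => j (e (adm l m)))).
- congr (_ + _); apply: eq_bigr => m _; congr (_ *: _).
  by rewrite /c' shom_sum mulr_suml; apply: eq_bigr => p _; rewrite shomM.
- by move=> m p; apply: shom_homog.
- by move=> m; apply: shom_homog.
- exact: dvar_odd.
- by move=> m b z md hb; rewrite conj_xp.
Qed.

Lemma adm_one R l k : (l < d)%N -> (k < d)%N -> pone E R (adm l k) = (l == k)%:R.
Proof.
move=> ld kd; pose j := dinj R.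
apply: (@coef_extract R (fun l => pone E R (adm l k)) (fun l => (l == k)%:R)) => // y.
apply: (addrI (eps y)%:A).
have e1 := conj_xp (shom_compose j (pone E R)) k y (dvar_odd R).
have -> : (eps y)%:A + \sum_(l < d) v l y *: (j (pone E R (adm l k)) * dvar R) =
   conjpt (point_map i (shom_compose j (pone E R))) (xp char2 (v k) (dvar R)) y.
  by rewrite e1.
rewrite pone_natural point_map1 /conjpt pmul1 -[pinv _]pmul1 pmulgV pmulg1.
rewrite xpE //; last exact: dvar_odd.
have jn (c : bool) : j c%:R = c%:R by case: c; rewrite ?mulr1n ?mulr0n ?shom1 ?shom0.
congr (_ + _); under eq_bigr do rewrite jn.
rewrite (bigD1 (Ordinal kd)) //= eqxx mul1r big1 ?addr0 // => m mk.
by rewrite (_ : (m == k :> nat) = false) ?mul0r ?scaler0 //; exact/negbTE.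
Qed.

Hypothesis tE : trigonalizable E.

Lemma triangular_tangent_basis : exists (v' : nat -> A -> K) (a' : nat -> A),
  [/\ forall n, tangent (v' n),
      forall k, (k < d)%N -> is_odd (a' k),
      forall k l, (k < d)%N -> (l < d)%N -> v' k (a' l) = (k == l)%:R,
      cotangent_span d v' a' &
      forall n R (b : R) (e : point G R), (n < d)%N -> is_odd b -> evenpt e ->
        cell char2 v' n.+1 (pmul (xp char2 (v' n) b) e)].
Proof.
(* Transposed to suit the row convention of [flag]. *)
pose X : 'M[B]_d := \matrix_(k, l) adm l k.
have ev R (g : point E R) x : is_even (g x) by apply: shom_homog; apply: Eev.
have XM R (g h : point E R) : map_mx (pmul g h) X = map_mx h X *m map_mx g X.
  apply/matrixP => k l; rewrite !mxE adm_mul //; apply: eq_bigr => j _.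
  by rewrite !mxE even_comm_l.
have X1 R : map_mx (pone E R) X = 1%:M.
  by apply/matrixP => k l; rewrite !mxE adm_one // eq_sym.
have [P [L [uP Ll PX]]] := flag Eev tE XM X1.
pose P' := invmx P.
(* The new vectors are given by the rows of [P], the dual elements by the columns of its inverse.
   Indices from d on receive the zero functional, which is tangent. *)
pose v' (k : nat) (y : A) : K := if insub k is Some o then \sum_(j < d) P o j * v j y else 0.
pose a' (k : nat) : A := if insub k is Some o then \sum_(j < d) P' j o *: a j else 0.
have v'E (k : 'I_d) y : v' k y = \sum_(j < d) P k j * v j y by rewrite /v' valK.
have a'E (k : 'I_d) : a' k = \sum_(j < d) P' j k *: a j by rewrite /a' valK.
have hv' n : tangent (v' n).
  rewrite /v'; case: insubP => [o _ _|_]; last first.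
    by split=> *; rewrite ?mulr0 ?mul0r ?addr0.
  split=> [c x y|x hx|x y].
  - rewrite mulr_sumr -big_split; apply: eq_bigr => j _.
    by rewrite (tan_lin (hv j)) mulrDr mulrCA.
  - by rewrite big1 // => j _; rewrite (tan_even (hv j)) ?mulr0.
  - rewrite mulr_sumr mulr_suml -big_split; apply: eq_bigr => j _.
    by rewrite (tan_der (hv j)) mulrDr; congr (_ + _); [exact: mulrCA|exact: mulrA].
have vsum (j : 'I_d) y : \sum_(k < d) P' j k * v' k y = v j y.
  under eq_bigr do rewrite v'E mulr_sumr.
  rewrite exchange_big (bigD1 j) //=.
  have e (m : 'I_d) : \sum_(k < d) P' j k * (P k m * v m y) = (j == m)%:R * v m y.
    have := mulVmx uP => /matrixP/(_ j m); rewrite !mxE => <-.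
    by rewrite mulr_suml; apply: eq_bigr => k _; rewrite mulrA.
  rewrite e eqxx mul1r big1 ?addr0 // => m mj.
  by rewrite e eq_sym (negbTE mj) mul0r.
exists v', a'; split => //.
- move=> k kd; rewrite -[k]/(val (Ordinal kd)) a'E; apply: homog_sum => j _.
  by apply: homogZ; apply: a_odd.
- move=> k l kd ld; rewrite -[k]/(val (Ordinal kd)) -[l]/(val (Ordinal ld)) v'E a'E.
  have := mulmxV uP => /matrixP/(_ (Ordinal kd) (Ordinal ld)); rewrite !mxE => <-.
  apply: eq_bigr => j _; congr (_ * _).
  have vl : forall (I : seq 'I_d), v j (\sum_(m <- I) P' m (Ordinal ld) *: a m) =
      \sum_(m <- I) P' m (Ordinal ld) * v j (a m).
    elim=> [|m I ih]; first by rewrite !big_nil tan0.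
    by rewrite !big_cons (tan_lin (hv j)) ih.
  rewrite vl (bigD1 j) //= va // eqxx mulr1 big1 ?addr0 // => m mj.
  by rewrite va // eq_sym (_ : (m == j :> nat) = false) ?mulr0 //; apply/negbTE.
- move=> y /va_span; congr (cotangent_null (_ - _)).
  under [RHS]eq_bigr do rewrite a'E scaler_sumr.
  rewrite exchange_big; apply: eq_bigr => j _.
  rewrite -vsum scaler_suml; apply: eq_bigr => k _.
  by rewrite scalerA mulrC.
move=> n R b e nd hb he.
have /(evenptP hE)[f fE] := evenptV hE he.
pose o := Ordinal nd.
pose r (m : nat) : R := if insub m is Some p then f (L o p) else 0.
have rE (m : 'I_d) : r m = f (L o m) by rewrite /r valK.
have hr m : is_even (r m).
  by rewrite /r; case: insubP => [p _ _|_]; [exact: ev|exact: homog0].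
(* Moving e to the left conjugates x_n(b) by e^-1, the point given by [f]. The coefficients are row
   n of the lower triangular [L], so only x_0, ..., x_n occur. *)
have -> : pmul (xp char2 (v' n) b) e = pmul e (lpt char2 v' n.+1 r b).
  suff <- : conjpt (pinv e) (xp char2 (v' n) b) = lpt char2 v' n.+1 r b.
    by rewrite /conjpt pinvK !pmulA pmulgV pmul1.
  have -> : xp char2 (v' n) b = lpt char2 v d (fun j => (if insub j is Some p then P o p else 0)%:A) b.
    apply: shom_ext => y; rewrite xpE // lptE //; last by move=> j; apply: homogZ1.
    congr (_ + _); rewrite -[n]/(val o) v'E scaler_suml; apply: eq_bigr => j _.
    by rewrite valK -scalerAl mul1r scalerA mulrC.
  apply: shom_ext => y; rewrite -fE.
  rewrite (@conjpt_lpt _ char2 _ v d d _ _ (fun l m => f (adm l m))); last first.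
  - by move=> j c z jd hc; rewrite conj_xp.
  - exact: hb.
  - by move=> j; apply: homogZ1.
  - by move=> l m; apply: ev.
  rewrite lptE //; congr (_ + _).
  have key (l : 'I_d) : \sum_(j < d) f (adm l j) * (P o j)%:A = \sum_(m < d) f (L o m) * (P m l)%:A.
    have /matrixP/(_ o l) := PX; rewrite !mxE => /(congr1 f); rewrite !shom_sum => h.
    under [RHS]eq_bigr => m _ do [have -> : f (L o m) * (P m l)%:A = f (L o m * smx E P m l) by rewrite mxE shomM shom_scal1].
    rewrite -h; apply: eq_bigr => j _.
    by rewrite !mxE shomM shom_scal1 even_comm_l.
  have -> : \sum_(j < n.+1) v' j y *: (r j * b) = \sum_(j < d) v' j y *: (r j * b).
    rewrite (big_ord_widen _ (fun j => v' j y *: (r j * b)) nd) big_mkcond /=.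
    apply: eq_bigr => j _; case: ltnP => // nj.
    by rewrite rE Ll // shom0 mul0r scaler0.
  transitivity (\sum_(l < d) v l y *: (\sum_(m < d) f (L o m) * (P m l)%:A * b)).
    apply: eq_bigr => l _; congr (_ *: _); rewrite -[RHS]mulr_suml -key mulr_suml.
    by apply: eq_bigr => j _; rewrite valK.
  under eq_bigr do rewrite scaler_sumr.
  rewrite exchange_big; apply: eq_bigr => m _.
  rewrite rE v'E scaler_suml; apply: eq_bigr => l _.
  by rewrite -scalerAr mulr1 -scalerAl scalerA mulrC.
have : evenpt e by [].
elim: (n.+1) => [|m ih] he'; first by rewrite /= pmulg1.
exists (pmul e (lpt char2 v' m r b)), (r m * b); split.
- exact: even_odd_mul.
- exact: ih.
- by rewrite /= pmulA.
Qed.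

End Adjoint.

(** * The even part *)

Section LocalFiniteness.
Variables (K : fieldType) (G : supergroup K).
Let A := coord_alg G.
Implicit Types R : SAlg K.

Lemma dual_family (W : lmodType K) n (b : 'I_n -> W) :
  (forall c : 'I_n -> K, \sum_k c k *: b k = 0 -> forall k, c k = 0) ->
  exists beta : 'I_n -> W -> K, (forall k, linear (beta k : W -> K^o)) /\
    forall k l, beta k (b l) = (k == l)%:R.
Proof.
move=> bfree; pose f (u : 'rV[K]_n) := \sum_k u 0 k *: b k.
have fL : linear f.
  move=> c u w; rewrite /f scaler_sumr -big_split; apply: eq_bigr => k _.
  by rewrite !mxE scalerDl scalerA.
have fI : injective f.
  move=> u w e; apply/rowP => k; apply/eqP; rewrite -subr_eq0; apply/eqP.
  apply: (bfree (fun k => u 0 k - w 0 k)).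
  under eq_bigr do rewrite scalerBl.
  by rewrite sumrB -[X in X - _]/(f u) e subrr.
have [r [rL rf]] := linear_retraction fL fI.
exists (fun k x => r x 0 k); split=> [k c x y|k l]; first by rewrite rL !mxE.
have -> : b l = f (delta_mx 0 l).
  rewrite /f (bigD1 l) //= mxE !eqxx scale1r big1 ?addr0 // => m ml.
  by rewrite mxE (negbTE ml) andbF scale0r.
by rewrite rf mxE eqxx.
Qed.

Lemma solve_for (W : lmodType K) n (b : 'I_n.+1 -> W) (u : 'I_n.+1 -> K) o :
  u o != 0 -> \sum_k u k *: b k = 0 ->
  b o = - \sum_(k < n) (u (lift o k) / u o) *: b (lift o k).
Proof.
move=> uo; rewrite (bigD1_ord o) //= => /eqP; rewrite addr_eq0 => /eqP e.
apply: (scalerI uo); rewrite e scalerN scaler_sumr; congr (- _); apply: eq_bigr => k _.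
by rewrite scalerA mulrCA mulfV // mulr1.
Qed.

Definition splits n (y : A) (b c : 'I_n -> A) : Prop :=
  forall R (g h : point G R), pmul g h y = \sum_k g (b k) * h (c k).

Lemma splits_ex y : exists n (b c : 'I_n -> A), splits y b c.
Proof.
have [s sE] := comult_list y.
exists (size s), (fun k => (nth (0, 0) s k).1), (fun k => (nth (0, 0) s k).2) => R g h.
by rewrite sE (big_nth (0, 0)) big_mkord.
Qed.

(** In a decomposition of least length both families are free, because a relation would allow one
    term to be absorbed into the others. *)
Lemma splits_min y : exists n (b c : 'I_n -> A), [/\ splits y b c,
   forall u : 'I_n -> K, \sum_k u k *: b k = 0 -> forall k, u k = 0 &
   forall u : 'I_n -> K, \sum_k u k *: c k = 0 -> forall k, u k = 0].
Proof.
have exP : exists n, asbool (exists b c : 'I_n -> A, splits y b c).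
  by have [n h] := splits_ex y; exists n; apply/asboolP.
case: (ex_minnP exP) => -[|n] /asboolP[b [c sp]] nmin; exists _, b, c.
  by split => // u _ [].
have nlt : ~ exists b' c' : 'I_n -> A, splits y b' c'.
  by move=> h; have := nmin n; rewrite ltnn => /(_ (asboolT h)).
split => // u u0 o; apply: contrapT => /eqP uo; apply: nlt.
  exists (fun k => b (lift o k)), (fun k => c (lift o k) - (u (lift o k) / u o) *: c o) => R g h.
  rewrite sp (bigD1_ord o) //= {1}(solve_for uo u0) shomN shom_sum mulNr mulr_suml addrC -sumrB.
  by apply: eq_bigr => k _; rewrite shomB !shomZ mulrBr -scalerAl -scalerAr.
exists (fun k => b (lift o k) - (u (lift o k) / u o) *: b o), (fun k => c (lift o k)) => R g h.
rewrite sp (bigD1_ord o) //= {1}(solve_for uo u0) shomN shom_sum mulrN mulr_sumr addrC -sumrB.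
by apply: eq_bigr => k _; rewrite shomB !shomZ mulrBl -scalerAl -scalerAr.
Qed.

Section Slices.
Variables (W : lmodType K) (beta : W -> K).
Hypothesis bL : linear (beta : W -> K^o).
Lemma slicel_bilin (V : lmodType K) : bilinear_map (fun (x : W) (r : V) => beta x *: r).
Proof.
split=> [r c x y|x c r s]; first by rewrite bL scalerDl -scalerA.
by rewrite scalerDr !scalerA mulrC.
Qed.
Lemma slicer_bilin (V : lmodType K) : bilinear_map (fun (r : V) (x : W) => beta x *: r).
Proof.
split=> [x c r s|r c x y]; last by rewrite bL scalerDl -scalerA.
by rewrite scalerDr !scalerA mulrC.
Qed.
End Slices.

Lemma bilin_sum (V W U : lmodType K) (f : V -> W -> U) (I : Type) (r : seq I) (x : I -> V) (z : I -> W) :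
  bilinear_map f -> tensor_lift f (\sum_(k <- r) tens (x k) (z k)) = \sum_(k <- r) f (x k) (z k).
Proof.
move=> fb; elim: r => [|k r ih]; first by rewrite !big_nil; apply: tensor_lift0.
rewrite !big_cons -ih -(tensor_lift_tens (x k) (z k) fb); exact: tensor_liftD.
Qed.

(** Write Delta(y) as a sum of b_k (x) c_k of least length. Coassociativity, sliced by the dual
    family of the b_k, gives Delta(c_k) as the sum of the T_kl (x) c_l; slicing by the dual family
    of the c_l makes [T] multiplicative. The counit laws recover y from its entries. *)
Lemma matrix_coefficients y : exists n (T : 'M[A]_n) (al be : 'I_n -> K),
  [/\ forall R (g h : point G R), map_mx (pmul g h) T = map_mx g T *m map_mx h T,
      forall R, map_mx (pone G R) T = 1%:M &
      y = \sum_k \sum_l (al k * be l) *: T k l].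
Proof.
have [n [b [c [sp bfree cfree]]]] := splits_min y.
have [beta [bL bE]] := dual_family bfree; have [gam [gL gE]] := dual_family cfree.
have clP x : exists s : seq (A * A), forall R (g h : point G R),
    pmul g h x = \sum_(p <- s) g p.1 * h p.2 by exact: comult_list.
have [cl clE] := boolp.choice clP.
pose T : 'M[A]_n := \matrix_(k, l) \sum_(p <- cl (b l)) beta k p.1 *: p.2.
have cT R (g h : point G R) k : pmul g h (c k) = \sum_l g (T k l) * h (c l).
  (* The slice acts on A, so the first factor is the universal point, while [g] and [h] keep their
     values in [R]. *)
  pose f : point G (stensor_salg A R) := sinl.
  pose g' : point G (stensor_salg A R) := shom_compose sinr g.
  pose h' : point G (stensor_salg A R) := shom_compose sinr h.
  have e1 : pmul f (pmul g' h') y = \sum_m tens (b m) (pmul g h (c m)).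
    rewrite sp; apply: eq_bigr => m _.
    by rewrite -pmul_natural; exact: esym (stens_sinlr (b m) (pmul g h (c m))).
  have e2 : pmul (pmul f g') h' y =
      \sum_m \sum_(p <- cl (b m)) tens p.1 (g p.2 * h (c m)).
    rewrite sp; apply: eq_bigr => m _; rewrite clE mulr_suml; apply: eq_bigr => p _.
    rewrite -[RHS]/(stens p.1 (g p.2 * h (c m)) : stensor_salg A R) stens_sinlr.
    by rewrite -mulrA shomM.
  have := congr1 (tensor_lift (fun (x : A) (r : R) => beta k x *: r)) (etrans (esym e1) (etrans (congr1 (fun q : point G _ => q y) (pmulA f g' h')) e2)).
  rewrite (bilin_sum _ _ _ (slicel_bilin (bL k) R)).
  rewrite (bigD1 k) //= bE eqxx scale1r big1 ?addr0; last first.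
    by move=> m mk; rewrite bE eq_sym (negbTE mk) scale0r.
  move=> ->.
  have sl := tensor_lift_linear (slicel_bilin (bL k) R).
  rewrite (big_morph (tensor_lift (fun (x : A) (r : R) => beta k x *: r)) (id1 := 0) (op1 := +%R)); first last.
  - exact: tensor_lift0 (slicel_bilin (bL k) R).
  - by move=> u w; have := sl 1 u w; rewrite !scale1r.
  apply: eq_bigr => m _; rewrite (bilin_sum _ _ _ (slicel_bilin (bL k) R)).
  rewrite mxE shom_sum mulr_suml; apply: eq_bigr => p _.
  by rewrite shomZ scalerAl.
have TM R (g h : point G R) k l : pmul g h (T k l) = \sum_m g (T k m) * h (T m l).
  pose g' : point G (stensor_salg R A) := shom_compose sinl g.
  pose h' : point G (stensor_salg R A) := shom_compose sinl h.
  pose w : point G (stensor_salg R A) := sinr.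
  have e1 : pmul (pmul g' h') w (c k) = \sum_m tens (pmul g h (T k m)) (c m).
    rewrite cT; apply: eq_bigr => m _.
    by rewrite -pmul_natural; exact: esym (stens_sinlr (pmul g h (T k m)) (c m)).
  have e2 : pmul g' (pmul h' w) (c k) = \sum_j tens (\sum_m g (T k m) * h (T m j)) (c j).
    rewrite cT; under eq_bigr do rewrite cT mulr_sumr.
    rewrite exchange_big; apply: eq_bigr => j _; rewrite tens_suml; apply: eq_bigr => m _.
    rewrite -[RHS]/(stens (g (T k m) * h (T m j)) (c j) : stensor_salg R A) stens_sinlr shomM.
    by rewrite -mulrA.
  have := congr1 (tensor_lift (fun (r : R) (x : A) => gam l x *: r)) (etrans (esym e1) (etrans (esym (congr1 (fun q : point G _ => q (c k)) (pmulA g' h' w))) e2)).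
  rewrite !(bilin_sum _ _ _ (slicer_bilin (gL l) R)).
  have sel (F : 'I_n -> R) : \sum_m gam l (c m) *: F m = F l.
    rewrite (bigD1 l) //= gE eqxx scale1r big1 ?addr0 // => m ml.
    by rewrite gE eq_sym (negbTE ml) scale0r.
  by rewrite !sel.
have T1 k l : eps (T k l) = (k == l)%:R.
  have e : c k = \sum_m eps (T k m) *: c m.
    transitivity (pmul (pone G A) (shom_id A) (c k)); first by rewrite pmul1.
    rewrite cT.
    by apply: eq_bigr => m _; rewrite epsE -scalerAl mul1r.
  have gs (I : seq 'I_n) (u : 'I_n -> K) :
      gam l (\sum_(m <- I) u m *: c m) = \sum_(m <- I) u m * gam l (c m).
    elim: I => [|m I ih]; last by rewrite !big_cons gL ih.
    rewrite !big_nil; have := gL l (-1) 0 0; rewrite scaler0 addr0 scaleN1r addNr.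
    by [].
  have := gE l k; rewrite e gs (bigD1 l) //= gE eqxx mulr1 big1 ?addr0 => [->|m ml].
    by rewrite eq_sym.
  by rewrite gE eq_sym (negbTE ml) mulr0.
clearbody T; exists n, T, (fun k => eps (b k)), (fun l => eps (c l)); split.
- by move=> R g h; apply/matrixP => k l; rewrite !mxE TM; apply: eq_bigr => m _; rewrite !mxE.
- move=> R; apply/matrixP => k l; rewrite mxE [RHS]mxE epsE T1.
  by case: eqP => _; rewrite ?scale1r ?scale0r.
have yE : y = \sum_k eps (b k) *: c k.
  transitivity (pmul (pone G A) (shom_id A) y); first by rewrite pmul1.
  rewrite sp.
  by apply: eq_bigr => k _; rewrite epsE -scalerAl mul1r.
rewrite {1}yE; apply: eq_bigr => k _.
have -> : c k = \sum_l eps (c l) *: T k l.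
  transitivity (pmul (shom_id A) (pone G A) (c k)); first by rewrite pmulg1.
  rewrite cT.
  by apply: eq_bigr => l _; rewrite epsE -scalerAr mulr1.
by rewrite scaler_sumr; apply: eq_bigr => l _; rewrite scalerA.
Qed.
End LocalFiniteness.

(** * Solvability of trigonalizable groups *)

Section Trigonalizable.
Variables (K : fieldType) (E : supergroup K).
Hypotheses (Eev : forall c : coord_alg E, is_even c) (tE : trigonalizable E).
Let A := coord_alg E.
Implicit Types R : SAlg K.

Lemma triangular_coefficients y : exists n (L : 'M[A]_n),
  [/\ forall R (g h : point E R), map_mx (pmul g h) L = map_mx h L *m map_mx g L,
      forall R, map_mx (pone E R) L = 1%:M,
      forall i j : 'I_n, (i < j)%N -> L i j = 0 &
      forall R (g : point E R), map_mx g L = 1%:M -> g y = pone E R y].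
Proof.
have [n [T [al [be [TM T1 yE]]]]] := matrix_coefficients y.
have ev R (g : point E R) x : is_even (g x) by apply: shom_homog; apply: Eev.
have XM R (g h : point E R) : map_mx (pmul g h) T^T = map_mx h T^T *m map_mx g T^T.
  rewrite -map_trmx TM; apply/matrixP => k l; rewrite !mxE; apply: eq_bigr => m _.
  by rewrite !mxE even_comm_l.
have X1 R : map_mx (pone E R) T^T = 1%:M by rewrite -map_trmx T1 trmx1.
have [P [L [uP Ll PX]]] := flag Eev tE XM X1.
have LE : L = smx E P *m T^T *m smx E (invmx P).
  by rewrite PX -mulmxA -smxM mulmxV // smx1 mulmx1.
have Lg R (g : point E R) : map_mx g L =
    map_mx (in_alg R) P *m map_mx g T^T *m map_mx (in_alg R) (invmx P).
  by rewrite LE !map_mxM !smx_point.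
have PVP R : map_mx (in_alg R) (invmx P) *m map_mx (in_alg R) P = 1%:M.
  by rewrite -map_mxM mulVmx // map_mx1.
have PPV R : map_mx (in_alg R) P *m map_mx (in_alg R) (invmx P) = 1%:M.
  by rewrite -map_mxM mulmxV // map_mx1.
exists n, L; split => //.
- move=> R g h; rewrite !Lg XM !mulmxA; congr (_ *m _ *m _).
  by rewrite -[RHS]mulmxA PVP mulmx1.
- by move=> R; rewrite Lg X1 mulmx1 PPV.
move=> R g; rewrite Lg => g1.
have gT : map_mx g T = 1%:M.
  apply: trmx_inj; rewrite trmx1 map_trmx.
  have : map_mx (in_alg R) (invmx P) *m (map_mx (in_alg R) P *m map_mx g T^T *m map_mx (in_alg R) (invmx P)) *m map_mx (in_alg R) P = 1%:M.
    by rewrite g1 mulmx1 PVP.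
  by rewrite !mulmxA PVP mul1mx -mulmxA PVP mulmx1.
rewrite yE !shom_sum; apply: eq_bigr => k _; rewrite !shom_sum; apply: eq_bigr => l _.
rewrite !shomZ; congr (_ *: _).
have /matrixP/(_ k l) := etrans gT (esym (T1 R)).
by rewrite !mxE.
Qed.

Section Chain.
Variables (n : nat) (L : 'M[A]_n).
Hypotheses
  (LM : forall R (g h : point E R), map_mx (pmul g h) L = map_mx h L *m map_mx g L)
  (L1 : forall R, map_mx (pone E R) L = 1%:M)
  (Ll : forall i j : 'I_n, (i < j)%N -> L i j = 0).
Variable F : forall R, point E R -> Prop.

(** Agreement with the identity on all diagonals i - j < k: for k = 0 triangularity gives it, for k
    = n it says that [L] becomes 1. *)
Let band k R (g : point E R) : Prop :=
  F g /\ forall i j : 'I_n, (i < j + k)%N -> g (L i j) = (i == j)%:R.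

Fact LM' R (g h : point E R) i j : pmul g h (L i j) = \sum_m h (L i m) * g (L m j).
Proof.
have /matrixP/(_ i j) := LM g h; rewrite !mxE => ->.
by apply: eq_bigr => m _; rewrite !mxE.
Qed.
Fact L1' R i j : pone E R (L i j) = (i == j)%:R.
Proof. by have /matrixP/(_ i j) := L1 R; rewrite !mxE. Qed.

(** On diagonal k the entries restrict to grouplike functions if k = 0 and to primitive ones if k >
    0. In the product formula an index other than p and q contributes 0, either by triangularity or
    because L p m lies on a lower diagonal, where it is already trivial. *)
Fact band_step k : solvable_within (band k.+1) -> solvable_within (band k).
Proof.
move=> sk; apply: solvable_within_step sk _ => D j cj jF R d kd.
have [Fd bd] := jF R d; split => // p q pq.
have [pk|] := boolP (p < q + k)%N; first exact: bd.
rewrite -leqNgt => pk; have pqk : (p = q + k :> nat)%N.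
  by apply/eqP; rewrite eqn_leq pk andbT -ltnS -addnS.
pose x := comorphism j (L p q).
have ev S (g : point D S) z : is_even (g (comorphism j z)).
  by apply: shom_homog; apply: shom_homog; apply: Eev.
rewrite -[LHS]/(d x).
have xM S (g h : point D S) :
    pmul g h x = \sum_m point_map j h (L p m) * point_map j g (L m q).
  by rewrite -LM' -point_mapM.
have ex : eps x = (p == q)%:R.
  rewrite eps_comorphism; have := L1' (base_salg K) p q; rewrite -[LHS]/(eps (L p q)) => ->.
  by case: eqP.
have zero S (g h : point D S) (m : 'I_n) : m != p -> m != q ->
    point_map j h (L p m) * point_map j g (L m q) = 0.
  move=> mp mq; have [pm|mp'] := ltnP p m; first by rewrite Ll // shom0 mul0r.
  have [mq'|qm] := ltnP m q; first by rewrite [L m q]Ll // shom0 mulr0.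
  have [_ bh] := jF S h; rewrite bh; last first.
    by rewrite pqk ltn_add2r ltn_neqAle qm andbT eq_sym.
  by rewrite eq_sym (negbTE mp) mul0r.
case: k jF bd pq pk pqk {zero} (zero) => [|k] jF bd pq pk pqk zero.
  have e : p = q by apply: val_inj; rewrite /= pqk addn0.
  subst q; rewrite eqxx; apply: (kills_grouplike _ _ _ kd).
  - by rewrite /x; apply: shom_homog; apply: Eev.
  - by rewrite ex eqxx.
  move=> S g h; rewrite xM (bigD1 p) //= big1 ?addr0 => [|m mp]; last exact: zero.
  exact: even_comm_l (ev _ h _).
have npq : p != q.
  by apply/eqP => e; move: pqk; rewrite e => /eqP; rewrite -{1}[nat_of_ord q]addn0 eqn_add2l.
rewrite (negbTE npq); apply: (kills_primitive _ _ kd).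
  by rewrite /x; apply: shom_homog; apply: Eev.
move=> S g h; rewrite xM (bigD1 p) // (bigD1 q) ?[q == p]eq_sym // big1 ?addr0; last first.
  by move=> m /andP[mp mq]; apply: zero.
have [_ bg] := jF S g; have [_ bh] := jF S h.
rewrite bh ?eqxx ?mul1r; last by rewrite addnS ltnS leq_addr.
rewrite [point_map j g (L q q)]bg ?eqxx ?mulr1; first by rewrite /= addr0.
by rewrite addnS ltnS leq_addr.
Qed.

Lemma solvable_within_triangular :
  solvable_within (fun R (g : point E R) => F g /\ map_mx g L = 1%:M) -> solvable_within F.
Proof.
move=> h.
have key k : solvable_within (band k) -> solvable_within (band 0).
  by elim: k => // k ih /band_step.
apply: solvable_within_sub (key n _) => [R g Fg|].
  split => // i j; rewrite addn0 => ij.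
  rewrite Ll // shom0 (_ : (i == j) = false) //; apply/negbTE/eqP => e.
  by rewrite e ltnn in ij.
apply: solvable_within_sub h => R g [Fg bg]; split => //.
apply/matrixP => i j; rewrite !mxE; apply: bg.
by apply: leq_trans (ltn_ord i) _; rewrite leq_addl.
Qed.
End Chain.

Lemma solvable_within_element F y :
  solvable_within (fun R (g : point E R) => F R g /\ g y = pone E R y) ->
  solvable_within F.
Proof.
move=> h; have [n [L [LM L1 Ll Ly]]] := triangular_coefficients y.
apply: (solvable_within_triangular LM L1 Ll).
by apply: solvable_within_sub h => R g [Fg /Ly].
Qed.

(** Each function in the finite list has its own triangular representation, whose kernel makes that
    function neutral; jointly they detect the neutral point. *)
Lemma solvable_within_trigonalizable (s : seq A) :
  (forall R (g : point E R), (forall y, y \in s -> g y = pone E R y) -> g = pone E R) ->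
  solvable_within (fun R (g : point E R) => True).
Proof.
move=> sP.
have : solvable_within (fun R (g : point E R) => forall y, y \in s -> g y = pone E R y).
  exact: solvable_within_trivial.
elim: s {sP} => [|y s ih] h; first by apply: solvable_within_sub h.
apply: ih; apply: (@solvable_within_element _ y).
apply: solvable_within_sub h => R g [h1 h2] z.
by rewrite inE => /orP[/eqP ->|/h1].
Qed.
End Trigonalizable.

(** * Solvability of the supergroup *)

Section Main.
Variables (K : fieldType) (char2 : 2%N \notin [pchar K]).
Variables (G E : supergroup K) (i : supergroup_hom E G).
Hypotheses (hE : is_even_part i) (tE : trigonalizable E) (hG : algebraic_supergroup G).
Implicit Types R : SAlg K.

Lemma solvable_within_evenpt : solvable_within (fun R (g : point G R) => evenpt g).
Proof.
have Eev := even_part_even hE; have [ci _] := hE.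
have sE : solvable_within (fun R (g : point E R) => True).
  have [s sP] := hG.
  apply: (solvable_within_trigonalizable Eev tE (s := [seq comorphism i x | x <- s])) => R g h.
  apply: (point_map_inj ci); apply: shom_ext; apply: sP.
  - by move=> x xs; apply: h; apply: map_f.
  - by rewrite !shom1.
  - by move=> c x y hx hy; rewrite !shomP hx hy.
  - by move=> x y hx hy; rewrite !shomM hx hy.
move=> D j cj jev.
(* The universal point of [D] is even, so the inclusion of [D] factors through E, where solvability
   is already known. *)
have /(evenptP hE)[e eE] := jev _ (shom_id (coord_alg D)).
rewrite /point_map shom_1compose in eE.
have eM R (g h : point D R) : shom_compose (pmul g h) e = pmul (shom_compose g e) (shom_compose h e).
  apply: (point_map_inj ci); rewrite point_mapM !point_map_natural /point_map eE.
  exact: comorphismM.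
apply: (sE D (MkSupergroupHom eM)) => // a; have [b hb] := cj a.
exists (comorphism i b); rewrite -hb -eE.
by [].
Qed.

Lemma even_trigonalizable_solvable : solvable_supergroup G.
Proof.
have [L [L_odd L_gen]] := odd_generators hG.
have [d [a0 [v0 [hv0 a0_odd va0 va0_span]]]] := tangent_basis L_odd L_gen.
have [v [a [hv a_odd va va_span conj]]] :=
  triangular_tangent_basis char2 hE hv0 a0_odd va0 va0_span tE.
have [sj _] := cell_pt_bij char2 hE hv a_odd va va_span L_odd L_gen.
(* The bijectivity result covers n = d; surjectivity descends to smaller n by setting the last
   variables to 0. *)
have sj' n : (n <= d)%N -> forall b, exists x, cell_pt i char2 v n x = b.
  move=> nd; rewrite -(subKn nd); elim: (d - n)%N (leq_subr n d) => [|k ih] kd.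
    by rewrite subn0.
  have {ih} := ih (ltnW kd).
  rewrite -[(d - k)%N]prednK ?subn_gt0 // -subnS.
  exact: cell_pt_surj_pred.
have key n : (n <= d)%N -> solvable_within (cell char2 v n).
  elim: n => [|n ih] nd; first exact: solvable_within_evenpt.
  by apply: (solvable_within_cellS hE hv conj nd (sj' _ nd)); apply: ih; apply: ltnW.
apply: solvable_within_all; apply: solvable_within_sub (key d (leqnn d)) => R g _.
exact: (cell_all char2 hE hv a_odd va va_span L_odd L_gen).
Qed.
End Main.

Theorem corollary6p3 (K : fieldType) (hK : 2%N \notin [pchar K])
    (G : supergroup K) (hG : algebraic_supergroup G)
    (hev : even_trigonalizable G) :
  solvable_supergroup G.
Proof.
have [E [i [hE tE]]] := hev; exact: (even_trigonalizable_solvable hK hE tE hG).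
Qed.
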